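(* Let $f=(f_1,\dots,f_n)$ be an $n$-tuple of formal power series with the radial approximation property, let $\mathcal P\subset\mathbb C[Z_1,\dots,Z_n]$ be a set of homogeneous noncommutative polynomials, and let $B=(B_1,\dots,B_n)$ be the universal model associated with $f$ and the WOT-closed two-sided ideal $J_{\mathcal P\circ f}$ generated by $q(f(M_Z))$, $q\in\mathcal P$, in the Hardy algebra $H^\infty(\mathbb B_f)$. If $\mathcal H$ is a Hilbert space and the $n$-tuple $T=(T_1,\dots,T_n)\in\mathbb B_f(\mathcal H)$ has the property that $$(q\circ f)(T)=0,\qquad q\in\mathcal P,$$ then the linear map $\Psi_{f,T,\mathcal P}:\overline{\mathrm{span}}\{B_\alpha B_\beta^*:\alpha,\beta\in\mathbb F_n^+\}\to B(\mathcal H)$ defined by $$\Psi_{f,T,\mathcal P}(B_\alpha B_\beta^* ):=T_\alpha T_\beta^*,\qquad\alpha,\beta\in\mathbb F_n^+,$$ is completely contractive.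
   Context: Words and series. $\mathbb F_n^+$ is the free semigroup of words in the letters $1,\dots,n$, with empty word $\varnothing$; $|\alpha|$ is the length of $\alpha$. For an $n$-tuple $Y=(Y_1,\dots,Y_n)$ of elements of a unital algebra, $Y_\alpha:=Y_{i_1}\cdots Y_{i_k}$ if $\alpha=i_1\cdots i_k$, and $Y_\varnothing:=1$. Power series are formal power series $\psi=\sum_\alpha a_\alpha Z_\alpha$ with complex coefficients in noncommuting indeterminates $Z_1,\dots,Z_n$. For $Y\in B(\mathcal H)^n$ put $\psi(Y):=\sum_{k\ge0}\sum_{|\alpha|=k}a_\alpha Y_\alpha$ (series over $k$); $\mathcal C_\psi(\mathcal H)$ (resp. $\mathcal C_\psi^{SOT}(\mathcal H)$) is the set of $Y$ for which this converges in norm (resp. in the strong operator topology, SOT). $\mathcal C_\psi^{rad}(\mathcal H)$ is the set of $Y$ for which there is $\delta\in(0,1)$ with $rY\in\mathcal C_\psi(\mathcal H)$ for $r\in(\delta,1)$ and $\text{SOT-}\lim_{r\to1}\psi(rY)$ exists; then $\psi(Y)$ denotes this limit. For an $n$-tuple $f=(f_1,\dots,f_n)$ of power series these conditions are required for every $f_i$; $f(Y)=(f_1(Y),\dots,f_n(Y))$ is also regarded as a row operator $\mathcal H^{(n)}\to\mathcal H$, where $\mathcal H^{(n)}$ is the direct sum of $n$ copies of $\mathcal H$. $[B(\mathcal H)^n]_r:=\{X\in B(\mathcal H)^n:\|\sum_iX_iX_i^*\|^{1/2}<r\}$. A free holomorphic function on $[B(\mathcal H)^n]_\gamma$ is (the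 evaluation map of) a power series with $\limsup_k(\sum_{|\alpha|=k}|a_\alpha|^2)^{1/2k}\le1/\gamma$. Model property. $\mathbb H^2(f)$ denotes the Hilbert space with orthonormal basis $\{f_\alpha\}_{\alpha\in\mathbb F_n^+}$ ($f_\varnothing=1$), whose elements are the series $\sum_\alpha c_\alpha f_\alpha$, $\sum|c_\alpha|^2<\infty$. $f$ has the model property ($f\in\mathcal M$) if one of the following holds. ($\mathcal A$) $f$ is an $n$-tuple of noncommutative polynomials and there is an $n$-tuple $q$ of polynomials with $f\circ q=q\circ f=\mathrm{id}$. ($\mathcal S$) $f(0)=0$, each $f_i$ has nonzero radius of convergence, the matrix of linear coefficients of $f$ is invertible ($\det J_f(0)\ne0$; then elements of $\mathbb H^2(f)$ are formal power series), $Z_1,\dots,Z_n\in\mathbb H^2(f)$, each $M_{Z_i}\psi:=Z_i\psi$ is a bounded operator on $\mathbb H^2(f)$, and $M_{f_j}=f_j(M_{Z_1},\dots,M_{Z_n})$, where $M_{f_j}\psi:=f_j\psi$ and $(M_{Z_1},\dots,M_{Z_n})$ is in $\mathcal C_f^{SOT}(\mathbb H^2(f))$ or $\mathcal C_f^{rad}(\mathbb H^2(f))$. ($\mathcal F$) for some $\gamma>0$, $f$ is an $n$-tuple of free holomorphic functions on $[B(\mathcal H)^n]_\gamma$ ($\mathcal H$ infinite dimensional) with range in $[B(\mathcal H)^n]_1$, there is no nonzero free holomorphic $G$ on $[B(\mathcal H)^n]_1$ with $G\circ f=0$ (then $\mathbb H^2(f)=\{G\circ f: G=\sum c_\alpha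 Z_\alpha,\ \sum|c_\alpha|^2<\infty\}$), the coordinate functions lie in $\mathbb H^2(f)$, and the boundedness of $M_{Z_i}$ and $M_{f_j}=f_j(M_{Z_1},\dots,M_{Z_n})$ hold as in ($\mathcal S$). The universal model of $\mathbb B_f$ is $M_Z=(M_{Z_1},\dots,M_{Z_n})$. Writing $Z_i=\sum_\alpha a_\alpha^{(i)}f_\alpha$ in $\mathbb H^2(f)$, the inverse of $f$ under composition is $g=(g_1,\dots,g_n)$, $g_i:=\sum_\alpha a^{(i)}_\alpha Z_\alpha$ (so $g\circ f=\mathrm{id}$). $f$ has the radial approximation property ($f\in\mathcal M_{rad}$) if $f\in\mathcal M$ and there is $\delta\in(0,1)$ such that $rf=(rf_1,\dots,rf_n)$ has the model property for every $r\in(\delta,1]$. Domain. $\mathbb B_f(\mathcal H)$ is the set of $X\in B(\mathcal H)^n$ with $X\in\mathcal C_f^{SOT}(\mathcal H)$ or $X\in\mathcal C_f^{rad}(\mathcal H)$, $\|f(X)\|\le1$ and $g(f(X))=X$, meaning that either $X_i=\sum_k\sum_{|\alpha|=k}a_\alpha^{(i)}[f(X)]_\alpha$ (SOT convergence) for all $i$, or $X_i=\text{SOT-}\lim_{r\to1}\sum_k\sum_{|\alpha|=k}a_\alpha^{(i)}r^{|\alpha|}[f(X)]_\alpha$ for all $i$. For a noncommutative polynomial $q$ and $T\in\mathbb B_f(\mathcal H)$, $(q\circ f)(T):=q(f_1(T),\dots,f_n(T))$. Universal model of a variety. $H^\infty(\mathbb B_f)$ is the WOT-closure (weak operator topology)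 in $B(\mathbb H^2(f))$ of all polynomials in $M_{Z_1},\dots,M_{Z_n}$ and the identity. For a WOT-closed two-sided ideal $J$ of it, $\mathcal N_{f,J}:=\mathbb H^2(f)\ominus\overline{J\mathbb H^2(f)}$ and the universal model associated with $f$ and $J$ is $B=(B_1,\dots,B_n)$, $B_i:=P_{\mathcal N_{f,J}}M_{Z_i}|_{\mathcal N_{f,J}}$. The span in the claim is closed in the operator norm. *)

(* Defs.v *)
From HB Require Import structures.
From mathcomp Require Import all_boot all_order all_algebra.
From mathcomp Require Import complex.
From mathcomp Require Import lra ring.
From mathcomp Require Import all_classical all_reals all_analysis.

Set Implicit Arguments.
Unset Strict Implicit.
Unset Printing Implicit Defensive.

Import Order.TTheory GRing.Theory Num.Theory.
Import numFieldNormedType.Exports.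

Local Open Scope classical_set_scope.
Local Open Scope ring_scope.

HB.mixin Record isHilbert (R : realType) (H : Type)
    & CompleteNormedModule R[i] H := {
  hdot : {dot H for (@Num.conj R[i])} ;
  hnormE : forall x : H, `|x| ^+ 2 = hdot x x
}.

#[short(type="hilbertType")]
HB.structure Definition Hilbert (R : realType) :=
  {H of isHilbert R H & CompleteNormedModule R[i] H}.

Notation word n := (seq 'I_n).

Definition wsum (V : nmodType) (n N : nat) (F : word n -> V) : V :=
  \sum_(k < N) \sum_(a : k.-tuple 'I_n) F a.

Section WordSums.
Variables (n : nat).

Lemma eq_wsum (V : nmodType) N (F G : word n -> V) :
  F =1 G -> wsum N F = wsum N G.
Proof. by move=> FG; apply: eq_bigr => k _; apply: eq_bigr => a _. Qed.

Lemma wsumD (V : nmodType) N (F G : word n -> V) :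
  wsum N (fun a => F a + G a) = wsum N F + wsum N G.
Proof. by rewrite /wsum -big_split; apply: eq_bigr => k _; rewrite big_split. Qed.

Lemma raddf_wsum (U V : nmodType) (h : {additive U -> V}) N (F : word n -> U) :
  h (wsum N F) = wsum N (h \o F).
Proof. by rewrite raddf_sum; apply: eq_bigr => k _; rewrite raddf_sum. Qed.

Lemma wsumMl (S : pzRingType) c N (F : word n -> S) :
  wsum N (fun a => c * F a) = c * wsum N F.
Proof.
by rewrite /wsum mulr_sumr; apply: eq_bigr => k _; rewrite mulr_sumr.
Qed.

Lemma ler_wsum (S : numDomainType) N (F G : word n -> S) :
  (forall a, F a <= G a) -> wsum N F <= wsum N G.
Proof. by move=> FG; apply: ler_sum => k _; apply: ler_sum => a _. Qed.

Lemma wsum_ge0 (S : numDomainType) N (F : word n -> S) :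
  (forall a, 0 <= F a) -> 0 <= wsum N F.
Proof. by move=> F0; apply: sumr_ge0 => k _; apply: sumr_ge0. Qed.

Lemma wsum_homo (S : numDomainType) (F : word n -> S) :
  (forall a, 0 <= F a) -> nondecreasing_seq (fun N => wsum N F).
Proof.
move=> F0 N1 N2 N12; rewrite /wsum (big_ord_widen N2 (fun k => \sum_(a : k.-tuple 'I_n) F a))//.
rewrite [leRHS](bigID (fun k : 'I_N2 => (k < N1)%N))/= lerDl.
by apply: sumr_ge0 => k _; apply: sumr_ge0.
Qed.

Lemma ler_wsum_term (S : numDomainType) (F : word n -> S) (a : word n) :
  (forall a, 0 <= F a) -> F a <= wsum (size a).+1 F.
Proof.
move=> F0; rewrite /wsum big_ord_recr/= (bigD1 (in_tuple a))//=.
rewrite addrCA lerDl addr_ge0//; last exact: sumr_ge0.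
by apply: sumr_ge0 => k _; apply: sumr_ge0.
Qed.

Lemma wsum_cvgP (R : realType) (F : word n -> R) : (forall a, 0 <= F a) ->
  cvgn (fun N => wsum N F) <-> exists M, forall N, wsum N F <= M.
Proof.
move=> F0; split=> [cF|[M FM]].
  exists (limn (fun N => wsum N F)) => N.
  by apply: nondecreasing_cvgn_le => //; exact: wsum_homo.
by apply: nondecreasing_is_cvgn; [exact: wsum_homo|exists M => _ [N _ <-]].
Qed.

End WordSums.

Section SquareNorm.
Variable R : realType.
Implicit Types z w : R[i].

Definition sqn z : R := complex.Re z ^+ 2 + complex.Im z ^+ 2.

Lemma sqn_normc z : (sqn z)%:C%C = `|z| ^+ 2.
Proof. exact: add_Re2_Im2. Qed.

Lemma sqn_ge0 z : 0 <= sqn z.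
Proof. by rewrite addr_ge0 ?sqr_ge0. Qed.

Lemma sqn_eq0 z : sqn z = 0 -> z = 0.
Proof. 
by move=> z0; apply/eqP; rewrite -normr_eq0 -sqrf_eq0 -sqn_normc z0.
Qed.

Lemma sqn0 : sqn 0 = 0.
Proof. by rewrite /sqn /= expr0n addr0. Qed.

Lemma sqnM z w : sqn (z * w) = sqn z * sqn w.
Proof. by case: z w => a b [c d]; rewrite /sqn/=; ring. Qed.

Lemma sqnN z : sqn (- z) = sqn z.
Proof. by case: z => a b; rewrite /sqn/= !sqrrN. Qed.

Lemma sqnD z w : sqn (z + w) <= 2 * sqn z + 2 * sqn w.
Proof.
case: z => a b; case: w => c d; rewrite /sqn/=.
have := sqr_ge0 (a - c); have := sqr_ge0 (b - d); nra.
Qed.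

Lemma conjCE z : z^* = conjc z. Proof. by []. Qed.

Lemma Re_mulconj_le z w :
  `|complex.Re (z * w^*)| <= sqn z + sqn w.
Proof.
case: z => a b; case: w => c d; rewrite conjCE /sqn/= ler_norml.
have := sqr_ge0 (a - c); have := sqr_ge0 (b - d).
have := sqr_ge0 (a + c); have := sqr_ge0 (b + d) => *; apply/andP; split; nra.
Qed.

Lemma Im_mulconj_le z w :
  `|complex.Im (z * w^*)| <= sqn z + sqn w.
Proof.
case: z => a b; case: w => c d; rewrite conjCE /sqn/= ler_norml.
have := sqr_ge0 (a - d); have := sqr_ge0 (b - c).
have := sqr_ge0 (a + d); have := sqr_ge0 (b + c) => *; apply/andP; split; nra.
Qed.

End SquareNorm.

Section ComplexWordSeries.
Variables (R : realType) (n : nat).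
Local Notation C := R[i].
Implicit Types (u v : word n -> C).

Definition wsummable u := cvgn (fun N => complex.Re (wsum N u)) /\
  cvgn (fun N => complex.Im (wsum N u)).

Definition wseries u : C :=
  Complex (limn (fun N => complex.Re (wsum N u)))
          (limn (fun N => complex.Im (wsum N u))).

Lemma Re_wsum N u : complex.Re (wsum N u) = wsum N (fun a => complex.Re (u a)).
Proof. exact: (raddf_wsum (@complex.Re R)). Qed.

Lemma Im_wsum N u : complex.Im (wsum N u) = wsum N (fun a => complex.Im (u a)).
Proof. exact: (raddf_wsum (@complex.Im R)). Qed.

Lemma wsum_abs_cvg (F G : word n -> R) : (forall a, `|F a| <= G a) ->
  cvgn (fun N => wsum N G) -> cvgn (fun N => wsum N F).
Proof.
move=> FG cG.
have -> : (fun N => wsum N F) = (fun N => wsum N (fun a => F a + G a)) \- (fun N => wsum N G).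
  by apply/funext => N /=; rewrite wsumD addrK.
have FG0 a : 0 <= F a + G a by have := FG a; rewrite ler_norml => /andP[]; lra.
apply: is_cvgB => //; apply/(wsum_cvgP FG0).
have G0 a : 0 <= G a by exact: le_trans (normr_ge0 _) (FG a).
have /(wsum_cvgP G0)[M GM] := cG.
exists (M + M) => N; rewrite wsumD lerD// (le_trans _ (GM N))//.
by apply: ler_wsum => a; exact: le_trans (ler_norm _) (FG a).
Qed.

Lemma wsummable_le u (b : word n -> R) :
  (forall a, `|complex.Re (u a)| <= b a) ->
  (forall a, `|complex.Im (u a)| <= b a) ->
  cvgn (fun N => wsum N b) -> wsummable u.
Proof.
move=> ub1 ub2 cb; split.
  under eq_fun do rewrite Re_wsum; exact: wsum_abs_cvg cb.
under eq_fun do rewrite Im_wsum; exact: wsum_abs_cvg cb.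
Qed.

Lemma wseriesD u v : wsummable u -> wsummable v ->
  wseries (fun a => u a + v a) = wseries u + wseries v.
Proof.
move=> [cu1 cu2] [cv1 cv2]; rewrite /wseries.
transitivity (Complex 
   (limn ((fun N => complex.Re (wsum N u)) \+ (fun N => complex.Re (wsum N v))))
   (limn ((fun N => complex.Im (wsum N u)) \+ (fun N => complex.Im (wsum N v))))).
  congr Complex; apply: (congr1 (fun f : nat -> R => limn f)); apply/funext => N /=;
  by rewrite wsumD; case: (wsum N u) (wsum N v) => ? ? [? ?].
by rewrite !limD.
Qed.

Lemma wseriesZ c u : wsummable u -> wseries (fun a => c * u a) = c * wseries u.
Proof.
move=> [cu1 cu2]; rewrite /wseries; case: c => a b.
transitivity (Complex 
   (limn ((cst a \* (fun N => complex.Re (wsum N u))) \- (cst b \* (fun N => complex.Im (wsum N u)))))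
   (limn ((cst a \* (fun N => complex.Im (wsum N u))) \+ (cst b \* (fun N => complex.Re (wsum N u)))))).
  congr Complex; apply: (congr1 (fun f : nat -> R => limn f)); apply/funext => N /=;
  by rewrite wsumMl; case: (wsum N u).
have ccst (x : R) (f : nat -> R) : cvgn f -> cvgn (cst x \* f).
  by move=> cf; exact: is_cvgM (is_cvg_cst _) cf.
rewrite limB ?limD; try exact: ccst.
have lcst (x : R) (f : nat -> R) : cvgn f -> limn (cst x \* f) = x * limn f.
  move=> cf; apply: (@cvg_lim R^o) => //.
  by apply: cvgM => //; exact: cvg_cst.
by rewrite !lcst.
Qed.

Lemma wseries_conj u : wsummable u -> wseries (fun a => (u a)^* ) = (wseries u)^*.
Proof.
move=> [cu1 cu2]; rewrite conjCE /wseries/=; congr Complex.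
  apply: (congr1 (fun f : nat -> R => limn f)); apply/funext => N /=.
  by rewrite !Re_wsum; apply: eq_wsum => a; rewrite conjCE; case: (u a).
rewrite -limN//; apply: (congr1 (fun f : nat -> R => limn f)); apply/funext => N /=.
rewrite !Im_wsum.
transitivity (wsum N (fun a => -1 * complex.Im (u a))).
  by apply: eq_wsum => a; rewrite conjCE mulN1r; case: (u a).
by rewrite wsumMl mulN1r -Im_wsum.
Qed.

End ComplexWordSeries.

Section FormNorm.
Variables (R : realType) (V : lmodType R[i]).
Variable d : {dot V for (@Num.conj R[i])}.

Definition fnorm (x : V) : R[i] := ((Num.sqrt (complex.Re (d x x)))%:C)%C.

Lemma form_real x : d x x = ((complex.Re (d x x))%:C)%C.
Proof.
have := dnorm_ge0 d x; case: (d x x) => a b; rewrite lecE/= => /andP[/eqP-> _].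
by [].
Qed.

Lemma Re_form_ge0 x : 0 <= complex.Re (d x x).
Proof. by have := dnorm_ge0 d x; rewrite form_real lecR. Qed.

Lemma sqr_fnorm x : fnorm x ^+ 2 = d x x.
Proof.
rewrite /fnorm -rmorphXn/= sqr_sqrtr ?Re_form_ge0//; exact/esym/form_real.
Qed.

Lemma fnorm0_eq0 x : fnorm x = 0 -> x = 0.
Proof.
by move=> x0; apply/eqP; rewrite -(dnorm_eq0 d) -sqr_fnorm x0 expr0n.
Qed.

Lemma Re_formD x y : complex.Re (d (x + y) (x + y)) =
  complex.Re (d x x) + complex.Re (d y y) + 2 * complex.Re (d x y).
Proof.
rewrite dnormD; case: (d x x) (d y y) (d x y) => a b [a' b'] [p q].
by rewrite conjCE/=; ring.
Qed.

Lemma Re_formZ (t : R) x : complex.Re (d (t%:C%C *: x) (t%:C%C *: x)) =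
  t ^+ 2 * complex.Re (d x x).
Proof.
rewrite dnormZ -sqn_normc /sqn/= expr0n addr0; case: (d x x) => a b /=.
by rewrite mul0r subr0.
Qed.

Lemma Re_form_Zr (t : R) x y : complex.Re (d x (t%:C%C *: y)) =
  t * complex.Re (d x y).
Proof.
rewrite linearZr_LR/= conjCE/=; case: (d x y) => a b /=.
by rewrite oppr0 mul0r subr0.
Qed.

Lemma Re_form_le x y : complex.Re (d x y) <=
  Num.sqrt (complex.Re (d x x)) * Num.sqrt (complex.Re (d y y)).
Proof.
have [->|y0] := eqVneq y 0.
  by rewrite !linear0r /= sqrtr0 mulr0.
have c0 : 0 < complex.Re (d y y).
  have := neq0_dnorm_gt0 (s := d) _ y0; rewrite form_real.
  by rewrite -[0]/(((0 : R)%:C)%C) ltcR.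
rewrite -sqrtrM ?Re_form_ge0//; apply: (le_trans (ler_norm _)).
rewrite -sqrtr_sqr ler_wsqrtr//.
set b := complex.Re (d x y); set c := complex.Re (d y y) in c0 *.
set a := complex.Re (d x x).
have := Re_form_ge0 (x + ((- (b / c))%:C)%C *: y).
rewrite Re_formD Re_formZ Re_form_Zr -/a -/b -/c => h.
rewrite -(ler_pM2r (x:=c^-1)) ?invr_gt0// mulfK ?gt_eqF//.
suff -> : b ^+ 2 / c = a - (a + (- (b / c)) ^+ 2 * c + 2 * (- (b / c) * b)) by lra.
by field; rewrite gt_eqF.
Qed.

Lemma fnormD x y : fnorm (x + y) <= fnorm x + fnorm y.
Proof.
rewrite /fnorm -rmorphD/= lecR -[leRHS]ger0_norm ?addr_ge0 ?sqrtr_ge0//.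
rewrite -[leRHS]sqrtr_sqr ler_wsqrtr// sqrrD !sqr_sqrtr ?Re_form_ge0// Re_formD.
have := Re_form_le x y; set s := Num.sqrt _; set t := Num.sqrt _.
by rewrite mulr2n; lra.
Qed.

Lemma fnormZ (l : R[i]) x : fnorm (l *: x) = `|l| * fnorm x.
Proof.
apply/eqP; rewrite -(@eqrXn2 _ 2)//; last 2 first.
- by rewrite lecR sqrtr_ge0.
- by rewrite mulr_ge0// lecR sqrtr_ge0.
by rewrite exprMn !sqr_fnorm dnormZ.
Qed.

End FormNorm.

Lemma cvg_finsum (R : realType) (T : Type) (F : set_system T) (FF : Filter F)
    (I : Type) (r : seq I) (f : I -> T -> R) (l : I -> R) :
  (forall i, f i t @[t --> F] --> l i) ->
  \sum_(i <- r) f i t @[t --> F] --> \sum_(i <- r) l i.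
Proof.
move=> fl; elim: r => [|i r IHr].
  by rewrite big_nil; under eq_fun do rewrite big_nil; exact: cvg_cst.
rewrite big_cons; under eq_fun do rewrite big_cons.
exact: cvgD (fl i) IHr.
Qed.

Section L2.
Variables (R : realType) (n : nat).
Local Notation C := R[i].

Definition square_summable : {pred word n -> C} :=
  fun c => `[< cvgn (fun N => wsum N (fun a => sqn (c a))) >].

Lemma square_summableP (c : word n -> C) : reflect
  (exists M, forall N, wsum N (fun a => sqn (c a)) <= M) (c \in square_summable).
Proof.
apply: (iffP (asboolP _)) => /(wsum_cvgP (fun a => sqn_ge0 (c a))) //.
Qed.

Lemma square_summable_submod : submod_closed square_summable.
Proof.
split=> [|k c c' /square_summableP[M cM] /square_summableP[M' cM']].
  apply/square_summableP; exists 0 => N; rewrite /wsum big1// => j _.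
  by rewrite big1// => a _; exact: sqn0.
apply/square_summableP; exists (2 * sqn k * M + 2 * M') => N.
apply: (@le_trans _ _ (wsum N (fun a => 2 * sqn k * sqn (c a) + 2 * sqn (c' a)))).
  apply: ler_wsum => a; apply: (le_trans (sqnD _ _)).
  by rewrite sqnM mulrA.
rewrite wsumD !wsumMl lerD// ler_wpM2l// mulr_ge0//; exact: sqn_ge0.
Qed.

HB.instance Definition _ := GRing.isSubmodClosed.Build C (word n -> C)
  square_summable square_summable_submod.

Record l2 := L2 { l2val :> word n -> C ; l2valP : l2val \in square_summable }.

HB.instance Definition _ := [isSub for l2val].
HB.instance Definition _ := [Choice of l2 by <:].
HB.instance Definition _ := [SubChoice_isSubLmodule of l2 by <:].

Definition l2dot (x y : l2) : C := wseries (fun a => x a * (y a)^* ).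

Lemma l2dot_summable (x y : l2) : wsummable (fun a => x a * (y a)^* ).
Proof.
apply: (@wsummable_le _ _ _ (fun a => sqn (x a) + sqn (y a))).
- by move=> a; exact: Re_mulconj_le.
- by move=> a; exact: Im_mulconj_le.
under eq_fun do rewrite wsumD.
by apply: is_cvgD; apply/asboolP; exact: l2valP.
Qed.

Lemma l2dot_linear_l (y : l2) : GRing.linear_for ( *%R ) (l2dot ^~ y).
Proof.
move=> k x x'; rewrite /l2dot -wseriesZ; last exact: l2dot_summable.
rewrite -wseriesD; first 1 last.
- rewrite (_ : (fun _ => _) = (fun a => (k *: x) a * (y a)^* )).
    exact: l2dot_summable.
  by apply/funext => a; rewrite mulrA.
- exact: l2dot_summable.
by congr wseries; apply/funext => a; rewrite mulrA -mulrDl.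
Qed.

Lemma l2dotC (x y : l2) : l2dot x y = (l2dot y x)^*.
Proof.
rewrite /l2dot -wseries_conj; last exact: l2dot_summable.
by congr wseries; apply/funext => a; rewrite rmorphM/= conjCK mulrC.
Qed.

Lemma l2dot_linear_r (x : l2) :
  GRing.linear_for ((@Num.conj C) \; *%R) (l2dot x).
Proof.
move=> k y y'; rewrite l2dotC l2dot_linear_l rmorphD rmorphM/=.
by rewrite -!(l2dotC x).
Qed.

HB.instance Definition _ := bilinear_isBilinear.Build C l2 l2 C _ _ l2dot
  (l2dot_linear_l, l2dot_linear_r).

Lemma l2dot_hermitian (x y : l2) :
  l2dot x y = (-1) ^+ false * (l2dot y x)^*.
Proof. by rewrite expr0 mul1r; exact: l2dotC. Qed.

HB.instance Definition _ := isHermitianSesquilinear.Build C l2 false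
  (@Num.conj C) l2dot l2dot_hermitian.

Definition l2sqn (x : l2) : R := limn (fun N => wsum N (fun a => sqn (x a))).

Lemma l2dotE (x : l2) : l2dot x x = ((l2sqn x)%:C)%C.
Proof.
rewrite /l2dot /wseries; congr Complex.
  apply: (congr1 (fun f : nat -> R => limn f)); apply/funext => N.
  rewrite Re_wsum; apply: eq_wsum => a; rewrite /sqn conjCE.
  by case: (l2val x a) => p q /=; ring.
apply: (@cvg_lim R^o) => //.
rewrite (_ : (fun _ => _) = cst 0); first exact: cvg_cst.
apply/funext => N /=.
rewrite Im_wsum /wsum big1// => k _; rewrite big1// => a _; rewrite conjCE.
by case: (l2val x a) => p q /=; ring.
Qed.

Lemma wsum_le_l2sqn (x : l2) N : wsum N (fun a => sqn (x a)) <= l2sqn x.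
Proof.
apply: (nondecreasing_cvgn_le (u_ := fun N => wsum N (fun a => sqn (x a)))).
  by apply: wsum_homo => a; exact: sqn_ge0.
exact/asboolP/l2valP.
Qed.

Lemma sqn_le_l2sqn (x : l2) a : sqn (x a) <= l2sqn x.
Proof.
apply: le_trans (wsum_le_l2sqn x (size a).+1).
by apply: (ler_wsum_term (F := fun a => sqn (x a))) => b; exact: sqn_ge0.
Qed.

Lemma l2sqn_le (x : l2) M :
  (forall N, wsum N (fun a => sqn (x a)) <= M) -> l2sqn x <= M.
Proof.
move=> xM; apply: limr_le; first exact/asboolP/l2valP.
by apply: nearW.
Qed.

Lemma l2dot_pos (x : l2) : x != 0 -> 0 < l2dot x x.
Proof.
move=> x0; rewrite l2dotE -[0]/(((0 : R)%:C)%C) ltcR lt_neqAle.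
rewrite (le_trans (sqn_ge0 (x [::])) (sqn_le_l2sqn _ _)) andbT.
apply: contra x0 => /eqP h; apply/eqP/val_inj/funext => a /=.
apply: sqn_eq0; apply/eqP; rewrite eq_le sqn_ge0 andbT h; exact: sqn_le_l2sqn.
Qed.

HB.instance Definition _ := isDotProduct.Build C l2 l2dot l2dot_pos.

HB.instance Definition _ := Lmodule_isNormed.Build C l2
  (@fnormD _ _ l2dot) (@fnormZ _ _ l2dot) (@fnorm0_eq0 _ _ l2dot).

Lemma l2_normE (x : l2) : `|x| = ((Num.sqrt (l2sqn x))%:C)%C.
Proof.
by rewrite -[LHS]/(((Num.sqrt (complex.Re (l2dot x x)))%:C)%C) l2dotE.
Qed.

Lemma gtc0_real (e : C) : 0 < e -> exists2 r : R, 0 < r & e = (r%:C)%C.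
Proof.
case: e => a b; rewrite ltcE/= => /andP[/eqP -> a0]; by exists a.
Qed.

Lemma l2_dist_le (x y : l2) (r : R) : 0 <= r ->
  (`|x - y| <= (r%:C)%C) = (l2sqn (x - y) <= r ^+ 2).
Proof.
move=> r0; rewrite l2_normE lecR -[in LHS](ger0_norm r0) -sqrtr_sqr.
by rewrite ler_sqrt// sqr_ge0.
Qed.

Lemma l2_complete (F : set_system l2) : ProperFilter F -> cauchy F -> cvg F.
Proof.
move=> FF /cauchy_ballP Fc.
have Fe (e : R) : 0 < e -> \forall x & y \near F, l2sqn (x - y) <= e ^+ 2.
  move=> e0; have := Fc ((e%:C)%C); rewrite -[0]/(((0 : R)%:C)%C) ltcR => /(_ e0).
  apply: filterS => -[x y] /=; rewrite -ball_normE/= => /ltW.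
  by rewrite l2_dist_le// ltW.
have coord (p : {additive C -> R}) : (forall z, p z ^+ 2 <= sqn z) ->
    forall a, cvg ((fun x : l2 => p (x a)) @ F).
  move=> psqn a; apply/cauchy_cvgP/cauchy_ballP => e e0.
  near_simpl.
  have := Fe (e / 2); rewrite divr_gt0// => /(_ isT).
  apply: filterS => -[x y] /= xy; rewrite -ball_normE/= -raddfB.
  rewrite (@le_lt_trans _ _ (e / 2))//; last by rewrite ltr_pdivrMr// ltr_pMr// ltr1n.
  have e20 : 0 <= e / 2 by rewrite divr_ge0// ltW.
  rewrite -(ger0_norm e20) -!sqrtr_sqr ler_sqrt ?sqr_ge0//.
  apply: (le_trans (psqn _)); apply: le_trans xy.
  exact: (sqn_le_l2sqn (x - y) a).
pose c a : C := Complex (lim ((fun x : l2 => complex.Re (x a)) @ F))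
                        (lim ((fun x : l2 => complex.Im (x a)) @ F)).
have Fsum (x : l2) N : (fun y : l2 => wsum N (fun a => sqn (x a - y a))) @ F -->
    wsum N (fun a => sqn (x a - c a)).
  apply: cvg_finsum => k; apply: cvg_finsum => a; rewrite /sqn.
  have hR : (fun y : l2 => complex.Re (y (val a))) @ F --> complex.Re (c (val a)).
    apply: (coord (@complex.Re R)) => z; by rewrite lerDl sqr_ge0.
  have hI : (fun y : l2 => complex.Im (y (val a))) @ F --> complex.Im (c (val a)).
    apply: (coord (@complex.Im R)) => z; by rewrite lerDr sqr_ge0.
  rewrite raddfB/= raddfB/=.
  under eq_fun do rewrite raddfB/= raddfB/= !expr2.
  rewrite !expr2.
  by apply: cvgD; apply: cvgM; apply: cvgB => //; exact: cvg_cst.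
have Fle (e : R) : 0 < e ->
    F [set x : l2 | forall N, wsum N (fun a => sqn (x a - c a)) <= e ^+ 2].
  move=> /Fe[[A B] /= [FA FB] AB]; apply: filterS FA => x Ax N.
  rewrite -(cvg_lim _ (Fsum x N))//; apply: limr_le.
    by apply/cvg_ex; eexists; exact: Fsum.
  apply: filterS FB => y By; apply: le_trans (AB (x, y) (conj Ax By)).
  exact: (wsum_le_l2sqn (x - y) N).
have cl2 : c \in square_summable.
  have /filter_ex[x xc] := Fle 1 ltr01.
  have -> : c = l2val x - ((l2val x : word n -> C) - c) by rewrite opprB addrC subrK.
  rewrite rpredB ?l2valP//; apply/square_summableP; exists (1 ^+ 2) => N.
  exact: xc.
apply/cvg_ex; exists (L2 cl2); apply/cvgrPdist_le => _ /gtc0_real[e e0 ->].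
apply: filterS (Fle e e0) => x xc; rewrite distrC l2_dist_le ?(ltW e0)//.
by apply: l2sqn_le.
Qed.

HB.instance Definition _ := Uniform_isComplete.Build l2 l2_complete.

Lemma l2_hnormE (x : l2) : `|x| ^+ 2 = l2dot x x.
Proof. exact: (sqr_fnorm l2dot). Qed.

HB.instance Definition _ := isHilbert.Build R l2 l2_hnormE.

End L2.

Section Orthocomplement.
Variables (R : realType) (K : hilbertType R) (A : set K).
Local Notation C := R[i].

Definition orthogonal_to : {pred K} :=
  fun x => `[< forall a, A a -> hdot a x = 0 >].

Lemma orthogonal_to_submod : submod_closed orthogonal_to.
Proof.
split=> [|k x y /asboolP xA /asboolP yA]; apply/asboolP => a Aa.
  exact: linear0r.
by rewrite linearDr/= linearZr_LR/= xA// yA// mulr0 addr0.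
Qed.

HB.instance Definition _ := GRing.isSubmodClosed.Build C K
  orthogonal_to orthogonal_to_submod.

Record orthocomp := Orthocomp {
  orthocomp_val :> K ; orthocompP : orthocomp_val \in orthogonal_to }.

HB.instance Definition _ := [isSub for orthocomp_val].
HB.instance Definition _ := [Choice of orthocomp by <:].
HB.instance Definition _ := [SubChoice_isSubLmodule of orthocomp by <:].

Definition orthocomp_dot (x y : orthocomp) : C :=
  hdot (orthocomp_val x) (orthocomp_val y).

Lemma orthocomp_dot_linear_l y :
  GRing.linear_for ( *%R ) (orthocomp_dot ^~ y).
Proof. by move=> k x x'; rewrite /orthocomp_dot/= linearDl/= linearZl_LR. Qed.

Lemma orthocomp_dot_linear_r x :
  GRing.linear_for ((@Num.conj C) \; *%R) (orthocomp_dot x).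
Proof. by move=> k y y'; rewrite /orthocomp_dot/= linearDr/= linearZr_LR. Qed.

HB.instance Definition _ := bilinear_isBilinear.Build C orthocomp orthocomp C
  _ _ orthocomp_dot (orthocomp_dot_linear_l, orthocomp_dot_linear_r).

Lemma orthocomp_dot_hermitian x y :
  orthocomp_dot x y = (-1) ^+ false * (orthocomp_dot y x)^*.
Proof. exact: hermC. Qed.

HB.instance Definition _ := isHermitianSesquilinear.Build C orthocomp false
  (@Num.conj C) orthocomp_dot orthocomp_dot_hermitian.

Lemma orthocomp_dot_pos x : x != 0 -> 0 < orthocomp_dot x x.
Proof.
move=> x0; apply: neq0_dnorm_gt0; apply: contra x0 => /eqP x0.
exact/eqP/val_inj.
Qed.

HB.instance Definition _ := isDotProduct.Build C orthocomp orthocomp_dot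
  orthocomp_dot_pos.

Lemma orthocomp_normD (x y : orthocomp) :
  `|val (x + y)| <= `|val x| + `|val y|.
Proof. exact: ler_normD. Qed.

Lemma orthocomp_normZ (l : C) (x : orthocomp) :
  `|val (l *: x)| = `|l| * `|val x|.
Proof. exact: normrZ. Qed.

Lemma orthocomp_norm0_eq0 (x : orthocomp) : `|val x| = 0 -> x = 0.
Proof. by move/normr0_eq0 => x0; exact: val_inj. Qed.

HB.instance Definition _ := Lmodule_isNormed.Build C orthocomp
  orthocomp_normD orthocomp_normZ orthocomp_norm0_eq0.

Lemma Re_hdot_le (x y : K) :
  ((complex.Re (hdot x y))%:C)%C <= `|x| * `|y|.
Proof.
have nE (z : K) : `|z| = fnorm hdot z.
  apply/eqP; rewrite -(@eqrXn2 _ 2)//; last by rewrite lecR sqrtr_ge0.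
  by rewrite hnormE sqr_fnorm.
by rewrite !nE /fnorm -rmorphM/= lecR; exact: Re_form_le.
Qed.

Lemma orthocomp_complete (F : set_system orthocomp) :
  ProperFilter F -> cauchy F -> cvg F.
Proof.
move=> FF /cauchy_ballP Fc.
have : cvg (orthocomp_val @ F).
  apply/cauchy_cvgP/cauchy_ballP => e e0; near_simpl.
  by have := Fc e e0; apply: filterS => -[x y] /=; rewrite -!ball_normE.
move=> /cvg_ex[l Fl]; have lA : l \in orthogonal_to.
  apply/asboolP => a Aa; apply/eqP/negPn/negP => z0.
  pose z := hdot a l; pose b := z^* *: a; pose M := `|b| + 1.
  have M0 : 0 < M by rewrite ltr_wpDl.
  have e0 : 0 < `|z| ^+ 2 / M by rewrite divr_gt0// exprn_gt0// normr_gt0.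
  have /(_ _ e0)/filter_ex[x /= xl] :
      forall e, 0 < e -> F [set x | `|l - orthocomp_val x| < e].
    by move/cvgrPdist_lt : Fl.
  have bx : hdot b (orthocomp_val x) = 0.
    by rewrite /b linearZl_LR/= (asboolW (orthocompP x))// mulr0.
  have bl : hdot b (l - orthocomp_val x) = `|z| ^+ 2.
    by rewrite linearBr/= bx subr0 /b linearZl_LR/= -/z mulrC -normCK.
  have := Re_hdot_le b (l - orthocomp_val x).
  rewrite bl -sqn_normc /=; apply/negP; rewrite -real_ltNge ?realE//; last 2 first.
  - by rewrite mulr_ge0.
  - by rewrite lecR sqn_ge0.
  rewrite sqn_normc; rewrite ltr_pdivlMr// mulrC in xl; apply: le_lt_trans xl.
  by rewrite ler_wpM2r// lerDl.
apply/cvg_ex; exists (Orthocomp lA); apply/cvgrPdist_lt => e e0.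
by move/cvgrPdist_lt : Fl => /(_ e e0).
Qed.

HB.instance Definition _ := Uniform_isComplete.Build orthocomp orthocomp_complete.

Lemma orthocomp_hnormE (x : orthocomp) : `|x| ^+ 2 = orthocomp_dot x x.
Proof. exact: hnormE. Qed.

HB.instance Definition _ := isHilbert.Build R orthocomp orthocomp_hnormE.

End Orthocomplement.

Section Operators.
Variable R : realType.
Local Notation C := R[i].

Definition hnorm (H : hilbertType R) (x : H) : R := complex.Re `|x|.

(* The norm of the operator matrix [A i j], acting from the direct sum of m
   copies of H1 to that of p copies of H2; a row operator has p = 1. *)
Definition mx_opnorm (H1 H2 : hilbertType R) (p m : nat)
    (A : 'I_p -> 'I_m -> H1 -> H2) : \bar R :=
  ereal_sup [set (Num.sqrt (\sum_i hnorm (\sum_j A i j (x j)) ^+ 2))%:E |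
             x in [set x : 'I_m -> H1 | \sum_j hnorm (x j) ^+ 2 <= 1]].

Definition opnorm (H1 H2 : hilbertType R) (A : H1 -> H2) : \bar R :=
  ereal_sup [set (hnorm (A x))%:E | x in [set x : H1 | hnorm x <= 1]].

Definition bounded_op (H1 H2 : hilbertType R) (A : H1 -> H2) : Prop :=
  linear A /\ (opnorm A < +oo)%E.

Definition adjoint (H1 H2 : hilbertType R) (A : H1 -> H2) : H2 -> H1 :=
  xget 0 [set B | forall x y, hdot (A x) y = hdot x (B y)].

Definition norm_closure (H : hilbertType R) (S : set (H -> H)) : set (H -> H) :=
  [set A | bounded_op A /\
     forall e : R, 0 < e -> exists2 B, S B & (opnorm (A - B)%R < e%:E)%E].

Definition wot_closure (H : hilbertType R) (S : set (H -> H)) : set (H -> H) :=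
  [set A | bounded_op A /\
     forall (s : seq (H * H)) (e : R), 0 < e -> exists2 B, S B &
       forall x y, (x, y) \in s -> `|hdot (A x - B x) y| < (e%:C)%C].

Definition infinite_dimensional (H : hilbertType R) : Prop :=
  forall m, exists v : 'I_m -> H, forall k : 'I_m -> C,
    \sum_i k i *: v i = 0 -> forall i, k i = 0.

Definition projection (H : hilbertType R) (A : set H) (x : H) : orthocomp A :=
  xget 0 [set y : orthocomp A |
    forall z : orthocomp A, hdot (x - orthocomp_val y) (orthocomp_val z) = 0].

Definition completely_contractive (H1 H2 : hilbertType R)
    (S : set (H1 -> H1)) (Psi : (H1 -> H1) -> (H2 -> H2)) : Prop :=
  forall (m : nat) (A : 'I_m -> 'I_m -> H1 -> H1), (forall i j, S (A i j)) ->
    (mx_opnorm (fun i j => Psi (A i j)) <= mx_opnorm A)%E.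

End Operators.

(* Formal power series in n noncommuting indeterminates: F a is the coefficient
   of Z_a. *)
Notation ncseries R n := (word n -> R[i]).

Section FormalSeries.
Variables (R : realType) (n : nat).
Local Notation series := (ncseries R n).
Implicit Types (p q : series) (f : 'I_n -> series).

Definition series_one : series := fun w => (w == [::])%:R.

Definition series_X (i : 'I_n) : series := fun w => (w == [:: i])%:R.

Definition series_mul p q : series := fun w =>
  \sum_(k < (size w).+1) p (take k w) * q (drop k w).

Definition series_word f (a : word n) : series :=
  foldr (fun i q => series_mul (f i) q) series_one a.

Definition degree_lt (N : nat) p : Prop :=
  forall w, (N <= size w)%N -> p w = 0.

Definition ncpolynomial p : Prop := exists N, degree_lt N p.

Definition homogeneous p : Prop := exists d, forall w, size w != d -> p w = 0.

(* The terms of degree < N in p of the composition p o f. *)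
Definition series_comp (N : nat) p f : series :=
  wsum N (fun a => p a *: series_word f a).

(* The sequence whose limsup is the inverse of the radius of convergence. *)
Definition root_term p (k : nat) : \bar R :=
  ((\sum_(a : k.-tuple 'I_n) sqn (p a)) `^ (((2 * k)%N%:R)^-1))%:E.

Definition free_holomorphic (gamma : R) p : Prop :=
  (limn_esup (root_term p) <= (gamma^-1)%:E)%E.

End FormalSeries.

Section Evaluation.
Variables (R : realType) (n : nat) (H : hilbertType R).
Local Notation series := (ncseries R n).
Local Notation tuples := ('I_n -> H -> H).
Implicit Types (psi : series) (f : 'I_n -> series) (Y : tuples) (A : H -> H).

Definition op_word Y (a : word n) : H -> H :=
  foldr (fun i A => Y i \o A) idfun a.

Definition partial_eval psi Y (N : nat) : H -> H :=
  wsum N (fun a => psi a *: op_word Y a).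

Definition bounded_tuple Y : Prop := forall i, bounded_op (Y i).

Definition norm_sum psi Y A : Prop :=
  bounded_op A /\ opnorm (partial_eval psi Y N - A) @[N --> \oo] --> 0%E.

Definition sot_sum psi Y A : Prop :=
  bounded_op A /\ forall x, partial_eval psi Y N x @[N --> \oo] --> A x.

Definition scale_tuple (r : R) Y : tuples := fun i => (r%:C)%C *: Y i.

Definition rad_sum psi Y A : Prop :=
  bounded_op A /\ exists delta : R, 0 < delta < 1 /\
    exists Phi : R -> H -> H,
      (forall r, delta < r < 1 -> norm_sum psi (scale_tuple r Y) (Phi r)) /\
      forall x, Phi r x @[r --> 1^'-] --> A x.

Definition conv_sot f : set tuples :=
  [set Y | bounded_tuple Y /\ forall i, exists A, sot_sum (f i) Y A].

Definition conv_rad f : set tuples :=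
  [set Y | bounded_tuple Y /\ forall i, exists A, rad_sum (f i) Y A].

(* By Abel's theorem the two kinds of sums agree when both exist. *)
Definition series_eval psi Y : H -> H :=
  xget 0 [set A | sot_sum psi Y A \/ rad_sum psi Y A].

Definition eval_tuple f Y : tuples := fun i => series_eval (f i) Y.

Definition op_ball (r : R) : set tuples :=
  [set X | bounded_tuple X /\
     (poweR (opnorm (\sum_i (X i \o adjoint (X i)))%R) 2^-1%R < r%:E)%E].

(* B_f(H); g is the inverse of f under composition. *)
Definition op_domain f g : set tuples :=
  [set X | [/\ conv_sot f X \/ conv_rad f X,
      (mx_opnorm (fun _ : 'I_1 => eval_tuple f X) <= 1)%E &
      (forall i, sot_sum (g i) (eval_tuple f X) (X i)) \/
      (forall i, rad_sum (g i) (eval_tuple f X) (X i))]].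

End Evaluation.

Section Models.
Variables (R : realType) (n : nat) (H0 : hilbertType R).
Local Notation series := (ncseries R n).
Local Notation fock := (l2 R n).
Implicit Types f g : 'I_n -> series.

(* H^2(f) is the space l2 of coefficient families on the words, the family c
   being the element sum_a c_a f_a.  A realization tells what this sum is:
   [represents c p] says that it is p, so that products such as Z_i p and
   f_j p make sense. *)
Record realization := Realization {
  carrier : Type ;
  represents : fock -> carrier -> Prop ;
  coord_fun : 'I_n -> carrier ;
  mul_coord : 'I_n -> carrier -> carrier ;
  mul_f : 'I_n -> carrier -> carrier }.
Arguments represents : clear implicits.
Arguments coord_fun : clear implicits.
Arguments mul_coord : clear implicits.
Arguments mul_f : clear implicits.

(* Only finite sums are interpreted: if f(0) <> 0, an infinite one need not be a
   formal series.  They are dense, hence determine bounded operators. *)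
Definition poly_realization f : realization := {|
  carrier := series ;
  represents := fun c p => exists2 N, degree_lt N c & p = series_comp N c f ;
  coord_fun := @series_X R n ;
  mul_coord := fun i => series_mul (series_X R i) ;
  mul_f := fun j => series_mul (f j) |}.

(* When f(0) = 0, f_a vanishes at words shorter than a, so the coefficient of
   sum_a c_a f_a at w involves only the words a with |a| <= |w|. *)
Definition formal_realization f : realization := {|
  carrier := series ;
  represents := fun c p => forall w, p w = series_comp (size w).+1 c f w ;
  coord_fun := @series_X R n ;
  mul_coord := fun i => series_mul (series_X R i) ;
  mul_f := fun j => series_mul (f j) |}.

Definition function_realization (gamma : R) f : realization := {|
  carrier := ('I_n -> H0 -> H0) -> H0 -> H0 ;
  represents := fun c p =>
    forall X, op_ball gamma X -> p X = series_eval c (eval_tuple f X) ;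
  coord_fun := fun i X => X i ;
  mul_coord := fun i p X => X i \o p X ;
  mul_f := fun j p X => eval_tuple f X j \o p X |}.

Definition mult_op (rho : realization)
    (mul : carrier rho -> carrier rho)
    (M : fock -> fock) : Prop :=
  bounded_op M /\ forall c p, represents rho c p -> represents rho (M c) (mul p).

Definition coords_in (rho : realization) : Prop :=
  forall i, exists c, represents rho c (coord_fun rho i).

Definition mult_axiom f (rho : realization) : Prop :=
  exists M : 'I_n -> fock -> fock,
    [/\ forall i, mult_op (mul_coord rho i) (M i),
        conv_sot f M \/ conv_rad f M &
        forall j, mult_op (mul_f rho j) (eval_tuple f M j)].

(* A function of an operator tuple is taken on the balls of B(H0)^n, for one
   infinite dimensional H0 fixed throughout. *)
Inductive model_case f : realization -> Prop :=
| ModelA N q of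
    (forall i, degree_lt N (f i) /\ degree_lt N (q i)) &
    (forall i, series_comp N (f i) q = series_X R i) &
    (forall i, series_comp N (q i) f = series_X R i) :
  model_case f (poly_realization f)
| ModelS of
    (forall i, f i [::] = 0) &
    (forall i, (limn_esup (root_term (f i)) < +oo)%E) &
    (\det (\matrix_(i, j) f i [:: j]) != 0) &
    coords_in (formal_realization f) &
    mult_axiom f (formal_realization f) :
  model_case f (formal_realization f)
| ModelF (gamma : R) of
    0 < gamma &
    (forall i, free_holomorphic gamma (f i)) &
    (forall X : 'I_n -> H0 -> H0,
       op_ball gamma X -> op_ball 1 (eval_tuple f X)) &
    (forall G : series, free_holomorphic 1 G ->
       (forall X : 'I_n -> H0 -> H0,
          op_ball gamma X -> series_eval G (eval_tuple f X) = 0) -> G = 0) &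
    coords_in (function_realization gamma f) &
    mult_axiom f (function_realization gamma f) :
  model_case f (function_realization gamma f).

Definition model_property f : Prop := exists rho, model_case f rho.

Definition radial_approximation f : Prop :=
  model_property f /\ exists delta : R, 0 < delta < 1 /\
    forall r, delta < r <= 1 -> model_property (fun i => (r%:C)%C *: f i).

(* M is the tuple of the M_{Z_i}, and g i the family of coordinates of Z_i in
   H^2(f); both are determined by f. *)
Definition universal_model f (M : 'I_n -> fock -> fock) g : Prop :=
  exists2 rho, model_case f rho &
    (forall i, mult_op (mul_coord rho i) (M i)) /\
    (forall i, exists2 c : fock, represents rho c (coord_fun rho i) & g i = c).

End Models.

Section Varieties.
Variables (R : realType) (n : nat).
Local Notation series := (ncseries R n).
Local Notation fock := (l2 R n).
Variables (f : 'I_n -> series) (M : 'I_n -> fock -> fock) (P : set series).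

Definition hardy_algebra : set (fock -> fock) :=
  wot_closure [set A | exists N p, A = partial_eval p M N].

Definition wot_closed_ideal (J : set (fock -> fock)) : Prop :=
  [/\ J `<=` hardy_algebra, J 0,
      (forall (k : R[i]) A B, J A -> J B -> J (k *: A + B)),
      (forall A B, hardy_algebra A -> J B -> J (A \o B) /\ J (B \o A)) &
      wot_closure J `<=` J].

Definition variety_ideal : set (fock -> fock) :=
  smallest wot_closed_ideal [set series_eval q (eval_tuple f M) | q in P].

Definition variety_space : hilbertType R :=
  orthocomp (closure (\bigcup_(A in variety_ideal) range A)).

Definition variety_model (i : 'I_n) : variety_space -> variety_space :=
  fun x => projection _ (M i (orthocomp_val x)).

End Varieties.
Arguments variety_model {R n} f M P i x.

Definition star_words (R : realType) (n : nat) (H : hilbertType R)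
    (B : 'I_n -> H -> H) (a b : word n) : H -> H :=
  op_word B a \o adjoint (op_word B b).

Definition star_span (R : realType) (n : nat) (H : hilbertType R)
    (B : 'I_n -> H -> H) : set (H -> H) :=
  norm_closure [set A | exists s : seq (R[i] * (word n * word n)),
    A = \sum_(t <- s) t.1 *: star_words B t.2.1 t.2.2].

(* Main.v *)
Require Import Defs.
From HB Require Import structures.
From mathcomp Require Import all_boot all_order all_algebra.
From mathcomp Require Import complex.
From mathcomp Require Import lra ring zify.
From mathcomp Require Import all_classical all_reals all_analysis.

Set Implicit Arguments.
Unset Strict Implicit.
Unset Printing Implicit Defensive.

Import Order.TTheory GRing.Theory Num.Theory.
Import numFieldNormedType.Exports.

Local Open Scope classical_set_scope.
Local Open Scope ring_scope.

(** Let Y = f(T), a row contraction with g(Y) = T, and identify H^2(f) with the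
    square summable families on the words.  There f_j(M_Z) is the j-th left creation
    operator, and M_Z,i is multiplication by g_i ([universal_model_facts]): in these
    coordinates M_Z is g of the creation operators, just as T is g of Y, and the
    theorem is von Neumann's inequality for Y, transported by g and compressed to a
    variety.

    Suppose first that the row norm of Y is less than 1.  The Poisson vectors
    K(h, b) = sum_w <h, Y_w b> e_w satisfy <c, K(h, b)> = <c(Y) b, h>.  Since
    T_i = g_i(Y), the adjoint of M_Z,i sends K(h, b) to K(T_i^* h, b)
    ([multiplier_pvec]).  As q(Y) = 0 for q in P, the Poisson vectors are orthogonal
    to the range of the ideal, so they lie in the space of the variety, where the
    adjoints of B_i and M_Z,i agree.  Let b run through a finite orthonormal
    family for the form of the defect D = 1 - sum_i Y_i Y_i^*, and consider the maps
    sending h to K(h, D b).  Together they are contractive, by Bessel's inequality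
    and a telescoping sum, and they are nearly isometric on given vectors once the family is large enough
    ([poisson_dilation]).  They are finitely many components of the Poisson kernel,
    an isometry from H to a multiple of the space of the variety; working with
    finitely many avoids tensor products and square roots of operators.  Because
    they intertwine B^* and T^*, every bound on a matrix of combinations of the
    B_a B_b^* holds for the corresponding matrix in T ([star_comb_form_bound]).

    A general Y is replaced by r Y with r < 1.  Homogeneity keeps q(r Y) = 0, and
    the bound passes to the limit as soon as g(r Y) tends to g(Y) = T in norm
    ([row_contraction_form_bound]).  This is what the radial approximation property
    is for: it gives the coefficients of g geometric decay ([coordinate_decay]).
    Indeed, if c' are the coordinates of Z_i for the model of r f, then the family
    r^|a| c'_a also expresses Z_i through f, and uniqueness makes it equal to g_i.
    For formal models uniqueness holds because f is invertible to first order
    ([formal_comp_inj]).  For function models the two expressions are compared on a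
    ball that may be smaller than that of f, and one needs that a function G o f
    vanishing near 0 vanishes ([composition_identity]).  This is an identity theorem
    in one variable, for z mapped to G(f(z X)) x on the unit disc; it is proved for
    uniform limits of polynomials, with Cauchy's estimate for polynomials obtained
    by splitting them into even and odd parts ([coef_le_circle_sup]).

    Finally the inequality, being valid for matrices of all sizes, makes the map
    well defined on combinations, extends it to the closed span by continuity, and
    gives complete contractivity ([star_span_map]). *)

(** * Operators on Hilbert spaces *)

Section ComplexModulus.
Variable R : realType.
Implicit Types (z w : R[i]) (t : R).

Definition cabs z : R := complex.Re `|z|.

Lemma cabsE z : `|z| = ((cabs z)%:C)%C.
Proof. by rewrite /cabs normc_def. Qed.

Lemma cabs_ge0 z : 0 <= cabs z.
Proof. by rewrite /cabs normc_def /= sqrtr_ge0. Qed.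

Lemma cabsM z w : cabs (z * w) = cabs z * cabs w.
Proof.
by apply: (@complexI R); rewrite rmorphM /= -!cabsE normrM.
Qed.

Lemma cabsD z w : cabs (z + w) <= cabs z + cabs w.
Proof. by rewrite -lecR rmorphD /= -!cabsE ler_normD. Qed.

Lemma cabs0 : cabs 0 = 0. Proof. by rewrite /cabs normr0. Qed.

Lemma cabs1 : cabs 1 = 1. Proof. by rewrite /cabs normr1. Qed.

Lemma cabsN z : cabs (- z) = cabs z. Proof. by rewrite /cabs normrN. Qed.

Lemma cabsX z k : cabs (z ^+ k) = cabs z ^+ k.
Proof. by elim: k => [|k IH]; rewrite ?expr0 ?cabs1// !exprS cabsM IH. Qed.

Lemma cabs_sum (I : Type) (r : seq I) (F : I -> R[i]) :
  cabs (\sum_(i <- r) F i) <= \sum_(i <- r) cabs (F i).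
Proof.
elim: r => [|i r IH]; first by rewrite !big_nil cabs0.
by rewrite !big_cons (le_trans (cabsD _ _))// lerD.
Qed.

Lemma cabs_conj z : cabs (z^* ) = cabs z.
Proof. by rewrite /cabs norm_conjC. Qed.

Lemma cabs_real t : cabs (t%:C)%C = `|t|.
Proof. by rewrite /cabs normc_def /= expr0n addr0 sqrtr_sqr. Qed.

Lemma sqnE z : sqn z = cabs z ^+ 2.
Proof. by apply: (@complexI R); rewrite sqn_normc cabsE rmorphXn. Qed.

Lemma Re_le_cabs z : complex.Re z <= cabs z.
Proof.
have := normc_ge_Re z; rewrite cabsE lecR; exact: le_trans (ler_norm _).
Qed.

Lemma cabs_eq0 z : cabs z = 0 -> z = 0.
Proof. by move=> z0; apply/eqP; rewrite -normr_eq0 cabsE z0. Qed.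

Lemma ReD z w : complex.Re (z + w) = complex.Re z + complex.Re w.
Proof. by rewrite raddfD. Qed.

Lemma Re_realM t z : complex.Re ((t%:C)%C * z) = t * complex.Re z.
Proof. by case: z => a b /=; rewrite mul0r subr0. Qed.

End ComplexModulus.

Section HilbertNorm.
Variables (R : realType) (H : hilbertType R).
Implicit Types (x y z : H) (t : R) (k : R[i]).

Lemma hnormC x : `|x| = ((hnorm x)%:C)%C.
Proof.
have := normr_ge0 x; rewrite /hnorm; case: `|x| => a b.
by rewrite lecE /= => /andP[/eqP -> _].
Qed.

Lemma hnorm_ge0 x : 0 <= hnorm x.
Proof. by rewrite -lecR -hnormC normr_ge0. Qed.

Lemma hnorm0 : hnorm (0 : H) = 0. Proof. by rewrite /hnorm normr0. Qed.

Lemma hnorm_opp x : hnorm (- x) = hnorm x. Proof. by rewrite /hnorm normrN. Qed.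

Lemma hnorm_triangle x y : hnorm (x + y) <= hnorm x + hnorm y.
Proof. by rewrite -lecR rmorphD /= -!hnormC ler_normD. Qed.

Lemma hnorm_subC x y : hnorm (x - y) = hnorm (y - x).
Proof. by rewrite -hnorm_opp opprB. Qed.

Lemma hnorm_scale k x : hnorm (k *: x) = cabs k * hnorm x.
Proof.
by apply: (@complexI R); rewrite rmorphM /= -!hnormC -cabsE normrZ.
Qed.

Lemma hnorm_eq0 x : hnorm x = 0 -> x = 0.
Proof. by move=> x0; apply/normr0_eq0; rewrite hnormC x0. Qed.

Lemma hnorm_sum (I : Type) (r : seq I) (F : I -> H) :
  hnorm (\sum_(i <- r) F i) <= \sum_(i <- r) hnorm (F i).
Proof.
elim: r => [|i r IH]; first by rewrite !big_nil hnorm0.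
by rewrite !big_cons (le_trans (hnorm_triangle _ _))// lerD.
Qed.

Lemma hdot_hnorm x : hdot x x = ((hnorm x ^+ 2)%:C)%C.
Proof. by rewrite -hnormE hnormC rmorphXn. Qed.

Lemma hnorm_sqr x : hnorm x ^+ 2 = complex.Re (hdot x x).
Proof. by rewrite hdot_hnorm. Qed.

Lemma hdotDl x y z : hdot (x + y) z = hdot x z + hdot y z.
Proof. exact: linearDl. Qed.

Lemma hdotDr x y z : hdot x (y + z) = hdot x y + hdot x z.
Proof. exact: linearDr. Qed.

Lemma hdotZl k x y : hdot (k *: x) y = k * hdot x y.
Proof. exact: linearZl_LR. Qed.

Lemma hdotZr k x y : hdot x (k *: y) = k^* * hdot x y.
Proof. exact: linearZr_LR. Qed.

Lemma hdot0l x : hdot 0 x = 0. Proof. exact: linear0l. Qed.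

Lemma hdot0r x : hdot x 0 = 0. Proof. exact: linear0r. Qed.

Lemma hdotNr x y : hdot x (- y) = - hdot x y. Proof. exact: linearNr. Qed.

Lemma hdotBl x y z : hdot (x - y) z = hdot x z - hdot y z.
Proof. exact: linearBl. Qed.

Lemma hdotBr x y z : hdot x (y - z) = hdot x y - hdot x z.
Proof. exact: linearBr. Qed.

Lemma hdotC x y : hdot x y = (hdot y x)^*.
Proof. by rewrite hermC expr0 mul1r. Qed.

Lemma hdot_suml (I : Type) (r : seq I) (P : pred I) (F : I -> H) y :
  hdot (\sum_(i <- r | P i) F i) y = \sum_(i <- r | P i) hdot (F i) y.
Proof.
elim: r => [|i r IH]; first by rewrite !big_nil hdot0l.
by rewrite !big_cons; case: ifP => _; rewrite ?hdotDl IH.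
Qed.

Lemma hdot_sumr (I : Type) (r : seq I) (P : pred I) (F : I -> H) y :
  hdot y (\sum_(i <- r | P i) F i) = \sum_(i <- r | P i) hdot y (F i).
Proof.
elim: r => [|i r IH]; first by rewrite !big_nil hdot0r.
by rewrite !big_cons; case: ifP => _; rewrite ?hdotDr IH.
Qed.

Lemma Re_hdotC x y : complex.Re (hdot x y) = complex.Re (hdot y x).
Proof. by rewrite hdotC conjCE; case: (hdot y x). Qed.

Lemma hnorm_add_sqr x y :
  hnorm (x + y) ^+ 2 =
  hnorm x ^+ 2 + hnorm y ^+ 2 + 2 * complex.Re (hdot x y).
Proof. by rewrite !hnorm_sqr (Re_formD hdot). Qed.

Lemma Re_hdot_hnorm x y : complex.Re (hdot x y) <= hnorm x * hnorm y.
Proof. by have := Re_hdot_le x y; rewrite !hnormC -rmorphM lecR. Qed.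

Lemma cauchy_schwarz x y : cabs (hdot x y) <= hnorm x * hnorm y.
Proof.
set z := hdot x y; have [->|z0] := eqVneq z 0.
  by rewrite cabs0 mulr_ge0 ?hnorm_ge0.
have c0 : 0 < cabs z.
  by rewrite lt_neqAle cabs_ge0 andbT; apply: contra z0 => /eqP/esym/cabs_eq0 ->.
have := Re_hdot_hnorm (z^* *: x) y; rewrite hdotZl -/z hnorm_scale cabs_conj -mulrA.
by rewrite mulrC -normCK -sqn_normc /= sqnE expr2 ler_pM2l.
Qed.

Lemma hdot_ext x y : (forall z, hdot z x = hdot z y) -> x = y.
Proof.
move=> xy; apply/eqP; rewrite -subr_eq0; apply/eqP/hnorm_eq0/eqP.
by rewrite -sqrf_eq0 hnorm_sqr hdotBr xy subrr.
Qed.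

Lemma hcvgP (T : Type) (F : set_system T) {FF : Filter F} (u : T -> H) l :
  (u t @[t --> F] --> l) <-> (forall e : R, 0 < e -> \forall t \near F, hnorm (u t - l) <= e).
Proof.
split=> [/cvgrPdist_le ul e e0|ul].
  have := ul ((e%:C)%C); rewrite -[0]/(((0 : R)%:C)%C) ltcR => /(_ e0).
  by apply: filterS => t; rewrite hnormC lecR hnorm_subC.
apply/cvgrPdist_le => e /gtc0_real[{}e' e0 ->].
by apply: filterS (ul _ e0) => t; rewrite hnormC lecR hnorm_subC.
Qed.

Lemma hcauchy (u : nat -> H) :
  (forall e : R, 0 < e -> exists N, forall i j, (N <= i)%N -> (N <= j)%N ->
     hnorm (u i - u j) <= e) ->
  exists l : H, u i @[i --> \oo] --> l.
Proof.
move=> uc; suff : cvg (u @ \oo) by move=> /cvg_ex.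
apply/cauchy_cvgP; apply/cauchy_ballP => _ /gtc0_real[e e0 ->].
have [N uN] := uc (e / 2) (divr_gt0 e0 (ltr0n _ 2)).
exists (u @` [set i | (N <= i)%N], u @` [set i | (N <= i)%N]).
  by split; exists N => // i Ni; exists i.
move=> [_ _] [/= [i Ni <-] [j Nj <-]]; rewrite -ball_normE /= hnormC ltcR.
by rewrite (le_lt_trans (uN _ _ Ni Nj))// ltr_pdivrMr// mulr_natr mulr2n ltrDl.
Qed.

End HilbertNorm.

Section LinearFunctions.
Variables (R : realType) (U V : lmodType R[i]) (A : U -> V).
Hypothesis Alin : linear A.

Lemma linfD x y : A (x + y) = A x + A y.
Proof. by rewrite -[x]scale1r Alin !scale1r. Qed.

Lemma linf0 : A 0 = 0.
Proof. by apply: (@addrI _ (A 0)); rewrite -linfD !addr0. Qed.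

Lemma linfZ k x : A (k *: x) = k *: A x.
Proof. by rewrite -[k *: x]addr0 Alin linf0 addr0. Qed.

Lemma linfN x : A (- x) = - A x.
Proof. by rewrite -[- x]scaleN1r linfZ scaleN1r. Qed.

Lemma linfB x y : A (x - y) = A x - A y.
Proof. by rewrite linfD linfN. Qed.

Lemma linf_sum (I : Type) (r : seq I) (F : I -> U) (P : pred I) :
  A (\sum_(i <- r | P i) F i) = \sum_(i <- r | P i) A (F i).
Proof.
elim: r => [|i r IH]; first by rewrite !big_nil linf0.
by rewrite !big_cons; case: ifP => _; rewrite ?linfD IH.
Qed.

End LinearFunctions.

Section BoundedOperators.
Variables (R : realType).
Implicit Types (H : hilbertType R).

Definition bound_by H1 H2 (c : R) (A : H1 -> H2) : Prop :=
  forall x, hnorm (A x) <= c * hnorm x.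

Lemma opnorm_leP H1 H2 (A : H1 -> H2) (c : R) : linear A -> 0 <= c ->
  (opnorm A <= c%:E)%E <-> bound_by c A.
Proof.
move=> Al c0; split=> [Ac x|Ac]; last first.
  apply: ge_ereal_sup => _ [x x1 <-]; rewrite lee_fin (le_trans (Ac x))//.
  by rewrite -[leRHS]mulr1 ler_wpM2l.
have [x0|x0] := eqVneq (hnorm x) 0.
  by rewrite (hnorm_eq0 x0) (linf0 Al) !hnorm0 mulr0.
have hx : 0 < hnorm x by rewrite lt_neqAle eq_sym x0 hnorm_ge0.
have : (hnorm (A ((((hnorm x)^-1)%:C)%C *: x)) <= c)%R.
  rewrite -lee_fin; apply: le_trans Ac; apply: ereal_sup_ubound.
  exists ((((hnorm x)^-1)%:C)%C *: x) => //=.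
  by rewrite hnorm_scale cabs_real ger0_norm ?invr_ge0 ?hnorm_ge0// mulVf.
rewrite (linfZ Al) hnorm_scale cabs_real ger0_norm ?invr_ge0 ?hnorm_ge0//.
by rewrite mulrC ler_pdivrMr.
Qed.

Lemma bounded_opP H1 H2 (A : H1 -> H2) :
  bounded_op A <-> linear A /\ exists2 c, 0 <= c & bound_by c A.
Proof.
split=> -[Al].
  move=> Ac; split=> //.
  have A0 : (0%:E <= opnorm A)%E.
    apply: ereal_sup_ubound; exists 0; rewrite /= ?hnorm0 ?ler01//.
    by rewrite (linf0 Al) hnorm0.
  case: (opnorm A) A0 Ac (@opnorm_leP _ _ A ^~ Al) => [r| |] //.
  rewrite lee_fin => r0 _ h; exists r => //; apply/(h _ r0).
  by rewrite lexx.
by move=> [c c0 Ac]; split=> //; apply: le_lt_trans (ltry c); apply/opnorm_leP.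
Qed.

Lemma bounded_comp H1 H2 H3 (A : H2 -> H3) (B : H1 -> H2) :
  bounded_op A -> bounded_op B -> bounded_op (A \o B).
Proof.
move=> /bounded_opP[Al [a a0 Aa]] /bounded_opP[Bl [b b0 Bb]]; apply/bounded_opP.
split=> [k x y /=|]; first by rewrite Bl Al.
exists (a * b) => [|x /=]; first exact: mulr_ge0.
by rewrite (le_trans (Aa _))// -mulrA ler_wpM2l.
Qed.

Lemma bounded_id H : bounded_op (idfun : H -> H).
Proof.
apply/bounded_opP; split=> //; exists 1 => // x; by rewrite mul1r.
Qed.

Lemma bounded_lin H1 H2 k (A B : H1 -> H2) :
  bounded_op A -> bounded_op B -> bounded_op (k *: A + B)%R.
Proof.
move=> /bounded_opP[Al [a a0 Aa]] /bounded_opP[Bl [b b0 Bb]]; apply/bounded_opP.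
split=> [l x y /=|].
  rewrite !addrfctE !scalrfctE Al Bl !scalerDr !scalerA [k * l]mulrC.
  by rewrite addrACA.
exists (cabs k * a + b) => [|x]; first by rewrite addr_ge0 ?mulr_ge0 ?cabs_ge0.
rewrite addrfctE scalrfctE (le_trans (hnorm_triangle _ _))// hnorm_scale mulrDl lerD// -mulrA.
by rewrite ler_wpM2l ?cabs_ge0.
Qed.

Lemma bounded0 H1 H2 : bounded_op (0 : H1 -> H2).
Proof.
apply/bounded_opP; split=> [k x y|]; first by rewrite scaler0 addr0.
by exists 0 => // x; rewrite hnorm0 mul0r.
Qed.

Lemma boundedZ H1 H2 k (A : H1 -> H2) : bounded_op A -> bounded_op (k *: A).
Proof. by move=> Ab; rewrite -[k *: A]addr0; apply: bounded_lin (bounded0 _ _). Qed.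

Lemma boundedD H1 H2 (A B : H1 -> H2) :
  bounded_op A -> bounded_op B -> bounded_op (A + B)%R.
Proof. by move=> Ab Bb; rewrite -[A]scale1r; exact: bounded_lin. Qed.

Lemma bounded_sum H1 H2 (I : Type) (r : seq I) (F : I -> H1 -> H2) :
  (forall i, bounded_op (F i)) -> bounded_op (\sum_(i <- r) F i).
Proof.
move=> Fb; elim: r => [|i r IH]; first by rewrite big_nil; exact: bounded0.
by rewrite big_cons; exact: boundedD.
Qed.

Lemma fct_sum H1 H2 (I : Type) (r : seq I) (F : I -> H1 -> H2) x :
  (\sum_(i <- r) F i) x = \sum_(i <- r) F i x.
Proof.
by elim: r => [|i r IH]; rewrite ?big_nil ?big_cons// addrfctE IH.
Qed.

Lemma bounded_cvg H1 H2 (A : H1 -> H2) (T : Type) (F : set_system T)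
    {FF : Filter F} (u : T -> H1) (l : H1) :
  bounded_op A -> u t @[t --> F] --> l -> A (u t) @[t --> F] --> A l.
Proof.
move=> /bounded_opP[Al [a a0 Aa]] /hcvgP ul; apply/hcvgP => e e0.
have a1 : 0 < a + 1 by rewrite ltr_wpDl.
apply: filterS (ul (e / (a + 1)) (divr_gt0 e0 a1)) => t.
rewrite -(linfB Al) ler_pdivlMr// => h; apply: le_trans (Aa _) (le_trans _ h).
by rewrite mulrC ler_wpM2l ?hnorm_ge0// lerDl.
Qed.

Lemma hcvg_unique H (T : Type) (F : set_system T) {FF : ProperFilter F}
  (u : T -> H) (l1 l2 : H) : u t @[t --> F] --> l1 -> u t @[t --> F] --> l2 -> l1 = l2.
Proof. exact: cvg_unique. Qed.

Lemma hdot_cvg H (T : Type) (F : set_system T) {FF : Filter F}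
    (u v : T -> H) (l m : H) :
  u t @[t --> F] --> l -> v t @[t --> F] --> m ->
  forall e : R, 0 < e -> \forall t \near F, cabs (hdot (u t) (v t) - hdot l m) <= e.
Proof.
move=> /hcvgP ul /hcvgP vm e e0.
pose c := hnorm l + hnorm m + 1.
have c0 : 0 < c by rewrite ltr_wpDl// addr_ge0// hnorm_ge0.
pose d := Num.min 1 (e / (c + c)).
have d0 : 0 < d by rewrite lt_min ltr01 divr_gt0// addr_gt0.
apply: filterS2 (ul _ d0) (vm _ d0) => t tu tv.
have -> : hdot (u t) (v t) - hdot l m = hdot (u t - l) (v t) + hdot l (v t - m).
  by rewrite hdotBl hdotBr subrKA.
apply: (le_trans (cabsD _ _)).
have hv : hnorm (v t) <= c.
  have d1 : d <= 1 by rewrite ge_min lexx.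
  have := hnorm_triangle (v t - m) m; rewrite subrK /c.
  have := hnorm_ge0 l; lra.
have hl : hnorm l <= c by rewrite /c -addrA lerDl addr_ge0 ?hnorm_ge0.
have de : d * (c + c) <= e.
  have cc : 0 < c + c by rewrite addr_gt0.
  by rewrite -(ler_pdivlMr _ _ cc) /d ge_min lexx orbT.
apply: le_trans de; rewrite mulrDr lerD//.
  by rewrite (le_trans (cauchy_schwarz _ _))// ler_pM ?hnorm_ge0.
by rewrite (le_trans (cauchy_schwarz _ _))// mulrC ler_pM ?hnorm_ge0.
Qed.

Lemma hdot_cvg0 H (T : Type) (F : set_system T) {FF : ProperFilter F}
    (u v : T -> H) (l m : H) :
  u t @[t --> F] --> l -> v t @[t --> F] --> m ->
  (\forall t \near F, hdot (u t) (v t) = 0) -> hdot l m = 0.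
Proof.
move=> ul vm uv0; apply: cabs_eq0; apply/eqP; rewrite eq_le cabs_ge0 andbT.
apply/ler_addgt0Pl => e e0.
have FF1 : Filter F by exact: _.
have H1 := @filterI _ F FF1 _ _ uv0 (@hdot_cvg _ _ F FF1 _ _ _ _ ul vm e e0).
have [t [tv te]] := @filter_ex _ F FF _ H1.
by rewrite addr0; move: te; rewrite tv sub0r cabsN.
Qed.

End BoundedOperators.

Section Riesz.
Variables (R : realType).

Lemma Re_ImE (z : R[i]) : complex.Im z = complex.Re (- 'i%C * z).
Proof. by case: z => a b /=; ring. Qed.

(** A bounded functional is represented by the minimizer of
    |x|^2 - 2 Re phi(x): a minimizing sequence is Cauchy by the parallelogram
    law, and at the minimum the derivative in each direction vanishes. *)
Lemma riesz (H : hilbertType R) (phi : H -> R[i]) (c : R) :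
  (forall k x y, phi (k *: x + y) = k * phi x + phi y) ->
  (forall x, cabs (phi x) <= c * hnorm x) ->
  exists y, forall x, phi x = hdot x y.
Proof.
move=> philin phic.
have phiD x y : phi (x + y) = phi x + phi y.
  by rewrite -[x]scale1r philin scale1r mul1r.
have phi0 : phi 0 = 0 by apply: (@addrI _ (phi 0)); rewrite -phiD !addr0.
have phiZ k x : phi (k *: x) = k * phi x.
  by rewrite -[k *: x]addr0 philin phi0 addr0.
pose Q x := hnorm x ^+ 2 - 2 * complex.Re (phi x).
have Qlb x : - c ^+ 2 <= Q x.
  have := Re_le_cabs (phi x); have := phic x; have := sqr_ge0 (hnorm x - c).
  rewrite /Q; nra.
pose m := inf (range Q).
have hi : has_inf (range Q).
  split; first by exists (Q 0), 0.
  by exists (- c ^+ 2) => _ [x _ <-].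
have mQ x : m <= Q x by apply: ge_inf; [case: hi|exists x].
have ex k : exists x, Q x < m + k.+1%:R^-1.
  have := inf_adherent (eps := k.+1%:R^-1) _ hi.
  by rewrite invr_gt0 ltr0n => /(_ isT)[_ [x _ <-]]; exists x.
have [u uQ] := choice ex.
have half_sqr x : hnorm (((2^-1 : R)%:C)%C *: x) ^+ 2 = hnorm x ^+ 2 / 4.
  rewrite hnorm_scale cabs_real ger0_norm ?invr_ge0 ?ler0n// exprMn mulrC; congr (_ * _).
  by rewrite exprVn; congr (_ ^-1); ring.
have para x y : hnorm (x - y) ^+ 2 <= 2 * Q x + 2 * Q y - 4 * m.
  have := mQ (((2^-1 : R)%:C)%C *: (x + y)).
  rewrite /Q half_sqr phiZ Re_realM phiD ReD.
  have := hnorm_add_sqr x y; have := hnorm_add_sqr x (- y).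
  rewrite hnorm_opp hdotNr [complex.Re (- _)]raddfN /=; lra.
have [l ul] : exists l : H, u i @[i --> \oo] --> l.
  apply: hcauchy => e e0.
  have e4 : 0 < e ^+ 2 / 4 by rewrite divr_gt0// exprn_gt0.
  have [N NP] := @ltr_add_invr R 0 (e ^+ 2 / 4) e4.
  rewrite add0r in NP.
  have small i : (N <= i)%N -> (i.+1%:R^-1 : R) <= e ^+ 2 / 4.
    move=> Ni; apply: le_trans (ltW NP); rewrite lef_pV2 ?posrE ?ltr0n//.
    by rewrite ler_nat.
  exists N => i j /small si /small sj.
  rewrite -(@ler_pXn2r _ 2) ?nnegrE ?hnorm_ge0 ?(ltW e0)//.
  move: (para (u i) (u j)) (uQ i) (uQ j) si sj.
  move: (Q (u i)) (Q (u j)) (i.+1%:R^-1) (j.+1%:R^-1) (hnorm _ ^+ 2) (e ^+ 2).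
  by move=> a b a' b' h e'; lra.
have Re_eq z : complex.Re (hdot l z) = complex.Re (phi z).
  apply/eqP; rewrite -subr_eq0; apply/eqP.
  set E := _ - _.
  have Eb k : (complex.Re (hdot (u k) z) - complex.Re (phi z)) ^+ 2 <=
      hnorm z ^+ 2 / k.+1%:R.
    set d := _ - _.
    have [z0|z0] := eqVneq (hnorm z) 0.
      by rewrite /d (hnorm_eq0 z0) hdot0r phi0 subrr !hnorm0 expr0n mul0r.
    have zp : 0 < hnorm z ^+ 2 by rewrite exprn_even_gt0.
    have tP (t : R) : 0 <= t ^+ 2 * hnorm z ^+ 2 + 2 * t * d + k.+1%:R^-1.
      have := mQ (u k + (t%:C)%C *: z); have := uQ k.
      rewrite /Q hnorm_add_sqr hnorm_scale cabs_real exprMn real_normK ?num_real//.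
      rewrite phiD phiZ ReD Re_realM Re_hdotC hdotZl Re_realM Re_hdotC /d.
      generalize m => m'; move: (k.+1%:R^-1) (hnorm z ^+ 2) (hnorm (u k) ^+ 2) => b Z U.
      by move: (complex.Re _) (complex.Re _) (complex.Re _) => A B D; lra.
    pose t := - d / hnorm z ^+ 2; have := tP t.
    have -> : t ^+ 2 * hnorm z ^+ 2 + 2 * t * d = - (d ^+ 2 / hnorm z ^+ 2).
      by rewrite /t; field; exact: z0.
    rewrite addrC subr_ge0 ler_pdivrMr// mulrC => h; apply: le_trans h _.
    by [].
  apply/eqP; rewrite -normr_eq0 eq_le normr_ge0 andbT; apply/ler_addgt0Pl => e e0.
  rewrite addr0.
  have e2 : 0 < e / 2 by rewrite divr_gt0.
  have cz : u i @[i --> \oo] --> l := ul.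
  have := @hdot_cvg R H nat \oo _ u (fun=> z) l z cz (cvg_cst _) _ e2.
  pose d := (e / 2) ^+ 2 / (hnorm z ^+ 2 + 1).
  have zp : 0 < hnorm z ^+ 2 + 1 by rewrite ltr_wpDl// sqr_ge0.
  have d0 : 0 < d by rewrite divr_gt0// exprn_gt0.
  have [N NP] := @ltr_add_invr R 0 d d0; rewrite add0r in NP.
  move=> [N' _ N'P].
  have := N'P (maxn N N') (leq_maxr _ _); set k := maxn N N' => /= h1.
  have kd : k.+1%:R^-1 <= d.
    apply: le_trans (ltW NP); rewrite lef_pV2 ?posrE ?ltr0n// ler_nat ltnS.
    exact: leq_maxl.
  have h2 : `|complex.Re (hdot (u k) z) - complex.Re (phi z)| <= e / 2.
    rewrite -(@ler_pXn2r _ 2) ?nnegrE ?(ltW e2)// real_normK ?num_real//.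
    apply: (le_trans (Eb k)); apply: (@le_trans _ _ (hnorm z ^+ 2 * d)).
      by rewrite ler_wpM2l// sqr_ge0.
    rewrite /d mulrCA ler_piMr ?sqr_ge0// ler_pdivrMr// mul1r lerDl ler01//.
  have h3 : `|complex.Re (hdot (u k) z) - complex.Re (hdot l z)| <= e / 2.
    apply: le_trans h1; rewrite -[_ - complex.Re _]raddfB /=.
    by have := normc_ge_Re (hdot (u k) z - hdot l z); rewrite cabsE lecR.
  have -> : E = (complex.Re (hdot (u k) z) - complex.Re (phi z)) -
      (complex.Re (hdot (u k) z) - complex.Re (hdot l z)) by rewrite /E; ring.
  rewrite (le_trans (ler_normB _ _))//; lra.
exists l => x.
have Im_eq : complex.Im (hdot x l) = complex.Im (phi x).
  by rewrite !Re_ImE -hdotZl -phiZ -Re_eq Re_hdotC.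
have := Re_eq x; rewrite Re_hdotC; move: Im_eq.
by case: (hdot x l) (phi x) => a b [a' b'] /= -> ->.
Qed.

Lemma adjoint_exists (H1 H2 : hilbertType R) (A : H1 -> H2) :
  bounded_op A -> exists B, forall x y, hdot (A x) y = hdot x (B y).
Proof.
move=> /bounded_opP[Al [a a0 Aa]].
have ex y : exists z, forall x, hdot (A x) y = hdot x z.
  apply: (@riesz _ (fun x => hdot (A x) y) (a * hnorm y)) => [k x x'|x].
    by rewrite Al hdotDl hdotZl.
  rewrite (le_trans (cauchy_schwarz _ _))// mulrAC ler_wpM2r ?hnorm_ge0//.
have [B BP] := choice ex; by exists B => x y; exact: BP.
Qed.

Lemma hdot_adjoint (H1 H2 : hilbertType R) (A : H1 -> H2) x y :
  bounded_op A -> hdot (A x) y = hdot x (adjoint A y).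
Proof.
move=> /adjoint_exists[B BP]; rewrite /adjoint.
by case: xgetP => [B' _ /= -> //|/(_ B) []].
Qed.

Lemma adjoint_hdot (H1 H2 : hilbertType R) (A : H1 -> H2) x y :
  bounded_op A -> hdot (adjoint A y) x = hdot y (A x).
Proof. by move=> Ab; rewrite hdotC -hdot_adjoint// -hdotC. Qed.

Lemma adjoint_unique (H1 H2 : hilbertType R) (A : H1 -> H2) (B : H2 -> H1) :
  bounded_op A -> (forall x y, hdot (A x) y = hdot x (B y)) -> adjoint A = B.
Proof.
move=> Ab AB; apply/funext => y; apply: hdot_ext => z.
by rewrite -hdot_adjoint// AB.
Qed.

Lemma adjoint_bound (H1 H2 : hilbertType R) (A : H1 -> H2) (c : R) :
  bounded_op A -> 0 <= c -> bound_by c A -> bound_by c (adjoint A).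
Proof.
move=> Ab c0 Ac y; set z := adjoint A y.
have [->|z0] := eqVneq (hnorm z) 0; first by rewrite mulr_ge0 ?hnorm_ge0.
have zp : 0 < hnorm z by rewrite lt_neqAle eq_sym z0 hnorm_ge0.
rewrite -(ler_pM2l zp) -expr2 hnorm_sqr {2}/z -hdot_adjoint//.
rewrite (le_trans (Re_hdot_hnorm _ _))// mulrCA mulrA ler_wpM2r ?hnorm_ge0//.
Qed.

Lemma bounded_adjoint (H1 H2 : hilbertType R) (A : H1 -> H2) :
  bounded_op A -> bounded_op (adjoint A).
Proof.
move=> Ab; have /bounded_opP[Al [a a0 Aa]] := Ab; apply/bounded_opP; split.
  move=> k x y; apply: hdot_ext => z.
  by rewrite hdotDr hdotZr -!hdot_adjoint// hdotDr hdotZr.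
by exists a => //; exact: adjoint_bound.
Qed.

(** The projection of x represents the functional <., x> on the orthocomplement. *)
Lemma projectionP (K : hilbertType R) (A : set K) (x : K) (z : orthocomp A) :
  hdot (projection A x) z = hdot x (orthocomp_val z).
Proof.
have [y yP] : exists y : orthocomp A, forall z : orthocomp A,
    hdot (orthocomp_val z) x = hdot z y.
  apply: (@riesz _ (fun z => hdot (orthocomp_val z) x) (hnorm x)) => [k z1 z2|z1].
    by rewrite [orthocomp_val _]/= hdotDl hdotZl.
  by rewrite mulrC; exact: cauchy_schwarz.
rewrite /projection; case: xgetP => [y' _ /= y'P|/(_ y) []].
  have := y'P z; rewrite hdotBl => /eqP; rewrite subr_eq0 => /eqP ->.
  by [].
move=> z1 /=; rewrite hdotBl hdotC yP -hdotC -[X in _ - X]/(hdot y z1).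
exact: subrr.
Qed.

End Riesz.

(** * Words, formal series and their evaluation *)

Section WordSumRecursion.
Variables (V : nmodType) (n : nat).
Implicit Types (F : word n -> V) (k N : nat).

Definition degree_sum k F : V := \sum_(a : k.-tuple 'I_n) F a.

Lemma degree_sum0 F : degree_sum 0 F = F [::].
Proof.
rewrite /degree_sum (big_pred1 [tuple]) // => a; apply/esym/eqP.
by rewrite (tuple0 a).
Qed.

Lemma degree_sumS k F :
  degree_sum k.+1 F = \sum_i degree_sum k (fun a => F (i :: a)).
Proof.
rewrite /degree_sum pair_big /=.
rewrite (reindex (fun p : 'I_n * k.-tuple 'I_n => [tuple of p.1 :: p.2])) //=.
exists (fun a : k.+1.-tuple 'I_n => (thead a, [tuple of behead a])) => [[i a]|a] _ /=.
  by rewrite theadE; congr pair; apply: val_inj.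
by rewrite [RHS]tuple_eta.
Qed.

Lemma eq_degree_sum k F G : (forall a, size a = k -> F a = G a) ->
  degree_sum k F = degree_sum k G.
Proof. by move=> FG; apply: eq_bigr => a _; apply: FG; rewrite size_tuple. Qed.

Lemma wsumE N F : wsum N F = \sum_(k < N) degree_sum k F.
Proof. by []. Qed.

Lemma wsumSr N F : wsum N.+1 F = wsum N F + degree_sum N F.
Proof. by rewrite /wsum big_ord_recr. Qed.

Lemma wsumSl N F :
  wsum N.+1 F = F [::] + \sum_i wsum N (fun a => F (i :: a)).
Proof.
rewrite wsumE big_ord_recl degree_sum0 exchange_big /=; congr (_ + _).
by apply: eq_bigr => k _; rewrite [degree_sum _ _]degree_sumS.
Qed.

Lemma eq_wsum_lt N F G : (forall a, (size a < N)%N -> F a = G a) ->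
  wsum N F = wsum N G.
Proof.
move=> FG; rewrite !wsumE; apply: eq_bigr => k _; apply: eq_degree_sum => a ak.
by apply: FG; rewrite ak.
Qed.

Lemma wsum_eq0 N F : (forall a, (size a < N)%N -> F a = 0) -> wsum N F = 0.
Proof.
move=> F0; rewrite (@eq_wsum_lt N F (fun=> 0))//.
by rewrite /wsum big1// => k _; rewrite big1.
Qed.

Lemma wsum0 F : wsum 0 F = 0. Proof. by rewrite /wsum big_ord0. Qed.

Lemma wsum_stable N N' F : (N <= N')%N ->
  (forall a, (N <= size a)%N -> F a = 0) -> wsum N' F = wsum N F.
Proof.
move=> /subnK <- F0; elim: (N' - N)%N => // k IH.
rewrite addSn wsumSr IH [degree_sum _ _]big1 ?addr0// => a _; apply: F0.
by rewrite size_tuple leq_addl.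
Qed.

Lemma wsum_only N F b : (size b < N)%N -> (forall a, a != b -> F a = 0) ->
  wsum N F = F b.
Proof.
move=> bN Fb; rewrite /wsum (bigD1 (Ordinal bN)) //= (bigD1 (in_tuple b)) //=.
rewrite big1 => [|a ab]; last first.
  by apply: Fb; apply: contra ab => /eqP ab; apply/eqP/val_inj.
rewrite big1 ?addr0// => k kb; rewrite big1// => a _; apply: Fb.
by apply: contra kb => /eqP ab; apply/eqP/val_inj; rewrite /= -ab size_tuple.
Qed.

End WordSumRecursion.

Lemma linf_wsum (R : realType) (n N : nat) (U V : lmodType R[i]) (A : U -> V)
    (F : word n -> U) :
  linear A -> A (wsum N F) = wsum N (fun a => A (F a)).
Proof.
move=> Al; rewrite /wsum (linf_sum Al); apply: eq_bigr => k _.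
exact: (linf_sum Al).
Qed.

Lemma wsumZ (R : realType) (n N : nat) (V : lmodType R[i]) k (F : word n -> V) :
  wsum N (fun a => k *: F a) = k *: wsum N F.
Proof.
rewrite -(@linf_wsum _ _ _ _ _ (fun x : V => k *: x))// => l x y.
by rewrite scalerDr !scalerA mulrC.
Qed.

Section WordAction.
Variables (R : realType) (n : nat).
Local Notation C := R[i].
Local Notation series := (ncseries R n).
Implicit Types (p q : series) (w a b : word n).

Definition left_quotient i p : series := fun w => p (i :: w).

Definition mono a : series := fun w => (w == a)%:R.

Lemma series_mul_nil p q : series_mul p q [::] = p [::] * q [::].
Proof. by rewrite /series_mul /= big_ord_recl big_ord0 addr0. Qed.

Lemma series_mul_cons p q i w : series_mul p q (i :: w) =
  p [::] * q (i :: w) + series_mul (left_quotient i p) q w.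
Proof. by rewrite /series_mul big_ord_recl. Qed.

Lemma series_mulDl k p p' q :
  series_mul (k *: p + p') q = k *: series_mul p q + series_mul p' q.
Proof.
apply/funext => w; rewrite -[RHS]/(k * series_mul p q w + series_mul p' q w).
rewrite /series_mul mulr_sumr -big_split.
by apply: eq_bigr => j _; rewrite /= mulrA -mulrDl.
Qed.

Lemma series_mulDr k p q q' :
  series_mul p (k *: q + q') = k *: series_mul p q + series_mul p q'.
Proof.
apply/funext => w; rewrite -[RHS]/(k * series_mul p q w + series_mul p q' w).
rewrite /series_mul mulr_sumr -big_split.
by apply: eq_bigr => j _; rewrite /= mulrCA -mulrDr.
Qed.

Lemma linear_series_mull q : linear (fun p : series => series_mul p q).
Proof. by move=> k p p'; exact: series_mulDl. Qed.

Lemma linear_series_mul p : linear (series_mul p).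
Proof. by move=> k q q'; exact: series_mulDr. Qed.

Lemma series_mul_suml (I : Type) (r : seq I) (F : I -> series) p :
  series_mul (\sum_(i <- r) F i) p = \sum_(i <- r) series_mul (F i) p.
Proof. exact: (linf_sum (linear_series_mull p)). Qed.

Lemma series_mulA p q r :
  series_mul (series_mul p q) r = series_mul p (series_mul q r).
Proof.
apply/funext => w; elim: w p q r => [|i w IH] p q r.
  by rewrite !series_mul_nil mulrA.
rewrite !series_mul_cons series_mul_nil.
have -> : left_quotient i (series_mul p q) = p [::] *: left_quotient i q + series_mul (left_quotient i p) q.
  by apply/funext => v; rewrite /left_quotient series_mul_cons.
by rewrite series_mulDl mulrDr -addrA -mulrA -IH.
Qed.

Lemma series_mul1 p : series_mul p (@series_one R n) = p.
Proof.
apply/funext => w; elim: w p => [|i w IH] p.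
  by rewrite series_mul_nil /series_one eqxx mulr1.
by rewrite series_mul_cons /series_one /= mulr0 add0r IH.
Qed.

Lemma series_1mul p : series_mul (@series_one R n) p = p.
Proof.
apply/funext => -[|i w]; first by rewrite series_mul_nil /series_one eqxx mul1r.
rewrite series_mul_cons /series_one eqxx mul1r /series_mul big1 ?addr0// => k _.
by rewrite /left_quotient /= mul0r.
Qed.

Lemma series_mul_local p p' q q' w :
  (forall v, (size v <= size w)%N -> p v = p' v) ->
  (forall v, (size v <= size w)%N -> q v = q' v) ->
  series_mul p q w = series_mul p' q' w.
Proof.
move=> pp' qq'; apply: eq_bigr => k _; congr (_ * _).
  by apply: pp'; rewrite size_take; case: ltnP => // /ltnW.
by apply: qq'; rewrite size_drop leq_subr.
Qed.

Lemma series_X_mul_nil i p : series_mul (series_X R i) p [::] = 0.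
Proof. by rewrite series_mul_nil /series_X mul0r. Qed.

Lemma series_X_mul_cons i p j w :
  series_mul (series_X R i) p (j :: w) = (j == i)%:R * p w.
Proof.
rewrite series_mul_cons /series_X mul0r add0r.
rewrite -[in RHS](series_1mul p) /series_mul mulr_sumr; apply: eq_bigr => k _.
by rewrite /left_quotient /series_one eqseq_cons mulrA -natrM mulnb.
Qed.

Lemma series_X_mul_mono i a : series_mul (series_X R i) (mono a) = mono (i :: a).
Proof.
apply/funext => -[|j w]; first by rewrite series_X_mul_nil.
by rewrite series_X_mul_cons /mono -natrM mulnb -eqseq_cons.
Qed.

Lemma mono_nil : mono [::] = @series_one R n. Proof. by []. Qed.

Lemma mono1 i : mono [:: i] = series_X R i. Proof. by []. Qed.

Lemma wsum_mono N p w :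
  wsum N (fun a => p a *: mono a) w = if (size w < N)%N then p w else 0.
Proof.
have -> : wsum N (fun a => p a *: mono a) w = wsum N (fun a => p a * mono a w).
  rewrite /wsum; elim/big_ind2: _ => [//|_ x _ y <- <- //|k _].
  by elim/big_ind2: _ => [//|_ x _ y <- <- //|a _].
case: ifPn => [wN|wN].
  rewrite (wsum_only (b := w))// /mono ?eqxx ?mulr1// => a aw.
  by rewrite eq_sym (negbTE aw) mulr0.
apply: wsum_eq0 => a aN; rewrite /mono; case: eqVneq => [wa|]; last by rewrite mulr0.
by rewrite wa aN in wN.
Qed.

Section Action.
Variables (V : lmodType C) (Y : 'I_n -> V -> V).
Hypothesis Ylin : forall i, linear (Y i).

Definition wact a (v : V) : V := foldr Y v a.

(** V need not be a Hilbert space: with V the formal series and Y_i the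
    multiplication by f_i, evaluation at Y is composition with f, so that one
    calculus serves both. *)
Definition peval N p v : V := wsum N (fun a => p a *: wact a v).

Lemma wact_cat a b v : wact (a ++ b) v = wact a (wact b v).
Proof. by rewrite /wact foldr_cat. Qed.

Lemma linear_wact a : linear (wact a).
Proof. by move=> k x y; elim: a => //= i a ->; rewrite Ylin. Qed.

Lemma linear_wsum_act N p : linear (peval N p).
Proof.
move=> k x y; rewrite /peval.
transitivity (wsum N (fun a => k *: (p a *: wact a x) + p a *: wact a y)).
  by apply: eq_wsum => a; rewrite linear_wact scalerDr !scalerA mulrC.
by rewrite wsumD wsumZ.
Qed.

Lemma peval_lin N k p q v : peval N (k *: p + q) v = k *: peval N p v + peval N q v.
Proof.
transitivity (wsum N (fun a => k *: (p a *: wact a v) + q a *: wact a v)).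
  by apply: eq_wsum => a; rewrite addrfctE scalrfctE scalerDl scalerA.
by rewrite wsumD wsumZ.
Qed.

Lemma peval_stable N N' p v : degree_lt N p -> (N <= N')%N ->
  peval N' p v = peval N p v.
Proof.
by move=> pN NN'; apply: wsum_stable => // a aN; rewrite pN// scale0r.
Qed.

Lemma peval_consE N p v :
  peval N.+1 p v = p [::] *: v + \sum_i Y i (peval N (left_quotient i p) v).
Proof.
rewrite /peval wsumSl; congr (_ + _); apply: eq_bigr => i _.
rewrite (linf_wsum _ _ (Ylin i)); apply: eq_wsum => a.
by rewrite (linfZ (Ylin i)).
Qed.

Lemma degree_lt_left_quotient N i p : degree_lt N.+1 p -> degree_lt N (left_quotient i p).
Proof. by move=> pN w wN; apply: pN. Qed.

Lemma peval_mul N1 N2 p q v : degree_lt N1 p -> degree_lt N2 q ->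
  peval (N1 + N2) (series_mul p q) v = peval N1 p (peval N2 q v).
Proof.
move=> + qN; elim: N1 p => [|N1 IH] p pN.
  rewrite /peval wsum0; apply: wsum_eq0 => a _.
  by rewrite /series_mul big1 ?scale0r// => k _; rewrite pN// mul0r.
rewrite addSn !peval_consE series_mul_nil.
have -> : \sum_i Y i (peval (N1 + N2) (left_quotient i (series_mul p q)) v) =
    p [::] *: (\sum_i Y i (peval (N1 + N2) (left_quotient i q) v)) +
    \sum_i Y i (peval N1 (left_quotient i p) (peval N2 q v)).
  rewrite scaler_sumr -big_split; apply: eq_bigr => i _.
  rewrite -IH; last exact: degree_lt_left_quotient.
  rewrite /= -(linfZ (Ylin i)) -(linfD (Ylin i)) -peval_lin; congr (Y i (peval _ _ _)).
  by apply/funext => w; rewrite /left_quotient series_mul_cons.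
rewrite addrA -scalerA -scalerDr -(peval_consE (N1 + N2) q).
by rewrite (peval_stable _ qN) // -addSn leq_addl.
Qed.

Lemma peval_mono N a v : (size a < N)%N -> peval N (mono a) v = wact a v.
Proof.
move=> aN; rewrite /peval (wsum_only (b := a)) ?/mono ?eqxx ?scale1r// => b ba.
by rewrite (negbTE ba) scale0r.
Qed.

(** Truncation at N on one side matches truncation at N + |a| on the other,
    which is why p may be an infinite series. *)
Lemma peval_mul_mono N p a v :
  peval (N + size a) (series_mul p (mono a)) v = peval N p (wact a v).
Proof.
elim: N p => [|N IH] p.
  rewrite /peval !wsum0; apply: wsum_eq0 => w wa.
  rewrite /series_mul big1 ?scale0r// => k _; rewrite /mono.
  case: eqVneq => [E|_]; last by rewrite mulr0.
  by have := leq_subr k (size w); rewrite -size_drop E leqNgt wa.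
rewrite addSn !peval_consE series_mul_nil.
have -> : \sum_i Y i (peval (N + size a) (left_quotient i (series_mul p (mono a))) v) =
    p [::] *: (\sum_i Y i (peval (N + size a) (left_quotient i (mono a)) v)) +
    \sum_i Y i (peval N (left_quotient i p) (wact a v)).
  rewrite scaler_sumr -big_split; apply: eq_bigr => i _.
  rewrite -IH /= -(linfZ (Ylin i)) -(linfD (Ylin i)) -peval_lin; congr (Y i (peval _ _ _)).
  by apply/funext => w; rewrite /left_quotient series_mul_cons.
rewrite addrA -scalerA -scalerDr -(peval_consE (N + size a) (mono a)).
by rewrite peval_mono// ltnS leq_addl.
Qed.

End Action.

Lemma mono_degree a : degree_lt (size a).+1 (mono a).
Proof.
by move=> w; rewrite /mono; case: eqVneq => // ->; rewrite ltnn.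
Qed.

End WordAction.

Section SeriesWords.
Variables (R : realType) (n : nat).
Local Notation series := (ncseries R n).
Implicit Types (p q : series) (f : 'I_n -> series) (w a b : word n).

Lemma series_wordE f a :
  series_word f a = wact (fun i => series_mul (f i)) a (@series_one R n).
Proof. by []. Qed.

Lemma series_compE N p f :
  series_comp N p f = peval (fun i => series_mul (f i)) N p (@series_one R n).
Proof. by []. Qed.

Lemma wact_series_mul f a p :
  wact (fun i => series_mul (f i)) a p = series_mul (series_word f a) p.
Proof. by elim: a => [|i a IH]; rewrite /= ?series_1mul// IH series_mulA. Qed.

Lemma peval_series_mul f N p q :
  peval (fun i => series_mul (f i)) N p q = series_mul (series_comp N p f) q.
Proof.
rewrite /series_comp /wsum series_mul_suml; apply: eq_bigr => k _.
rewrite series_mul_suml; apply: eq_bigr => a _; rewrite wact_series_mul.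
by rewrite (linfZ (linear_series_mull q)).
Qed.

Lemma series_word_X a : series_word (@series_X R n) a = mono R a.
Proof. by elim: a => //= i a ->; rewrite series_X_mul_mono. Qed.

Lemma degree_lt_mul N1 N2 p q : degree_lt N1 p -> degree_lt N2 q ->
  degree_lt (N1 + N2) (series_mul p q).
Proof.
move=> pN qN w wN; rewrite /series_mul big1// => k _.
have [N1k|kN1] := leqP N1 k.
  by rewrite pN ?mul0r// size_takel// -ltnS.
rewrite qN ?mulr0// size_drop; move: wN kN1; lia.
Qed.

Lemma degree_lt_leq N N' p : (N <= N')%N -> degree_lt N p -> degree_lt N' p.
Proof. by move=> NN' pN w wN; apply: pN; exact: leq_trans wN. Qed.

Lemma degree_lt_word N f a : (forall i, degree_lt N (f i)) ->
  degree_lt (size a * N).+1 (series_word f a).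
Proof.
move=> fN; elim: a => [|i a IH]; first exact: (@mono_degree R n [::]).
by rewrite mulSn -addnS; exact: degree_lt_mul.
Qed.

End SeriesWords.

(** * Evaluation with geometric convergence *)

Section AbsoluteSums.
Variables (R : realType) (n : nat) (H : hilbertType R).
Local Notation series := (ncseries R n).
Implicit Types (psi : series) (Y : 'I_n -> H -> H) (A : H -> H) (c s r : R).

Definition dilate r psi : series := fun a => (r%:C)%C ^+ size a * psi a.

Definition degree_term psi Y k (x : H) : H :=
  degree_sum k (fun a => psi a *: wact Y a x).

Lemma op_wordE Y a x : op_word Y a x = wact Y a x.
Proof. by elim: a => //= i a <-. Qed.

Lemma partial_evalE psi Y N x : partial_eval psi Y N x = peval Y N psi x.
Proof.
rewrite /partial_eval /peval /wsum fct_sum; apply: eq_bigr => k _.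
by rewrite fct_sum; apply: eq_bigr => a _; rewrite scalrfctE op_wordE.
Qed.

Lemma peval_recr psi Y N x :
  peval Y N.+1 psi x = peval Y N psi x + degree_term psi Y N x.
Proof. exact: wsumSr. Qed.

Lemma tuple_linear Y : bounded_tuple Y -> forall i, linear (Y i).
Proof. by move=> Yb i; case: (Yb i). Qed.

Lemma bounded_word Y a : bounded_tuple Y -> bounded_op (op_word Y a).
Proof.
move=> Yb; elim: a => [|i a IH] /=; first exact: bounded_id.
exact: bounded_comp.
Qed.

Lemma bounded_partial psi Y N : bounded_tuple Y -> bounded_op (partial_eval psi Y N).
Proof.
move=> Yb; apply: bounded_sum => k; apply: bounded_sum => a; apply: boundedZ.
exact: bounded_word.
Qed.

Lemma bounded_peval psi Y N : bounded_tuple Y -> bounded_op (peval Y N psi).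
Proof.
move=> Yb; have -> : peval Y N psi = partial_eval psi Y N.
  by apply/funext => x; rewrite partial_evalE.
exact: bounded_partial.
Qed.

(** The sum of psi(Y) when it converges in norm at a geometric rate. *)
Definition geom_sum psi Y A : Prop := bounded_op A /\
  exists c s, [/\ 0 <= c, 0 <= s < 1 &
    forall N x, hnorm (A x - peval Y N psi x) <= c * s ^+ N * hnorm x].

(** Geometric decay of the homogeneous parts: it survives dilation of Y and gives
    convergence in norm with explicit errors. *)
Definition tame c s psi Y : Prop :=
  forall k x, hnorm (degree_term psi Y k x) <= c * s ^+ k * hnorm x.

Lemma tame_increment c s psi Y N M x : 0 <= s < 1 -> tame c s psi Y ->
  (N <= M)%N ->
  hnorm (peval Y M psi x - peval Y N psi x) * (1 - s) <=
  c * (s ^+ N - s ^+ M) * hnorm x.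
Proof.
move=> /andP[s0 s1] t /subnK <-; elim: (M - N)%N => [|k IH].
  by rewrite !add0n !subrr hnorm0 mulr0 !mul0r.
rewrite addSn peval_recr addrAC exprS.
have := hnorm_triangle (peval Y (k + N) psi x - peval Y N psi x) (degree_term psi Y (k + N) x).
have := t (k + N)%N x; move: IH.
move: (hnorm _) (hnorm _) (hnorm (_ + _)) (hnorm x) (s ^+ _) (s ^+ N).
move=> a b d h u v; have : 0 < 1 - s by lra. nra.
Qed.

Lemma geometric_small s (e : R) : 0 <= s < 1 -> 0 < e ->
  exists N, forall k, (N <= k)%N -> s ^+ k <= e.
Proof.
move=> /andP[s0 s1] e0.
have : (fun k => s ^+ k) @ \oo --> (0 : R) by apply: cvg_expr; rewrite ger0_norm.
move=> /cvgrPdist_le /(_ e e0)[N _ NP]; exists N => k Nk.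
by have := NP k Nk; rewrite sub0r normrN ger0_norm// exprn_ge0.
Qed.

Lemma tame_geom_error c s psi Y A N x : 0 <= s < 1 -> 0 <= c -> tame c s psi Y ->
  peval Y k psi x @[k --> \oo] --> A x ->
  hnorm (A x - peval Y N psi x) * (1 - s) <= c * s ^+ N * hnorm x.
Proof.
move=> s01 c0 t /hcvgP cA; have /andP[s0 s1] := s01.
have s10 : 0 < 1 - s by rewrite subr_gt0.
apply/ler_addgt0Pl => e e0; have [M _ MP] := cA (e / (1 - s)) (divr_gt0 e0 s10).
have h1 := MP (maxn N M) (leq_maxr _ _); rewrite /= ler_pdivlMr// in h1.
have h2 := tame_increment x s01 t (leq_maxl N M).
have h3 : c * (s ^+ N - s ^+ maxn N M) * hnorm x <= c * s ^+ N * hnorm x.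
  by rewrite ler_wpM2r ?hnorm_ge0// ler_wpM2l// lerBlDr lerDl exprn_ge0.
have := hnorm_triangle (A x - peval Y (maxn N M) psi x)
  (peval Y (maxn N M) psi x - peval Y N psi x).
rewrite subrKA [hnorm (A x - peval Y (maxn N M) psi x)]hnorm_subC => h4.
apply: (@le_trans _ _ ((hnorm (peval Y (maxn N M) psi x - A x) +
  hnorm (peval Y (maxn N M) psi x - peval Y N psi x)) * (1 - s))).
  by rewrite ler_wpM2r// ltW.
by rewrite mulrDl; apply: lerD => //; exact: le_trans h3.
Qed.

Lemma tame_geom_sum c s psi Y : bounded_tuple Y -> 0 <= c -> 0 <= s < 1 ->
  tame c s psi Y -> exists A, geom_sum psi Y A.
Proof.
move=> Yb c0 s01 t; have /andP[s0 s1] := s01.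
have s10 : 0 < 1 - s by rewrite subr_gt0.
have inc N M x : (N <= M)%N ->
    hnorm (peval Y M psi x - peval Y N psi x) <= c / (1 - s) * s ^+ N * hnorm x.
  move=> NM; have := tame_increment x s01 t NM.
  rewrite -ler_pdivlMr// => h; apply: (le_trans h).
  have -> : c * (s ^+ N - s ^+ M) * hnorm x / (1 - s) =
    c / (1 - s) * (s ^+ N - s ^+ M) * hnorm x by ring.
  rewrite ler_wpM2r ?hnorm_ge0// ler_wpM2l ?divr_ge0 ?(ltW s10)//.
  by rewrite lerBlDr lerDl exprn_ge0.
have ex x : exists l : H, peval Y k psi x @[k --> \oo] --> l.
  apply: hcauchy => e e0.
  pose d := e / ((c / (1 - s) * hnorm x) + 1) / 2.
  have q0 : 0 <= c / (1 - s) * hnorm x.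
    by rewrite mulr_ge0 ?hnorm_ge0// divr_ge0// ltW.
  have q1 : 0 < c / (1 - s) * hnorm x + 1 by rewrite ltr_wpDl.
  have d0 : 0 < d by rewrite !divr_gt0.
  have [N NP] := geometric_small s01 d0; exists N => i j Ni Nj.
  have hN k : (N <= k)%N -> hnorm (peval Y k psi x - peval Y N psi x) <= e / 2.
    move=> Nk; apply: (le_trans (inc _ _ x Nk)); rewrite mulrAC.
    apply: (@le_trans _ _ (c / (1 - s) * hnorm x * d)); first by rewrite ler_wpM2l// NP.
    rewrite /d mulrA ler_wpM2r ?invr_ge0 ?ler0n// mulrA ler_pdivrMr// mulrC.
    by rewrite ler_wpM2l ?lerDl// ltW.
  rewrite -[_ - _](subrKA (peval Y N psi x)) (le_trans (hnorm_triangle _ _))//.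
  by have := hN i Ni; have := hN j Nj; rewrite [hnorm (_ - peval Y j psi x)]hnorm_subC; lra.
have [A AP] := choice ex; exists A.
have AN N x : hnorm (A x - peval Y N psi x) <= c / (1 - s) * s ^+ N * hnorm x.
  apply/ler_addgt0Pl => e e0; have /hcvgP /(_ e e0)[M _ MP] := AP x.
  have := MP (maxn N M) (leq_maxr _ _) => /= h1.
  have := inc N (maxn N M) x (leq_maxl _ _) => h2.
  rewrite -(subrKA (peval Y (maxn N M) psi x)) (le_trans (hnorm_triangle _ _))//.
  by rewrite lerD// hnorm_subC.
have C0 : 0 <= c / (1 - s) by rewrite divr_ge0// ltW.
split; last by exists (c / (1 - s)), s.
apply/bounded_opP; split.
  move=> k x y; apply: (@hcvg_unique _ _ _ \oo _ (fun N => peval Y N psi (k *: x + y))) => //.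
  have -> : (fun N => peval Y N psi (k *: x + y)) =
      (fun N => k *: peval Y N psi x + peval Y N psi y).
    by apply/funext => N; rewrite linear_wsum_act//; exact: tuple_linear.
  by apply: cvgD => //; apply: cvgZr.
exists (c / (1 - s)) => // x.
by have := AN 0%N x; rewrite /peval wsum0 subr0 expr0 mulr1.
Qed.

Lemma geom_sum_tame psi Y A : geom_sum psi Y A ->
  exists c s, [/\ 0 <= c, 0 <= s < 1 & tame c s psi Y].
Proof.
move=> [_ [c [s [c0 s01 As]]]]; have /andP[s0 s1] := s01; exists (c + c), s.
split=> //; first exact: addr_ge0.
move=> k x; have -> : degree_term psi Y k x =
    (A x - peval Y k psi x) - (A x - peval Y k.+1 psi x).
  by rewrite peval_recr; rewrite opprB addrC addrA subrK addrC addKr.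
rewrite (le_trans (hnorm_triangle _ _))// hnorm_opp !mulrDl lerD//.
rewrite (le_trans (As _ _))// ler_wpM2r ?hnorm_ge0// ler_wpM2l// exprS.
by rewrite ler_piMl ?exprn_ge0// ltW.
Qed.

Lemma geom_sum_cvg psi Y A x : geom_sum psi Y A ->
  peval Y N psi x @[N --> \oo] --> A x.
Proof.
move=> [_ [c [s [c0 s01 As]]]]; apply/hcvgP => e e0.
have d0 : 0 < e / (c * hnorm x + 1).
  by rewrite divr_gt0// ltr_wpDl// mulr_ge0 ?hnorm_ge0.
have [N NP] := geometric_small s01 d0; exists N => // k Nk /=.
rewrite hnorm_subC (le_trans (As _ _))// mulrAC.
have c1 : 0 < c * hnorm x + 1 by rewrite ltr_wpDl// mulr_ge0 ?hnorm_ge0.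
have := NP k Nk; rewrite ler_pdivlMr// => h; apply: le_trans h.
rewrite mulrC ler_wpM2l ?lerDl//; apply: exprn_ge0; by case/andP: s01.
Qed.

Lemma geom_sum_sot psi Y A : geom_sum psi Y A -> sot_sum psi Y A.
Proof.
move=> gA; split=> [|x]; first by case: gA.
under eq_fun do rewrite partial_evalE; exact: geom_sum_cvg.
Qed.

Lemma wact_scale (r : R) Y a x : bounded_tuple Y ->
  wact (scale_tuple r Y) a x = (r%:C)%C ^+ size a *: wact Y a x.
Proof.
move=> Yb; elim: a => [|i a IH] /=; first by rewrite expr0 scale1r.
rewrite IH /scale_tuple scalrfctE (linfZ (tuple_linear Yb i)) scalerA.
by rewrite exprS.
Qed.

Lemma peval_scale r Y N psi x : bounded_tuple Y ->
  peval (scale_tuple r Y) N psi x = peval Y N (dilate r psi) x.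
Proof.
by move=> Yb; apply: eq_wsum => a; rewrite wact_scale// scalerA mulrC.
Qed.

Lemma degree_term_dilate r psi Y k x :
  degree_term (dilate r psi) Y k x = (r%:C)%C ^+ k *: degree_term psi Y k x.
Proof.
rewrite /degree_term /degree_sum scaler_sumr; apply: eq_bigr => a _.
by rewrite /dilate size_tuple scalerA.
Qed.

Lemma bernoulli r k : 0 <= r <= 1 -> 1 - r ^+ k <= k%:R * (1 - r).
Proof.
move=> /andP[r0 r1]; elim: k => [|k IH]; first by rewrite expr0 subrr mul0r.
have : r ^+ k <= 1 by rewrite exprn_ile1.
rewrite exprSr -natr1 mulrDl mul1r; nra.
Qed.

(** If the weights l_k grow at most linearly then the weighted sum stays
    bounded, since sum_k k s^k <= (1 - s)^-2. *)
Lemma tame_weighted c s psi Y (l : nat -> R[i]) (h : R) N x : 0 <= c -> 0 <= s < 1 ->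
  tame c s psi Y -> 0 <= h -> (forall k, cabs (l k) <= k%:R * h) ->
  hnorm (\sum_(k < N) l k *: degree_term psi Y k x) * (1 - s) ^+ 2 <= c * h * hnorm x.
Proof.
move=> c0 /andP[s0 s1] t h0 lh.
have s10 : 0 < 1 - s by rewrite subr_gt0.
have hx := hnorm_ge0 x.
suff : hnorm (\sum_(k < N) l k *: degree_term psi Y k x) * (1 - s) ^+ 2 <=
    c * h * hnorm x * (1 - s ^+ N - N%:R * s ^+ N * (1 - s)).
  move=> E; apply: (le_trans E); rewrite ler_piMr//.
    by rewrite !mulr_ge0.
  have : 0 <= s ^+ N by exact: exprn_ge0.
  have : 0 <= N%:R * s ^+ N * (1 - s) by rewrite !mulr_ge0 ?exprn_ge0// ltW.
  lra.
elim: N => [|N IH].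
  by rewrite big_ord0 hnorm0 expr0 subrr !mul0r subrr mulr0.
rewrite big_ord_recr /=; set E := \sum_(k < N) _ in IH *.
have sN : 0 <= s ^+ N by exact: exprn_ge0.
have key : hnorm (l N *: degree_term psi Y N x) <= (N%:R * h) * (c * s ^+ N * hnorm x).
  by rewrite hnorm_scale ler_pM ?hnorm_ge0 ?cabs_ge0.
apply: (@le_trans _ _ ((hnorm E + (N%:R * h) * (c * s ^+ N * hnorm x)) * (1 - s) ^+ 2)).
  rewrite ler_wpM2r ?sqr_ge0// (le_trans (hnorm_triangle _ _))// lerD//.
rewrite mulrDl; apply: (le_trans (lerD IH (lexx _))).
rewrite [s ^+ N.+1]exprS -[N.+1%:R]natr1 -subr_ge0.
have -> : c * h * hnorm x * (1 - s * s ^+ N - (N%:R + 1) * (s * s ^+ N) * (1 - s)) -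
  (c * h * hnorm x * (1 - s ^+ N - N%:R * s ^+ N * (1 - s)) +
   N%:R * h * (c * s ^+ N * hnorm x) * (1 - s) ^+ 2) =
  c * h * hnorm x * (s ^+ N) * (1 - s) ^+ 2 by ring.
by rewrite mulr_ge0 ?sqr_ge0// mulr_ge0// mulr_ge0// mulr_ge0.
Qed.

(** The weight 1 - r^k is at most k (1 - r). *)
Lemma tame_dilate c s psi Y r N x : 0 <= c -> 0 <= s < 1 -> tame c s psi Y ->
  0 <= r <= 1 ->
  hnorm (peval Y N psi x - peval Y N (dilate r psi) x) * (1 - s) ^+ 2 <=
  c * (1 - r) * hnorm x.
Proof.
move=> c0 s01 t r01; have /andP[r0 r1] := r01.
have -> : peval Y N psi x - peval Y N (dilate r psi) x =
    \sum_(k < N) (((1 - r ^+ k)%:C)%C) *: degree_term psi Y k x.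
  rewrite /peval !wsumE -sumrB; apply: eq_bigr => k _.
  rewrite -/(degree_term psi Y k x) -/(degree_term (dilate r psi) Y k x).
  by rewrite degree_term_dilate rmorphB rmorphXn scalerBl scale1r.
apply: (@tame_weighted c s psi Y (fun k => ((1 - r ^+ k)%:C)%C) (1 - r) N x) => // [|k].
  by rewrite subr_ge0.
by rewrite cabs_real ger0_norm ?bernoulli// subr_ge0 exprn_ile1.
Qed.

Lemma opnorm_cvg0 (B : nat -> H -> H) (x : H) : (forall N, bounded_op (B N)) ->
  opnorm (B N) @[N --> \oo] --> 0%E -> B N x @[N --> \oo] --> (0 : H).
Proof.
move=> Bb B0; apply/hcvgP => e e0.
have d0 : 0 < e / (hnorm x + 1) by rewrite divr_gt0// ltr_wpDl// hnorm_ge0.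
move: B0 => /fine_cvgP[fin /cvgrPdist_le /(_ _ d0) small].
have : \forall N \near \oo, (opnorm (B N) <= (e / (hnorm x + 1))%:E)%E.
  apply: filterS2 fin small => N Nf; rewrite /= sub0r normrN => Ns.
  by rewrite -(fineK Nf) lee_fin (le_trans (ler_norm _)).
apply: filterS => N /opnorm_leP h.
have [Bl _] := Bb N; have {}h := h Bl (ltW d0).
rewrite subr0 (le_trans (h x))// mulrAC ler_pdivrMr ?ltr_wpDl ?hnorm_ge0//.
by rewrite ler_wpM2l ?lerDl// ltW.
Qed.

Lemma norm_sum_cvg psi Y A x : bounded_tuple Y -> norm_sum psi Y A ->
  peval Y N psi x @[N --> \oo] --> A x.
Proof.
move=> Yb [Ab /opnorm_cvg0].
have Bb N : bounded_op (partial_eval psi Y N - A)%R.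
  by rewrite -scaleN1r; rewrite addrC; apply: bounded_lin => //; exact: bounded_partial.
move=> /(_ x Bb)/hcvgP h; apply/hcvgP => e e0; apply: filterS (h e e0) => N.
by rewrite subr0 addrfctE opprfctE partial_evalE.
Qed.

Lemma geom_sum_dilate_le c s psi Y A r x (z : H) : bounded_tuple Y -> 0 <= c ->
  0 <= s < 1 -> tame c s psi Y -> 0 <= r <= 1 -> geom_sum psi Y A ->
  peval (scale_tuple r Y) N psi x @[N --> \oo] --> z ->
  hnorm (A x - z) <= c * (1 - r) * hnorm x / (1 - s) ^+ 2.
Proof.
move=> Yb c0 s01 t r01 gA /hcvgP h1.
have s10 : 0 < (1 - s) ^+ 2 by case/andP: s01 => _ s1; rewrite exprn_gt0// subr_gt0.
have /hcvgP h2 := geom_sum_cvg (x := x) gA.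
apply/ler_addgt0Pl => e e0; have e2 : 0 < e / 2 by rewrite divr_gt0.
have [N [/= N1 N2]] := filter_ex (filterI (h1 _ e2) (h2 _ e2)).
rewrite peval_scale// in N1.
have := tame_dilate N x c0 s01 t r01; rewrite -ler_pdivlMr// => h3.
have -> : A x - z = (A x - peval Y N psi x) +
   ((peval Y N psi x - peval Y N (dilate r psi) x) +
    (peval Y N (dilate r psi) x - z)) by rewrite subrKA subrKA.
have := hnorm_triangle (A x - peval Y N psi x)
  ((peval Y N psi x - peval Y N (dilate r psi) x) + (peval Y N (dilate r psi) x - z)).
have := hnorm_triangle (peval Y N psi x - peval Y N (dilate r psi) x)
    (peval Y N (dilate r psi) x - z).
by rewrite [hnorm (A x - _)]hnorm_subC; lra.
Qed.

(** Dilation by r changes a geometrically convergent sum by O(1 - r), so the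
    radial limit agrees with the sum. *)
Lemma geom_sum_unique psi Y A B : bounded_tuple Y -> geom_sum psi Y A ->
  sot_sum psi Y B \/ rad_sum psi Y B -> B = A.
Proof.
move=> Yb gA [[Bb sB]|[Bb [delta [/andP[d0 d1] [Phi [nP Pc]]]]]]; apply/funext => x.
  have [_ sA] := geom_sum_sot gA.
  exact: hcvg_unique (sB x) (sA x).
have [c [s [c0 s01 t]]] := geom_sum_tame gA.
have s10 : 0 < (1 - s) ^+ 2 by case/andP: s01 => _ s1; rewrite exprn_gt0// subr_gt0.
have est r : delta < r < 1 ->
    hnorm (A x - Phi r x) <= c * (1 - r) * hnorm x / (1 - s) ^+ 2.
  move=> /[dup] dr1 /andP[dr r1].
  have r01 : 0 <= r <= 1 by rewrite ltW ?ltW// (lt_trans d0).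
  have Ysb : bounded_tuple (scale_tuple r Y) by move=> i; exact: boundedZ.
  exact: geom_sum_dilate_le (norm_sum_cvg (x := x) Ysb (nP r dr1)).
apply: (@hcvg_unique _ _ _ (1^'-) _ (fun r => Phi r x)); first exact: Pc.
apply/hcvgP => e e0.
pose K := c * hnorm x / (1 - s) ^+ 2 + 1.
have K0 : 0 < K by rewrite ltr_wpDl// !mulr_ge0 ?hnorm_ge0// invr_ge0 ltW.
near=> r.
have r1 : r < 1 by near: r; exact: nbhs_left_lt.
have dr : delta < r by near: r; exact: nbhs_left_gt.
have re : 1 - e / K < r.
  by near: r; apply: nbhs_left_gt; rewrite ltrBlDr ltrDl divr_gt0.
rewrite hnorm_subC (le_trans (est r _)) ?dr//.
have -> : c * (1 - r) * hnorm x / (1 - s) ^+ 2 = (1 - r) * (K - 1) by rewrite /K; ring.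
have : 1 - r < e / K by lra.
rewrite ltr_pdivlMr// => h; apply: le_trans (ltW h).
by apply: ler_wpM2l; [rewrite subr_ge0 ltW|rewrite gerBl].
Unshelve. all: by end_near. Qed.

Lemma series_eval_geom psi Y A : bounded_tuple Y -> geom_sum psi Y A ->
  series_eval psi Y = A.
Proof.
move=> Yb gA; rewrite /series_eval; case: xgetP => [B _ /= sB|/(_ A) []].
  exact: geom_sum_unique gA sB.
by left; exact: geom_sum_sot.
Qed.

Lemma geom_sum_stable psi Y N : bounded_tuple Y ->
  (forall N' x, (N <= N')%N -> peval Y N' psi x = peval Y N psi x) ->
  geom_sum psi Y (peval Y N psi).
Proof.
move=> Yb st; split; first exact: bounded_peval.
have ex k : exists c, 0 <= c /\ bound_by c (fun x => peval Y N psi x - peval Y k psi x).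
  have /bounded_opP[_ [c c0 cP]] : bounded_op (peval Y N psi - peval Y k psi)%R.
    rewrite -scaleN1r; rewrite addrC; apply: bounded_lin; exact: bounded_peval.
  by exists c; split=> // x; have := cP x; rewrite addrfctE opprfctE.
have [c cP] := choice ex.
(* Only the first N partial sums differ from the last one: any ratio will do. *)
exists (\sum_(k < N) c k * 2 ^+ k), 2^-1; split.
- by apply: sumr_ge0 => k _; case: (cP k) => c0 _; rewrite mulr_ge0// exprn_ge0.
- by apply/andP; split; lra.
move=> k x; have [Nk|kN] := leqP N k.
  rewrite st// subrr hnorm0 !mulr_ge0 ?hnorm_ge0// ?exprn_ge0 ?invr_ge0//.
  by apply: sumr_ge0 => j _; case: (cP j) => c0 _; rewrite mulr_ge0// exprn_ge0.
have [_ /(_ x) h] := cP k; apply: (le_trans h); rewrite ler_wpM2r ?hnorm_ge0//.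
rewrite exprVn ler_pdivlMr ?exprn_gt0// (bigD1 (Ordinal kN))//= lerDl.
by apply: sumr_ge0 => j _; case: (cP j) => c0 _; rewrite mulr_ge0// exprn_ge0.
Qed.

Lemma geom_sum_poly psi Y N : bounded_tuple Y -> degree_lt N psi ->
  geom_sum psi Y (peval Y N psi).
Proof.
by move=> Yb pN; apply: geom_sum_stable => // N' x NN'; exact: peval_stable.
Qed.

Lemma geom_sum_lin k psi phi Y A B : geom_sum psi Y A -> geom_sum phi Y B ->
  geom_sum (k *: psi + phi) Y (k *: A + B)%R.
Proof.
move=> [Ab [c [s [c0 /andP[s0 s1] cP]]]] [Bb [d [t [d0 /andP[t0 t1] dP]]]].
split; first exact: bounded_lin.
exists (cabs k * c + d), (Num.max s t).
have u0 : 0 <= Num.max s t by rewrite le_max s0.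
split; first by rewrite addr_ge0// mulr_ge0// cabs_ge0.
  by rewrite u0 gt_max s1.
move=> N x; rewrite peval_lin addrfctE scalrfctE opprD addrACA -scalerBr.
rewrite (le_trans (hnorm_triangle _ _))// hnorm_scale !mulrDl lerD//.
  rewrite -!mulrA ler_wpM2l ?cabs_ge0// (le_trans (cP _ _))// -mulrA ler_wpM2l//.
  by rewrite ler_wpM2r ?hnorm_ge0// lerXn2r ?nnegrE// le_max lexx.
rewrite (le_trans (dP _ _))// -!mulrA ler_wpM2l//.
by rewrite ler_wpM2r ?hnorm_ge0// lerXn2r ?nnegrE// le_max lexx orbT.
Qed.

Lemma geom_sum_scale r psi Y A : bounded_tuple Y ->
  geom_sum psi (scale_tuple r Y) A -> geom_sum (dilate r psi) Y A.
Proof.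
move=> Yb [Ab [c [s [c0 s01 cP]]]]; split=> //; exists c, s; split=> // N x.
by rewrite -peval_scale.
Qed.

End AbsoluteSums.

(** * Row norms and growth of coefficients *)

Section RealSums.
Variable R : realType.

Lemma sum_cauchy_schwarz (I : finType) (a b : I -> R) :
  (\sum_i a i * b i) ^+ 2 <= (\sum_i a i ^+ 2) * (\sum_i b i ^+ 2).
Proof.
set A := \sum_i a i ^+ 2; set B := \sum_i b i ^+ 2; set C := \sum_i a i * b i.
have B0 : 0 <= B by apply: sumr_ge0 => i _; exact: sqr_ge0.
have [B00|B1] := eqVneq B 0.
  have b0 i : b i = 0.
    apply/eqP; rewrite -sqrf_eq0; have /eqP := B00.
    by rewrite psumr_eq0 => [/allP /(_ i (mem_index_enum _))|j _]; rewrite ?sqr_ge0.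
  by rewrite /C big1 ?expr0n ?B00 ?mulr0// => i _; rewrite b0 mulr0.
have Bp : 0 < B by rewrite lt_neqAle eq_sym B1.
have : 0 <= \sum_i (a i * B - b i * C) ^+ 2 by apply: sumr_ge0 => i _; exact: sqr_ge0.
have -> : \sum_i (a i * B - b i * C) ^+ 2 =
    A * B ^+ 2 - 2 * B * C * C + B * C ^+ 2.
  transitivity (\sum_i (a i ^+ 2 * B ^+ 2 - 2 * B * C * (a i * b i) + b i ^+ 2 * C ^+ 2)).
    by apply: eq_bigr => i _; ring.
  by rewrite !big_split /= sumrN -mulr_sumr -!mulr_suml.
have -> : A * B ^+ 2 - 2 * B * C * C + B * C ^+ 2 = B * (A * B - C ^+ 2) by ring.
by rewrite pmulr_rge0// subr_ge0.
Qed.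

End RealSums.

Section RowBounds.
Variables (R : realType) (n : nat) (H : hilbertType R).
Local Notation series := (ncseries R n).
Implicit Types (psi : series) (Y : 'I_n -> H -> H) (rho tau : R).

Definition row_bound rho Y : Prop := forall x : 'I_n -> H,
  hnorm (\sum_i Y i (x i)) ^+ 2 <= rho ^+ 2 * \sum_i hnorm (x i) ^+ 2.

(** The square sums of degree k grow at most like tau^(2k), which is convergence on
    the ball of radius 1 / tau. *)
Definition growth tau psi : Prop := exists2 C : R, 0 <= C &
  forall k, degree_sum k (fun a => sqn (psi a)) <= C * (tau ^+ 2) ^+ k.

(** The row of all words of length k is a k-fold composition of rows. *)
Lemma row_bound_degree rho Y k (x : word n -> H) : bounded_tuple Y ->
  row_bound rho Y ->
  hnorm (degree_sum k (fun a => wact Y a (x a))) ^+ 2 <=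
  (rho ^+ 2) ^+ k * degree_sum k (fun a => hnorm (x a) ^+ 2).
Proof.
move=> Yb Yr; elim: k x => [|k IH] x.
  by rewrite !degree_sum0 expr0 mul1r.
rewrite !degree_sumS.
have -> : \sum_i degree_sum k (fun a => wact Y (i :: a) (x (i :: a))) =
    \sum_i Y i (degree_sum k (fun a => wact Y a (x (i :: a)))).
  by apply: eq_bigr => i _; rewrite /degree_sum (linf_sum (tuple_linear Yb i)).
rewrite (le_trans (Yr _))// [(rho ^+ 2) ^+ _]exprS -mulrA ler_wpM2l ?sqr_ge0// mulr_sumr.
by apply: ler_sum => i _; exact: (IH (fun a => x (i :: a))).
Qed.

(** The terms of degree k act through the row of the words of length k, whose
    norm is at most rho^k.  The constant depends on psi only, which makes the
    convergence uniform along families of tuples. *)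
Lemma growth_tame_uniform tau psi : 0 <= tau -> growth tau psi ->
  exists2 c : R, 0 <= c & forall Y rho, bounded_tuple Y -> 0 <= rho ->
    row_bound rho Y -> tame c (rho * tau) psi Y.
Proof.
move=> t0 [C C0 CP]; exists (Num.sqrt C); first exact: sqrtr_ge0.
move=> Y rho Yb r0 Yr.
move=> k x; rewrite -(@ler_pXn2r _ 2) ?nnegrE ?hnorm_ge0//; last first.
  by rewrite !mulr_ge0 ?sqrtr_ge0 ?hnorm_ge0 ?exprn_ge0// mulr_ge0.
have -> : degree_term psi Y k x = degree_sum k (fun a => wact Y a (psi a *: x)).
  apply: eq_bigr => a _.
  by rewrite (linfZ (linear_wact (tuple_linear Yb) _)).
rewrite (le_trans (row_bound_degree _ _ Yb Yr))//.
have -> : degree_sum k (fun a => hnorm (psi a *: x) ^+ 2) =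
    degree_sum k (fun a => sqn (psi a)) * hnorm x ^+ 2.
  rewrite /degree_sum mulr_suml; apply: eq_bigr => a _.
  by rewrite hnorm_scale exprMn sqnE.
rewrite [(_ * hnorm x) ^+ 2]exprMn [(Num.sqrt C * _) ^+ 2]exprMn sqr_sqrtr//.
rewrite [(rho * tau) ^+ k]exprMn [(_ ^+ k * _) ^+ 2]exprMn mulrA ler_wpM2r ?sqr_ge0//.
rewrite [rho ^+ k ^+ 2]exprAC [tau ^+ k ^+ 2]exprAC [leRHS]mulrCA.
by rewrite ler_wpM2l ?exprn_ge0 ?sqr_ge0.
Qed.

Lemma growth_tame rho tau psi Y : bounded_tuple Y -> 0 <= rho -> 0 <= tau ->
  row_bound rho Y -> growth tau psi ->
  exists2 c, 0 <= c & tame c (rho * tau) psi Y.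
Proof.
move=> Yb r0 t0 Yr /(growth_tame_uniform t0)[c c0 h]; exists c => //; exact: h.
Qed.

Lemma growth_geom_sum rho tau psi Y : bounded_tuple Y -> 0 <= rho -> 0 <= tau ->
  rho * tau < 1 -> row_bound rho Y -> growth tau psi ->
  exists A, geom_sum psi Y A.
Proof.
move=> Yb r0 t0 rt Yr psig; have [c c0 t] := growth_tame Yb r0 t0 Yr psig.
by apply: tame_geom_sum t => //; rewrite rt mulr_ge0.
Qed.

(** A row and its adjoint column have the same norm: the row is tested on the
    adjoint column itself. *)
Lemma row_bound_adjoint rho Y : bounded_tuple Y -> 0 <= rho -> row_bound rho Y ->
  forall x, \sum_i hnorm (adjoint (Y i) x) ^+ 2 <= rho ^+ 2 * hnorm x ^+ 2.
Proof.
move=> Yb r0 Yr x; set S := \sum_i _.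
have S0 : 0 <= S by apply: sumr_ge0 => i _; exact: sqr_ge0.
have h1 := Yr (fun i => adjoint (Y i) x); rewrite -/S in h1.
set z := \sum_i _ in h1.
have h2 : S <= hnorm z * hnorm x.
  apply: le_trans (Re_hdot_hnorm z x).
  rewrite hdot_suml raddf_sum /= /S le_eqVlt; apply/orP; left; apply/eqP.
  by apply: eq_bigr => i _; rewrite hdot_adjoint// hnorm_sqr.
have [S00|S1] := eqVneq S 0; first by rewrite S00 mulr_ge0 ?sqr_ge0.
have Sp : 0 < S by rewrite lt_neqAle eq_sym S1.
rewrite -(ler_pM2l Sp).
apply: (@le_trans _ _ ((hnorm z * hnorm x) ^+ 2)).
  by rewrite -expr2 lerXn2r ?nnegrE// mulr_ge0 ?hnorm_ge0.
by rewrite exprMn [leRHS]mulrA ler_wpM2r ?sqr_ge0// [leRHS]mulrC.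
Qed.

Lemma adjoint_row_bound rho Y : bounded_tuple Y -> 0 <= rho ->
  (forall x, \sum_i hnorm (adjoint (Y i) x) ^+ 2 <= rho ^+ 2 * hnorm x ^+ 2) ->
  row_bound rho Y.
Proof.
move=> Yb r0 Yr x; set z := \sum_i Y i (x i).
set S := \sum_i hnorm (x i) ^+ 2.
have S0 : 0 <= S by apply: sumr_ge0 => i _; exact: sqr_ge0.
have h : hnorm z ^+ 2 <= \sum_i hnorm (x i) * hnorm (adjoint (Y i) z).
  rewrite hnorm_sqr {1}/z hdot_suml raddf_sum /=; apply: ler_sum => i _.
  by rewrite hdot_adjoint// Re_hdot_hnorm.
have [z0|z1] := eqVneq (hnorm z ^+ 2) 0; first by rewrite z0 mulr_ge0 ?sqr_ge0.
have zp : 0 < hnorm z ^+ 2 by rewrite lt_neqAle eq_sym z1 sqr_ge0.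
rewrite -(ler_pM2r zp) -expr2.
apply: (@le_trans _ _ ((\sum_i hnorm (x i) * hnorm (adjoint (Y i) z)) ^+ 2)).
  rewrite lerXn2r ?nnegrE ?(ltW zp)//.
  by apply: sumr_ge0 => i _; rewrite mulr_ge0 ?hnorm_ge0.
rewrite (le_trans (sum_cauchy_schwarz _ _))// -/S mulrAC [leRHS]mulrC.
by rewrite ler_wpM2l// Yr.
Qed.

Lemma row_op_bounded Y : bounded_tuple Y ->
  bounded_op (\sum_i (Y i \o adjoint (Y i)))%R.
Proof.
move=> Yb; apply: bounded_sum => i; apply: bounded_comp => //.
exact: bounded_adjoint.
Qed.

Lemma op_ball_row_bound r Y : op_ball r Y -> exists2 rho,
  0 <= rho < r & row_bound rho Y.
Proof.
move=> [Yb]; set Q := (\sum_i _)%R.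
have Qb : bounded_op Q := row_op_bounded Yb.
have Q0 : (0%:E <= opnorm Q)%E.
  apply: ereal_sup_ubound; exists 0; rewrite /= ?hnorm0 ?ler01//.
  by rewrite (linf0 Qb.1) hnorm0.
have := Qb.2; case: (opnorm Q) Q0 (@opnorm_leP _ _ _ Q ^~ Qb.1) => [N| |] //.
rewrite lee_fin => N0 QN _; rewrite poweR_EFin powR12_sqrt// lte_fin => Nr.
exists (Num.sqrt N); first by rewrite sqrtr_ge0.
apply: adjoint_row_bound => //; rewrite ?sqrtr_ge0// => x; rewrite sqr_sqrtr//.
have QNx : bound_by N Q by apply/(QN _ N0); rewrite lexx.
have -> : \sum_i hnorm (adjoint (Y i) x) ^+ 2 = complex.Re (hdot (Q x) x).
  rewrite /Q fct_sum hdot_suml raddf_sum; apply: eq_bigr => i _ /=.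
  by rewrite hdot_adjoint// hnorm_sqr.
rewrite (le_trans (Re_hdot_hnorm _ _))// expr2 mulrA ler_wpM2r ?hnorm_ge0//.
Qed.

Lemma row_bound_op_ball r rho Y : bounded_tuple Y -> 0 <= rho < r ->
  row_bound rho Y -> op_ball r Y.
Proof.
move=> Yb /andP[r0 rr] Yr; split=> //; set Q := (\sum_i _)%R.
have Qb : bounded_op Q := row_op_bounded Yb.
have : (opnorm Q <= (rho ^+ 2)%:E)%E.
  apply/opnorm_leP; [exact: Qb.1|exact: sqr_ge0|] => x.
  rewrite -(@ler_pXn2r _ 2) ?nnegrE ?hnorm_ge0 ?mulr_ge0 ?sqr_ge0 ?hnorm_ge0//.
  rewrite /Q fct_sum; apply: (le_trans (Yr (fun i => adjoint (Y i) x))).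
  have -> : (rho ^+ 2 * hnorm x) ^+ 2 = rho ^+ 2 * (rho ^+ 2 * hnorm x ^+ 2) by ring.
  rewrite ler_wpM2l ?sqr_ge0//.
  exact: row_bound_adjoint.
have Q0 : (0%:E <= opnorm Q)%E.
  apply: ereal_sup_ubound; exists 0; rewrite /= ?hnorm0 ?ler01//.
  by rewrite (linf0 Qb.1) hnorm0.
case: (opnorm Q) Q0 => [N| |] //; rewrite !lee_fin => N0 Nr.
rewrite poweR_EFin powR12_sqrt// lte_fin; apply: le_lt_trans rr.
by rewrite -[leRHS]ger0_norm// -sqrtr_sqr ler_wsqrtr.
Qed.

Lemma row_bound_scale rho r Y : bounded_tuple Y -> row_bound rho Y ->
  row_bound (r * rho) (scale_tuple r Y).
Proof.
move=> Yb Yr x.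
have -> : \sum_i scale_tuple r Y i (x i) = ((r%:C)%C) *: \sum_i Y i (x i).
  by rewrite scaler_sumr; apply: eq_bigr.
rewrite hnorm_scale cabs_real exprMn real_normK ?num_real//.
by rewrite [(r * rho) ^+ 2]exprMn -[leRHS]mulrA ler_wpM2l ?sqr_ge0.
Qed.

Lemma row_bound_le rho rho' Y : 0 <= rho <= rho' -> row_bound rho Y ->
  row_bound rho' Y.
Proof.
move=> /andP[r0 rr] Yr x; rewrite (le_trans (Yr x))// ler_wpM2r//.
  by apply: sumr_ge0 => i _; exact: sqr_ge0.
by rewrite lerXn2r ?nnegrE// (le_trans r0).
Qed.

Lemma row_bound_sqrt rho Y (x : 'I_n -> H) : 0 <= rho -> row_bound rho Y ->
  hnorm (\sum_i Y i (x i)) <= rho * Num.sqrt (\sum_i hnorm (x i) ^+ 2).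
Proof.
move=> r0 /(_ x) h; have S0 : 0 <= \sum_i hnorm (x i) ^+ 2.
  by apply: sumr_ge0 => i _; exact: sqr_ge0.
rewrite -(@ler_pXn2r _ 2) ?nnegrE ?hnorm_ge0 ?mulr_ge0 ?sqrtr_ge0//.
by rewrite exprMn sqr_sqrtr.
Qed.

Lemma row_bound_perturb rho sigma Y Z : 0 <= rho -> 0 <= sigma -> row_bound rho Y ->
  row_bound sigma (fun i x => Z i x - Y i x) -> row_bound (rho + sigma) Z.
Proof.
move=> r0 s0 Yr Zr x; have S0 : 0 <= \sum_i hnorm (x i) ^+ 2.
  by apply: sumr_ge0 => i _; exact: sqr_ge0.
have h1 := row_bound_sqrt x r0 Yr; have h2 := row_bound_sqrt x s0 Zr.
rewrite -[X in _ <= _ * X](sqr_sqrtr S0) -exprMn.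
rewrite lerXn2r ?nnegrE ?hnorm_ge0 ?mulr_ge0 ?addr_ge0 ?sqrtr_ge0//.
have -> : \sum_i Z i (x i) = \sum_i Y i (x i) + \sum_i (Z i (x i) - Y i (x i)).
  by rewrite -big_split; apply: eq_bigr => i _; rewrite /= addrC subrK.
by rewrite (le_trans (hnorm_triangle _ _))// mulrDl lerD.
Qed.

Lemma row_bound_component rho Y i : bounded_tuple Y -> 0 <= rho -> row_bound rho Y ->
  bound_by rho (Y i).
Proof.
move=> Yb r0 Yr x; have := row_bound_sqrt (fun j => if j == i then x else 0) r0 Yr.
rewrite (bigD1 i)//= eqxx big1 ?addr0 => [|j ji]; last first.
  by rewrite (negbTE ji) (linf0 (tuple_linear Yb j)).
rewrite (bigD1 i)//= eqxx big1 ?addr0 => [|j ji]; last first.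
  by rewrite (negbTE ji) hnorm0 expr0n.
by rewrite sqrtr_sqr ger0_norm// hnorm_ge0.
Qed.

Lemma bound_row_bound Y (c : R) : 0 <= c ->
  (forall i, bound_by c (Y i)) -> row_bound (n%:R * c) Y.
Proof.
move=> c0 Yc x; set S := \sum_i hnorm (x i) ^+ 2.
have h1 : hnorm (\sum_i Y i (x i)) <= \sum_i c * hnorm (x i).
  by rewrite (le_trans (hnorm_sum _ _))//; apply: ler_sum => i _; exact: Yc.
apply: (@le_trans _ _ ((\sum_i c * hnorm (x i)) ^+ 2)).
  by rewrite lerXn2r ?nnegrE ?hnorm_ge0// sumr_ge0// => i _; rewrite mulr_ge0 ?hnorm_ge0.
rewrite (le_trans (sum_cauchy_schwarz _ _))// -/S.
rewrite ler_wpM2r ?sumr_ge0// => [i _|]; first exact: sqr_ge0.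
rewrite (sumr_const _ (c ^+ 2)) card_ord.
have -> : (n%:R * c) ^+ 2 = (n * n)%:R * c ^+ 2 by rewrite natrM; ring.
rewrite -[_ *+ n]mulr_natl ler_wpM2r ?sqr_ge0// ler_nat.
by case: (n) => // k; rewrite leq_pmulr.
Qed.

Lemma bounded_scale_tuple r Y : bounded_tuple Y -> bounded_tuple (scale_tuple r Y).
Proof. by move=> Yb i; exact: boundedZ. Qed.

Lemma growth_lin tau k psi phi : growth tau psi -> growth tau phi ->
  growth tau (k *: psi + phi).
Proof.
move=> [C C0 CP] [D D0 DP]; exists (2 * sqn k * C + 2 * D).
  by rewrite addr_ge0// !mulr_ge0// sqn_ge0.
move=> j; apply: (@le_trans _ _ (degree_sum j (fun a => 2 * sqn k * sqn (psi a) + 2 * sqn (phi a)))).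
  apply: ler_sum => a _; rewrite addrfctE scalrfctE (le_trans (sqnD _ _))//.
  by rewrite sqnM mulrA.
have -> : degree_sum j (fun a => 2 * sqn k * sqn (psi a) + 2 * sqn (phi a)) =
    2 * sqn k * degree_sum j (fun a => sqn (psi a)) +
    2 * degree_sum j (fun a => sqn (phi a)).
  by rewrite /degree_sum big_split /= !mulr_sumr.
have -> : (2 * sqn k * C + 2 * D) * (tau ^+ 2) ^+ j =
    2 * sqn k * (C * (tau ^+ 2) ^+ j) + 2 * (D * (tau ^+ 2) ^+ j).
  by rewrite mulrDl !mulrA.
by rewrite lerD// ler_wpM2l ?mulr_ge0 ?sqn_ge0.
Qed.

Lemma growth_dilate r tau psi : growth tau psi -> growth (r * tau) (dilate r psi).
Proof.
move=> [C C0 CP]; exists C => // k.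
have -> : degree_sum k (fun a => sqn (dilate r psi a)) =
    (r ^+ 2) ^+ k * degree_sum k (fun a => sqn (psi a)).
  rewrite /degree_sum mulr_sumr; apply: eq_bigr => a _.
  by rewrite /dilate sqnM size_tuple sqnE cabsX cabs_real exprAC real_normK ?num_real.
rewrite [(r * tau) ^+ 2]exprMn [(r ^+ 2 * tau ^+ 2) ^+ k]exprMn [leRHS]mulrCA.
by apply: ler_wpM2l; [rewrite exprn_ge0 ?sqr_ge0|exact: CP].
Qed.

Lemma l2_growth (c : l2 R n) : growth 1 c.
Proof.
exists (l2sqn c) => [|k]; first exact: le_trans (sqn_ge0 _) (sqn_le_l2sqn c [::]).
rewrite !expr1n mulr1; apply: le_trans (wsum_le_l2sqn c k.+1).
rewrite wsumSr lerDr; apply: wsum_ge0 => a; exact: sqn_ge0.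
Qed.

Lemma poly_growth N tau psi : 0 < tau -> degree_lt N psi -> growth tau psi.
Proof.
move=> t0 pN; pose F k := degree_sum k (fun a => sqn (psi a)) / (tau ^+ 2) ^+ k.
have t2 k : 0 < (tau ^+ 2) ^+ k by rewrite !exprn_gt0.
have F0 k : 0 <= F k.
  by rewrite divr_ge0 ?(ltW (t2 k))//; apply: sumr_ge0 => a _; exact: sqn_ge0.
exists (\sum_(k < N) F k); first by apply: sumr_ge0.
move=> k; rewrite -ler_pdivrMr// -/(F k); have [Nk|kN] := leqP N k.
  suff -> : F k = 0 by apply: sumr_ge0.
  by rewrite /F /degree_sum big1 ?mul0r// => a _; rewrite pN ?sqn0// size_tuple.
by rewrite (bigD1 (Ordinal kN))//= lerDl; apply: sumr_ge0.
Qed.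

(** The limsup controls all but finitely many degrees, and a polynomial grows at
    any positive rate. *)
Lemma free_holomorphic_growth (gamma tau : R) psi : 0 < gamma -> gamma^-1 < tau ->
  free_holomorphic gamma psi -> growth tau psi.
Proof.
move=> g0 gt psih; have t0 : 0 < tau by apply: lt_trans gt; rewrite invr_gt0.
have /ereal_inf_lt[_ [V Voo <-] Vt] :
    (ereal_inf [set ereal_sup (root_term psi @` V) | V in \oo] < tau%:E)%E.
  by apply: le_lt_trans psih _; rewrite lte_fin.
case: Voo => N _ NV.
pose low : series := fun a => if (size a < N.+1)%N then psi a else 0.
pose high : series := fun a => if (size a < N.+1)%N then 0 else psi a.
have -> : psi = 1 *: low + high.
  apply/funext => a; rewrite scale1r addrfctE /low /high.
  by case: ifP => _; rewrite ?addr0 ?add0r.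
apply: growth_lin.
  by apply: (@poly_growth N.+1) => // a aN; rewrite /low ltnNge aN.
exists 1 => // k; rewrite mul1r /high.
have [kN|Nk] := ltnP k N.+1.
  rewrite [leLHS]big1 => [|a _]; first by rewrite exprn_ge0 ?sqr_ge0.
  by rewrite size_tuple kN sqn0.
have -> : degree_sum k (fun a => sqn (if (size a < N.+1)%N then 0 else psi a)) =
    degree_sum k (fun a => sqn (psi a)).
  by apply: eq_degree_sum => a ->; rewrite ltnNge Nk.
have : (root_term psi k <= tau%:E)%E.
  apply: le_trans (ltW Vt); apply: ereal_sup_ubound; exists k => //.
  by apply: NV => /=; apply: leq_trans Nk; exact: leqnSn.
rewrite /root_term -/(degree_sum k (fun a => sqn (psi a))) lee_fin.
set D := degree_sum _ _ => Dt.
have D0 : 0 <= D by apply: sumr_ge0 => a _; exact: sqn_ge0.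
have k0 : (0 < 2 * k)%N by rewrite muln_gt0 /=; apply: leq_trans Nk.
have -> : D = (D `^ (2 * k)%:R^-1) `^ (2 * k)%:R.
  by rewrite -powRrM mulVf ?powRr1// pnatr_eq0 -lt0n.
rewrite powR_mulrn ?powR_ge0// -exprM.
by rewrite lerXn2r ?nnegrE ?powR_ge0 ?(ltW t0).
Qed.

(** The square sums of high degree are at most 1, hence so are their roots. *)
Lemma l2_free_holomorphic (c : l2 R n) : free_holomorphic 1 c.
Proof.
rewrite /free_holomorphic invr1.
have cc : cvgn (fun N => wsum N (fun a => sqn (c a))) by apply/asboolP/l2valP.
have : \forall k \near \oo, degree_sum k (fun a => sqn (c a)) <= 1.
  have := cc => /cvg_cauchy /cauchy_ballP /(_ _ (ltr01)).
  case=> -[A B] /= [[N1 _ AN] [N2 _ BN]] AB.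
  exists (maxn N1 N2) => // k /= kN.
  have := AB (wsum k.+1 (fun a => sqn (c a)), wsum k (fun a => sqn (c a))).
  move=> /(_ _)/wrap[]; first by split; [apply: AN|apply: BN]; move: kN => /=; lia.
  by rewrite /ball /= wsumSr addrAC subrr add0r => /ltW; apply: le_trans (ler_norm _).
move=> [N _ NP]; apply: (@le_trans _ _ (ereal_sup (root_term c @` [set k | (N <= k)%N]))).
  by apply: ereal_inf_lbound; exists [set k | (N <= k)%N] => //; exists N.
apply: ge_ereal_sup => _ [k Nk <-]; rewrite lee_fin.
apply: (@le_trans _ _ (1 `^ (2 * k)%:R^-1)); last by rewrite powR1.
apply: ge0_ler_powR; rewrite ?nnegrE ?invr_ge0// ?ler0n//.
  by apply: sumr_ge0 => a _; exact: sqn_ge0.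
exact: NP.
Qed.

Lemma mx_opnorm_leP (H2 : hilbertType R) p m (A : 'I_p -> 'I_m -> H -> H2) (c : R) :
  (forall i j, linear (A i j)) -> 0 <= c ->
  (mx_opnorm A <= c%:E)%E <->
  forall x : 'I_m -> H, \sum_i hnorm (\sum_j A i j (x j)) ^+ 2 <=
    c ^+ 2 * \sum_j hnorm (x j) ^+ 2.
Proof.
move=> Al c0; split=> [Ac x|Ac]; last first.
  apply: ge_ereal_sup => _ [x x1 <-]; rewrite lee_fin.
  rewrite -[leRHS]ger0_norm// -sqrtr_sqr ler_wsqrtr// (le_trans (Ac x))//.
  by rewrite ler_piMr ?sqr_ge0.
set S := \sum_j hnorm (x j) ^+ 2; have S0 : 0 <= S by apply: sumr_ge0 => j _; exact: sqr_ge0.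
have [S00|S1] := eqVneq S 0.
  have x0 j : x j = 0.
    apply/hnorm_eq0/eqP; rewrite -sqrf_eq0; have /eqP := S00.
    by rewrite psumr_eq0 => [/allP /(_ j (mem_index_enum _))|k _]; rewrite ?sqr_ge0.
  rewrite S00 mulr0 big1// => i _; rewrite big1 ?hnorm0 ?expr0n// => j _.
  by rewrite x0 (linf0 (Al i j)).
have Sp : 0 < S by rewrite lt_neqAle eq_sym S1.
pose t := (Num.sqrt S)^-1; have t0 : 0 <= t by rewrite invr_ge0 sqrtr_ge0.
have t2 : t ^+ 2 = S^-1 by rewrite exprVn sqr_sqrtr.
have := Ac; have : ((Num.sqrt (\sum_i hnorm (\sum_j A i j (((t%:C)%C) *: x j)) ^+ 2))%:E
    <= mx_opnorm A)%E.
  apply: ereal_sup_ubound; exists (fun j => (t%:C)%C *: x j) => //=.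
  under eq_bigr do rewrite hnorm_scale cabs_real exprMn real_normK ?num_real//.
  by rewrite -mulr_sumr t2 mulVf.
move=> h1 h2; have := le_trans h1 h2; rewrite lee_fin.
have -> : \sum_i hnorm (\sum_j A i j (((t%:C)%C) *: x j)) ^+ 2 =
    S^-1 * \sum_i hnorm (\sum_j A i j (x j)) ^+ 2.
  rewrite mulr_sumr; apply: eq_bigr => i _; rewrite -t2.
  have -> : \sum_j A i j (((t%:C)%C) *: x j) = ((t%:C)%C) *: \sum_j A i j (x j).
    by rewrite scaler_sumr; apply: eq_bigr => j _; rewrite (linfZ (Al i j)).
  by rewrite hnorm_scale cabs_real exprMn real_normK ?num_real.
move=> h; rewrite mulrC -ler_pdivrMl// -[leLHS]sqr_sqrtr.
  by rewrite lerXn2r ?nnegrE ?sqrtr_ge0.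
by rewrite mulr_ge0 ?invr_ge0//; apply: sumr_ge0 => i _; exact: sqr_ge0.
Qed.

Lemma row_contraction Y : bounded_tuple Y ->
  (mx_opnorm (fun _ : 'I_1 => Y) <= 1)%E -> row_bound 1 Y.
Proof.
move=> Yb /mx_opnorm_leP h x; have := h (fun _ => tuple_linear Yb) ler01 x.
by rewrite big_ord1.
Qed.

End RowBounds.

(** * Poisson vectors in the Fock space *)

Section FockBasis.
Variables (R : realType) (n : nat).
Local Notation fock := (l2 R n).

Lemma poly_square_summable N (p : ncseries R n) : degree_lt N p ->
  p \in @square_summable R n.
Proof.
move=> pN; apply/square_summableP; exists (wsum N (fun a => sqn (p a))) => M.
apply: (@le_trans _ _ (wsum (maxn M N) (fun a => sqn (p a)))).
  by apply: wsum_homo; [move=> a; exact: sqn_ge0|exact: leq_maxl].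
by rewrite (wsum_stable (N := N)) ?leq_maxr// => a aN; rewrite pN// sqn0.
Qed.

Definition fbasis (a : word n) : fock := L2 (poly_square_summable (@mono_degree R n a)).

Lemma l2valD (x y : fock) a : l2val (x + y) a = l2val x a + l2val y a.
Proof. by []. Qed.

Lemma l2val_sum (I : Type) (r : seq I) (F : I -> fock) a :
  l2val (\sum_(i <- r) F i) a = \sum_(i <- r) l2val (F i) a.
Proof.
by elim: r => [|i r IH]; rewrite ?big_nil// !big_cons l2valD IH.
Qed.

Lemma l2val_wsum N (F : word n -> fock) a :
  l2val (wsum N F) a = wsum N (fun b => l2val (F b) a).
Proof.
rewrite /wsum l2val_sum; apply: eq_bigr => k _; exact: l2val_sum.
Qed.

Lemma hnorm_l2 (x : fock) : hnorm x ^+ 2 = l2sqn x.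
Proof. by rewrite hnorm_sqr -[hdot x x]/(l2dot x x) l2dotE. Qed.

Lemma l2_trunc (c : fock) N : (c - wsum N (fun a => c a *: fbasis a) : fock) =
  (fun a => if (size a < N)%N then 0 else c a) :> ncseries R n.
Proof.
apply/funext => a; rewrite -[LHS]/(l2val c a - l2val (wsum N _) a) l2val_wsum.
rewrite (_ : (fun b : word n => _) = (fun b => c b * mono R b a)) //.
case: ifPn => aN.
  rewrite (wsum_only (b := a))// ?/mono ?eqxx ?mulr1 ?subrr// => b ba.
  by rewrite /mono eq_sym (negbTE ba) mulr0.
rewrite wsum_eq0 ?subr0// => b bN; rewrite /mono; case: eqVneq => [ab|_]; last by rewrite mulr0.
by rewrite ab bN in aN.
Qed.

Lemma l2_trunc_le (c : fock) N :
  hnorm (c - wsum N (fun a => c a *: fbasis a)) ^+ 2 <=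
  l2sqn c - wsum N (fun a => sqn (c a)).
Proof.
rewrite hnorm_l2; apply: l2sqn_le => M; rewrite l2_trunc lerBrDr.
apply: le_trans (wsum_le_l2sqn c (maxn M N)).
pose F a := sqn (if (size a < N)%N then 0 else c a).
pose G a := sqn (if (size a < N)%N then c a else 0).
apply: (@le_trans _ _ (wsum (maxn M N) F + wsum (maxn M N) G)).
  rewrite lerD//.
    by apply: wsum_homo; [move=> a; exact: sqn_ge0|exact: leq_maxl].
  rewrite (wsum_stable (N := N)) ?leq_maxr// => [|a aN].
    by rewrite le_eqVlt (eq_wsum_lt (G := G)) ?eqxx// => a aN; rewrite /G aN.
  by rewrite /G ltnNge aN sqn0.
rewrite -wsumD; apply: ler_wsum => a; rewrite /F /G.
by case: ifP => _; rewrite sqn0 ?addr0 ?add0r.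
Qed.

Lemma l2_trunc_cvg (c : fock) :
  wsum N (fun a => c a *: fbasis a) @[N --> \oo] --> c.
Proof.
apply/hcvgP => e e0.
have cc : cvgn (fun N => wsum N (fun a => sqn (c a))) by apply/asboolP/l2valP.
have /cvgrPdist_le /(_ (e ^+ 2) (exprn_gt0 2 e0)) : wsum N (fun a => sqn (c a)) @[N --> \oo] --> l2sqn c by exact: cc.
apply: filterS => N; rewrite hnorm_subC => h.
rewrite -(@ler_pXn2r _ 2) ?nnegrE ?hnorm_ge0 ?(ltW e0)//.
by rewrite (le_trans (l2_trunc_le _ _))// (le_trans (ler_norm _)).
Qed.

(** The basis vectors span a dense subspace. *)
Lemma fock_ext (K : hilbertType R) (A B : fock -> K) : bounded_op A -> bounded_op B ->
  (forall a, A (fbasis a) = B (fbasis a)) -> A = B.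
Proof.
move=> Ab Bb AB; apply/funext => c.
apply: (@hcvg_unique _ _ _ \oo _ (fun N => A (wsum N (fun a => c a *: fbasis a)))).
  by apply: bounded_cvg => //; exact: l2_trunc_cvg.
have -> : (fun N => A (wsum N (fun a => c a *: fbasis a))) =
    (fun N => B (wsum N (fun a => c a *: fbasis a))).
  apply/funext => N; rewrite (linf_wsum _ _ Ab.1) (linf_wsum _ _ Bb.1).
  by apply: eq_wsum => a; rewrite (linfZ Ab.1) (linfZ Bb.1) AB.
by apply: bounded_cvg => //; exact: l2_trunc_cvg.
Qed.

Lemma fock_dot_ext (A B : fock -> fock) (v w : fock) : bounded_op A -> bounded_op B ->
  (forall a, hdot (A (fbasis a)) v = hdot (B (fbasis a)) w) ->
  forall c, hdot (A c) v = hdot (B c) w.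
Proof.
move=> Ab Bb AB c; apply/eqP; rewrite -subr_eq0; apply/eqP.
rewrite (hdot_adjoint _ _ Ab) (hdot_adjoint _ _ Bb) -hdotBr.
set u := _ - _.
have tN N : hdot (wsum N (fun a => c a *: fbasis a)) u = 0.
  rewrite /u hdotBr -!hdot_adjoint// (linf_wsum _ _ Ab.1) (linf_wsum _ _ Bb.1).
  rewrite /wsum !hdot_suml -sumrB big1// => k _; rewrite !hdot_suml -sumrB big1// => a _.
  by rewrite (linfZ Ab.1) (linfZ Bb.1) !hdotZl AB subrr.
apply: (@hdot_cvg0 _ _ _ \oo _ (fun N => wsum N (fun a => c a *: fbasis a)) (fun=> u)).
- exact: l2_trunc_cvg.
- exact: cvg_cst.
- by apply: nearW => N; exact: tN.
Qed.

Lemma wseries_eq (u : word n -> R[i]) z :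
  (forall e : R, 0 < e -> \forall N \near \oo, cabs (wsum N u - z) <= e) ->
  wseries u = z.
Proof.
move=> h; case: z h => a b h; rewrite /wseries; congr Complex.
  apply: (@cvg_lim R^o) => //; apply/cvgrPdist_le => e e0.
  apply: filterS (h e e0) => N; apply: le_trans; rewrite distrC.
  have := normc_ge_Re (wsum N u - Complex a b); rewrite cabsE lecR.
  by case: (wsum N u).
apply: (@cvg_lim R^o) => //; apply/cvgrPdist_le => e e0.
apply: filterS (h e e0) => N; apply: le_trans; rewrite distrC.
have := normc_ge_Re (- 'i%C * (wsum N u - Complex a b)); rewrite cabsE lecR.
rewrite -Re_ImE cabsM cabsN.
have -> : cabs ('i%C : R[i]) = 1.
  by rewrite /cabs normc_def /= expr0n add0r expr1n sqrtr1.
by rewrite mul1r; case: (wsum N u).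
Qed.

Lemma l2dot_cvg (c v : fock) z :
  (forall e : R, 0 < e ->
     \forall N \near \oo, cabs (wsum N (fun a => c a * (v a)^* ) - z) <= e) ->
  hdot c v = z.
Proof. exact: wseries_eq. Qed.

Lemma hdot_fbasis a (v : fock) : hdot (fbasis a) v = (v a)^*.
Proof.
apply: l2dot_cvg => e e0; exists (size a).+1 => // N /= aN.
rewrite (wsum_only (b := a))// => [|b ba]; rewrite /= /mono ?eqxx ?mul1r.
  by rewrite subrr cabs0 ltW.
by rewrite (negbTE ba) mul0r.
Qed.

End FockBasis.

Section PoissonVectors.
Variables (R : realType) (n : nat) (H : hilbertType R) (Y : 'I_n -> H -> H).
Variable rho : R.
Hypotheses (Yb : bounded_tuple Y) (rho01 : 0 <= rho < 1) (Yr : row_bound rho Y).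
Local Notation fock := (l2 R n).

Let rho0 : 0 <= rho. Proof. by case/andP: rho01. Qed.

Lemma adjoint_word_cons i a x :
  adjoint (op_word Y (i :: a)) x = adjoint (op_word Y a) (adjoint (Y i) x).
Proof.
apply: hdot_ext => z; rewrite -hdot_adjoint; last exact: (@bounded_word _ _ _ _ (i :: a)).
by rewrite /= hdot_adjoint// hdot_adjoint//; exact: bounded_word.
Qed.

Lemma adjoint_degree_bound k h :
  degree_sum k (fun a => hnorm (adjoint (op_word Y a) h) ^+ 2) <=
  (rho ^+ 2) ^+ k * hnorm h ^+ 2.
Proof.
elim: k h => [|k IH] h.
  rewrite degree_sum0 expr0 mul1r (@adjoint_unique _ _ _ _ idfun)//.
  exact: bounded_id.
rewrite degree_sumS [(rho ^+ 2) ^+ k.+1]exprSr -mulrA.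
have h1 := row_bound_adjoint Yb rho0 Yr h.
apply: le_trans (ler_wpM2l (exprn_ge0 k (sqr_ge0 rho)) h1).
rewrite mulr_sumr; apply: ler_sum => i _.
rewrite (@eq_degree_sum _ _ _ _ (fun a => hnorm (adjoint (op_word Y a) (adjoint (Y i) h)) ^+ 2)) => [|a _].
  exact: IH.
by rewrite adjoint_word_cons.
Qed.

Lemma wsum_adjoint_bound N h :
  wsum N (fun a => hnorm (adjoint (op_word Y a) h) ^+ 2) <=
  hnorm h ^+ 2 / (1 - rho ^+ 2).
Proof.
have r2 : rho ^+ 2 < 1 by rewrite expr_lt1//; case/andP: rho01.
have r20 : 0 < 1 - rho ^+ 2 by rewrite subr_gt0.
rewrite ler_pdivlMr//; apply: (@le_trans _ _ (hnorm h ^+ 2 * (1 - (rho ^+ 2) ^+ N))).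
  elim: N => [|N IH]; first by rewrite wsum0 mul0r expr0 subrr mulr0.
  rewrite wsumSr mulrDl; apply: (le_trans (lerD IH (ler_wpM2r (ltW r20) (adjoint_degree_bound N h)))).
  by rewrite [_ ^+ N.+1]exprS le_eqVlt; apply/orP; left; apply/eqP; ring.
by rewrite ler_piMr ?sqr_ge0// lerBlDr lerDl exprn_ge0 ?sqr_ge0.
Qed.

Lemma pvec_summable h b : (fun w => hdot h (op_word Y w b)) \in @square_summable R n.
Proof.
apply/square_summableP; exists (hnorm h ^+ 2 / (1 - rho ^+ 2) * hnorm b ^+ 2) => N.
apply: (@le_trans _ _ (wsum N (fun a => hnorm b ^+ 2 * hnorm (adjoint (op_word Y a) h) ^+ 2))).
  apply: ler_wsum => a; rewrite sqnE -adjoint_hdot; last exact: bounded_word.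
  rewrite -exprMn lerXn2r ?nnegrE ?mulr_ge0 ?cabs_ge0 ?hnorm_ge0// mulrC.
  exact: cauchy_schwarz.
rewrite wsumMl mulrC ler_wpM2r ?sqr_ge0//; exact: wsum_adjoint_bound.
Qed.

(** The Poisson vector of h and b: it represents the functional
    c |-> <c(Y) b, h> on the Fock space. *)
Definition pvec h b : fock := L2 (pvec_summable h b).

Lemma hdot_pvec (c : fock) h b z :
  peval Y N c b @[N --> \oo] --> z -> hdot c (pvec h b) = hdot z h.
Proof.
move=> cz; apply: l2dot_cvg => e e0.
have hh := @hdot_cvg R H nat \oo eventually_filter _ (fun=> h) z h cz (cvg_cst _) e e0.
case: hh => N1 _ N1P; exists N1 => // N /N1P hN; set u := wsum _ _.
suff -> : u = hdot (peval Y N c b) h by exact: hN.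
rewrite /u /peval /wsum hdot_suml; apply: eq_bigr => k _.
rewrite hdot_suml; apply: eq_bigr => a _.
by rewrite hdotZl -op_wordE /= -hdotC.
Qed.

Lemma pvec_lin k h h' b : pvec (k *: h + h') b = k *: pvec h b + pvec h' b.
Proof.
by apply: val_inj; apply/funext => w; rewrite /= hdotDl hdotZl.
Qed.

Lemma hdot_fbasis_pvec a h b : hdot (fbasis R a) (pvec h b) = hdot (op_word Y a b) h.
Proof. by rewrite hdot_fbasis /= -hdotC. Qed.

Section Shifts.
Variable W : 'I_n -> fock -> fock.
Hypothesis Wb : bounded_tuple W.
Hypothesis We : forall i a, W i (fbasis R a) = fbasis R (i :: a).

Lemma wact_shift a b : wact W a (fbasis R b) = fbasis R (a ++ b).
Proof. by elim: a => //= i a ->; rewrite We. Qed.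

(** Since W_w e_a = e_wa, the vector q(W) e_a is paired with a Poisson vector as
    q(Y) Y_a b is paired with h. *)
Lemma pvec_orthogonal_poly q N (c : fock) h b :
  (forall x, peval Y N q x = 0) -> hdot (peval W N q c) (pvec h b) = 0.
Proof.
move=> q0; have pb : bounded_op (peval W N q) by exact: bounded_peval.
suff : forall c, hdot (peval W N q c) (pvec h b) = hdot ((0 : fock -> fock) c) (pvec h b).
  by move=> ->; rewrite hdot0l.
apply: fock_dot_ext => //; first exact: bounded0.
move=> a; rewrite hdot0l -(hdot0l h) -(q0 (op_word Y a b)).
rewrite /peval /wsum !hdot_suml; apply: eq_bigr => k _.
rewrite !hdot_suml; apply: eq_bigr => w _; rewrite !hdotZl wact_shift.
rewrite hdot_fbasis_pvec op_wordE wact_cat; congr (_ * hdot _ _).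
by rewrite op_wordE.
Qed.

End Shifts.

Section Multipliers.
Variables (M : 'I_n -> fock -> fock) (g : 'I_n -> ncseries R n) (T : 'I_n -> H -> H).
Hypothesis Mb : bounded_tuple M.
Hypothesis Me : forall i a w, l2val (M i (fbasis R a)) w = series_mul (g i) (mono R a) w.
Hypothesis gT : forall i, geom_sum (g i) Y (T i).

(** On e_a both sides are <T_i Y_a b, h>, for M_i e_a has the coefficients of
    g_i Z_a and g_i(Y) = T_i. *)
Lemma multiplier_pvec i (c : fock) h b :
  hdot (M i c) (pvec h b) = hdot c (pvec (adjoint (T i) h) b).
Proof.
have Tb : bounded_op (T i) by case: (gT i).
apply: (@fock_dot_ext _ _ _ idfun _ _ (Mb i) (bounded_id _)) => a.
rewrite /= hdot_fbasis_pvec -hdot_adjoint//.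
apply: hdot_pvec.
have -> : l2val (M i (fbasis R a)) = series_mul (g i) (mono R a).
  by apply/funext => w; exact: Me.
have := geom_sum_cvg (x := op_word Y a b) (gT i).
move=> /hcvgP h1; apply/hcvgP => e e0; have [N _ NP] := h1 e e0.
exists (N + size a)%N => // k /= Nk.
have ak : (size a <= k)%N by apply: leq_trans Nk; exact: leq_addl.
rewrite -(subnK ak) (peval_mul_mono (tuple_linear Yb)) -op_wordE; apply: NP => /=.
by move: Nk; lia.
Qed.

Lemma multiplier_word_pvec a (c : fock) h b :
  hdot (wact M a c) (pvec h b) = hdot c (pvec (adjoint (op_word T a) h) b).
Proof.
have Tb : bounded_tuple T by move=> i; case: (gT i).
elim: a h => [|i a IH] h.
  by rewrite (@adjoint_unique _ _ _ _ idfun)//; exact: bounded_id.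
rewrite -[wact M (i :: a) c]/(M i (wact M a c)) multiplier_pvec (IH (adjoint (T i) h)).
congr (hdot c (pvec _ b)).
apply: hdot_ext => z; rewrite -hdot_adjoint; last exact: bounded_word.
by rewrite -hdot_adjoint// -hdot_adjoint//; exact: (@bounded_word _ _ _ _ (i :: a)).
Qed.

End Multipliers.

End PoissonVectors.

(** * The Hardy algebra and the ideal of a variety *)

Section WotClosure.
Variables (R : realType) (H : hilbertType R).
Implicit Types (S : set (H -> H)) (A B : H -> H).

Lemma cabs_lt (z : R[i]) (e : R) : (`|z| < (e%:C)%C) = (cabs z < e).
Proof. by rewrite cabsE ltcR. Qed.

Lemma wot_closureP S A : wot_closure S A <-> bounded_op A /\
  forall (s : seq (H * H)) (e : R), 0 < e -> exists2 B, S B &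
    forall x y, (x, y) \in s -> cabs (hdot (A x - B x) y) < e.
Proof.
split=> -[Ab h]; split=> // s e e0; have [B SB hB] := h s e e0; exists B => // x y xy.
  by rewrite -cabs_lt hB.
by rewrite cabs_lt hB.
Qed.

Lemma wot_closure_sub S A : bounded_op A -> S A -> wot_closure S A.
Proof.
move=> Ab SA; apply/wot_closureP; split=> // s e e0; exists A => // x y _.
by rewrite subrr hdot0l cabs0.
Qed.

Lemma wot_closure_idem S A : wot_closure (wot_closure S) A -> wot_closure S A.
Proof.
move=> /wot_closureP[Ab hA]; apply/wot_closureP; split=> // s e e0.
have e2 : 0 < e / 2 by rewrite divr_gt0.
have [B /wot_closureP[_ hB] AB] := hA s _ e2.
have [D SD BD] := hB s _ e2; exists D => // x y xy.
rewrite -(subrKA (B x)) hdotDl (le_lt_trans (cabsD _ _))//.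
by rewrite (splitr e) ltrD// ?AB ?BD.
Qed.

Lemma wot_closure_mono S S' : S `<=` S' -> wot_closure S `<=` wot_closure S'.
Proof.
move=> SS A [Ab hA]; split=> // s e e0; have [B SB hB] := hA s e e0.
by exists B => //; exact: SS.
Qed.

Lemma wot_closure_lin S k A B :
  (forall k A B, S A -> S B -> S (k *: A + B)%R) ->
  wot_closure S A -> wot_closure S B -> wot_closure S (k *: A + B)%R.
Proof.
move=> Slin /wot_closureP[Ab hA] /wot_closureP[Bb hB]; apply/wot_closureP.
split=> [|s e e0]; first exact: bounded_lin.
have k1 : 0 < cabs k + 1 by rewrite ltr_wpDl// cabs_ge0.
have [A' SA' AA'] := hA s (e / 2 / (cabs k + 1)) (divr_gt0 (divr_gt0 e0 (ltr0n _ 2)) k1).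
have [B' SB' BB'] := hB s (e / 2) (divr_gt0 e0 (ltr0n _ 2)).
exists (k *: A' + B')%R; first exact: Slin.
move=> x y xy; rewrite !addrfctE !scalrfctE opprD addrACA -scalerBr hdotDl hdotZl.
rewrite (le_lt_trans (cabsD _ _))// (splitr e) ler_ltD ?BB'// cabsM.
have := AA' x y xy; rewrite ltr_pdivlMr// => /ltW h; apply: le_trans h.
by rewrite mulrC ler_wpM2l ?cabs_ge0// lerDl.
Qed.

(** Composition is continuous in each factor separately, not jointly: hence two
    steps, joined by idempotence. *)
Lemma wot_closure_comp S A B :
  (forall A, S A -> bounded_op A) -> (forall A B, S A -> S B -> S (A \o B)) ->
  wot_closure S A -> wot_closure S B -> wot_closure S (A \o B).
Proof.
move=> Sb Sc clA clB; have Bb := clB.1.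
have step D : S D -> wot_closure S (D \o B).
  move=> SD; have /wot_closureP[_ hB] := clB; apply/wot_closureP.
  split=> [|s e e0]; first by apply: bounded_comp => //; exact: Sb.
  have [B' SB' BB'] := hB [seq (p.1, adjoint D p.2) | p <- s] e e0.
  exists (D \o B'); first exact: Sc.
  move=> x y xy /=; have Db := Sb D SD; rewrite -(linfB Db.1) hdot_adjoint//.
  by apply: BB'; apply/mapP; exists (x, y).
apply: wot_closure_idem; have /wot_closureP[Ab hA] := clA; apply/wot_closureP.
split=> [|s e e0]; first exact: bounded_comp.
have [A' SA' AA'] := hA [seq (B p.1, p.2) | p <- s] e e0.
exists (A' \o B); first exact: step.
by move=> x y xy /=; apply: AA'; apply/mapP; exists (x, y).
Qed.

Lemma sot_wot_closure S A (T : Type) (F : set_system T) {FF : ProperFilter F}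
    (u : T -> H -> H) : bounded_op A -> (\forall t \near F, S (u t)) ->
  (forall x, u t x @[t --> F] --> A x) -> wot_closure S A.
Proof.
move=> Ab Su uA; apply/wot_closureP; split=> // s e e0.
have FF1 : Filter F by exact: _.
have : \forall t \near F, forall x y, (x, y) \in s -> cabs (hdot (A x - u t x) y) < e.
  elim: s => [|[x y] s IH]; first exact: nearW.
  have d0 : 0 < e / 2 / (hnorm y + 1).
    by rewrite !divr_gt0// ltr_wpDl// hnorm_ge0.
  have /hcvgP /(_ _ d0) h := uA x.
  apply: filterS2 IH h => t ht hx x' y'; rewrite inE => /predU1P[[-> ->]|]; last exact: ht.
  rewrite (le_lt_trans (cauchy_schwarz _ _))//.
  move: hx; rewrite hnorm_subC ler_pdivlMr ?ltr_wpDl ?hnorm_ge0// => hx.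
  apply: (@le_lt_trans _ _ (e / 2)); last by rewrite ltr_pdivrMr// mulr_natr mulr2n ltrDl.
  by apply: le_trans hx; rewrite ler_wpM2l ?hnorm_ge0// lerDl.
move=> h; have [t [St ht]] := @filter_ex _ F FF _ (filterI Su h).
by exists (u t).
Qed.

Lemma closure_orthogonal (U : set H) (v : H) :
  (forall u, U u -> hdot u v = 0) -> forall a, closure U a -> hdot a v = 0.
Proof.
move=> Uv a aU; apply: cabs_eq0; apply/eqP; rewrite eq_le cabs_ge0 andbT.
apply/ler_addgt0Pl => e e0; rewrite addr0.
have d0 : 0 < e / (hnorm v + 1) by rewrite divr_gt0// ltr_wpDl// hnorm_ge0.
have /aU[u [Uu]] : nbhs a (ball a (((e / (hnorm v + 1))%:C)%C)).
  by apply: nbhsx_ballx; rewrite -[0]/(((0 : R)%:C)%C) ltcR.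
rewrite -ball_normE /= hnormC ltcR => h.
have -> : hdot a v = hdot (a - u) v by rewrite hdotBl (Uv u Uu) subr0.
rewrite (le_trans (cauchy_schwarz _ _))//.
move: h; rewrite ltr_pdivlMr ?ltr_wpDl ?hnorm_ge0// => /ltW h; apply: le_trans h.
by rewrite ler_wpM2l ?hnorm_ge0// lerDl.
Qed.

End WotClosure.

Section HardyAlgebra.
Variables (R : realType) (n : nat) (fock : hilbertType R).
Variable M : 'I_n -> fock -> fock.
Hypothesis Mb : bounded_tuple M.

Definition poly_ops : set (fock -> fock) := [set A | exists N p, A = partial_eval p M N].

(** The Hardy algebra of an arbitrary Hilbert space in place of the Fock space. *)
Definition walgebra : set (fock -> fock) := wot_closure poly_ops.

Lemma poly_opsP A : poly_ops A <-> exists N p, degree_lt N p /\ A = peval M N p.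
Proof.
split=> [[N [p ->]]|[N [p [_ ->]]]]; last first.
  by exists N, p; apply/funext => x; rewrite partial_evalE.
exists N, (fun a => if (size a < N)%N then p a else 0); split.
  by move=> a aN; rewrite ltnNge aN.
apply/funext => x; rewrite partial_evalE; apply: eq_wsum_lt => a aN.
by rewrite aN.
Qed.

Lemma poly_ops_bounded A : poly_ops A -> bounded_op A.
Proof. by move=> [N [p ->]]; exact: bounded_partial. Qed.

Lemma poly_ops_lin k A B : poly_ops A -> poly_ops B -> poly_ops (k *: A + B)%R.
Proof.
move=> /poly_opsP[N [p [pN ->]]] /poly_opsP[N' [q [qN ->]]]; apply/poly_opsP.
exists (maxn N N'), (k *: p + q); split.
  move=> a; rewrite geq_max => /andP[aN aN'].
  by rewrite addrfctE scalrfctE pN// qN// scaler0 addr0.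
apply/funext => x; rewrite peval_lin addrfctE scalrfctE.
by rewrite !(peval_stable _ _ pN) ?leq_maxl// !(peval_stable _ _ qN) ?leq_maxr.
Qed.

Lemma poly_ops_comp A B : poly_ops A -> poly_ops B -> poly_ops (A \o B).
Proof.
move=> /poly_opsP[N [p [pN ->]]] /poly_opsP[N' [q [qN ->]]]; apply/poly_opsP.
exists (N + N')%N, (series_mul p q); split; first exact: degree_lt_mul.
apply/funext => x /=; rewrite peval_mul//; exact: tuple_linear.
Qed.

Lemma hardy_lin k A B : walgebra A -> walgebra B ->
  walgebra (k *: A + B)%R.
Proof. by apply: wot_closure_lin; exact: poly_ops_lin. Qed.

Lemma hardy_lin_ext k A B D : (forall x, D x = k *: A x + B x) ->
  walgebra A -> walgebra B -> walgebra D.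
Proof.
move=> DE Ah Bh; have -> : D = (k *: A + B)%R by apply/funext => x; exact: DE.
exact: hardy_lin.
Qed.

Lemma hardy_comp A B : walgebra A -> walgebra B ->
  walgebra (A \o B).
Proof.
by apply: wot_closure_comp; [exact: poly_ops_bounded|exact: poly_ops_comp].
Qed.

Lemma hardy_poly A : poly_ops A -> walgebra A.
Proof. by move=> pA; apply: wot_closure_sub => //; exact: poly_ops_bounded. Qed.

Lemma hardy0 : walgebra 0.
Proof.
apply: hardy_poly; exists 0%N, 0; apply/funext => x.
by rewrite partial_evalE /peval wsum0.
Qed.

Lemma hardy_id : walgebra idfun.
Proof.
apply: hardy_poly; exists 1%N, (@series_one R n); apply/funext => x.
by rewrite partial_evalE -mono_nil peval_mono.
Qed.

Lemma hardy_sum (I : Type) (r : seq I) (F : I -> fock -> fock) :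
  (forall i, walgebra (F i)) -> walgebra (\sum_(i <- r) F i).
Proof.
move=> Fh; elim: r => [|i r IH]; first by rewrite big_nil; exact: hardy0.
by rewrite big_cons -[F i]scale1r; exact: hardy_lin.
Qed.

Lemma hardy_partial (W : 'I_n -> fock -> fock) q N :
  (forall i, walgebra (W i)) -> walgebra (partial_eval q W N).
Proof.
move=> Wh; apply: hardy_sum => k; apply: hardy_sum => a.
rewrite -[_ *: _]addr0; apply: hardy_lin; last exact: hardy0.
by elim: (val a) => [|i w IH] /=; [exact: hardy_id|exact: hardy_comp].
Qed.

Lemma poly_ops_scale r : 
  forall A, [set A | exists N p, A = partial_eval p (scale_tuple r M) N] A -> poly_ops A.
Proof.
move=> _ [N [p ->]]; exists N, (dilate r p); apply/funext => x.
by rewrite !partial_evalE peval_scale.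
Qed.

(** A radial sum is a limit of limits of polynomials. *)
Lemma hardy_series (psi : ncseries R n) A :
  sot_sum psi M A \/ rad_sum psi M A -> walgebra A.
Proof.
case=> [[Ab sA]|[Ab [delta [/andP[d0 d1] [Phi [nP Pc]]]]]].
  apply: (@sot_wot_closure _ _ _ _ _ \oo _ (partial_eval psi M)) => //.
  by apply: nearW => N; exists N, psi.
apply: wot_closure_idem.
apply: (@sot_wot_closure _ _ _ _ _ (1^'-) _ Phi) => //.
near=> r.
have r1 : delta < r < 1.
  by apply/andP; split; near: r; [exact: nbhs_left_gt|exact: nbhs_left_lt].
have Mrb : bounded_tuple (scale_tuple r M) by move=> i; exact: boundedZ.
apply: (@sot_wot_closure _ _ _ _ _ \oo _ (partial_eval psi (scale_tuple r M))).
- by case: (nP r r1).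
- by apply: nearW => N; apply: poly_ops_scale; exists N, psi.
- move=> x; have := norm_sum_cvg (x := x) Mrb (nP r r1).
  by under eq_fun do rewrite -partial_evalE.
Unshelve. all: by end_near. Qed.

End HardyAlgebra.

Section PoissonVariety.
Variables (R : realType) (n : nat) (H : hilbertType R) (Y : 'I_n -> H -> H).
Variable rho : R.
Hypotheses (Yb : bounded_tuple Y) (rho01 : 0 <= rho < 1) (Yr : row_bound rho Y).
Local Notation fock := (l2 R n).
Variables (f : 'I_n -> ncseries R n) (M : 'I_n -> fock -> fock) (P : set (ncseries R n)).
Local Notation W := (eval_tuple f M).
Variables (g : 'I_n -> ncseries R n) (T : 'I_n -> H -> H).
Hypothesis Mb : bounded_tuple M.
Hypothesis Me : forall i a w, l2val (M i (fbasis R a)) w = series_mul (g i) (mono R a) w.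
Hypothesis Wb : bounded_tuple W.
Hypothesis We : forall i a, W i (fbasis R a) = fbasis R (i :: a).
Hypothesis Wh : forall i, hardy_algebra M (W i).
Hypothesis gT : forall i, geom_sum (g i) Y (T i).
Hypothesis PY : forall q, P q -> exists2 N, degree_lt N q & forall x, peval Y N q x = 0.

Local Notation pv := (pvec Yb rho01 Yr).

Definition poisson_annihilator : set (fock -> fock) :=
  [set A | hardy_algebra M A /\ forall c h b, hdot (A c) (pv h b) = 0].

(** The operators whose range is orthogonal to all Poisson vectors form an
    ideal, because the adjoints of the M_i permute these vectors. *)
Lemma poisson_annihilator_ideal : wot_closed_ideal M poisson_annihilator.
Proof.
split.
- by move=> A [].
- by split=> [|c h b]; [exact: hardy0|rewrite hdot0l].
- move=> k A B [Ah A0] [Bh B0]; split=> [|c h b].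
    exact: (@hardy_lin_ext _ _ _ M k A B _ (fun x => erefl _) Ah Bh).
  transitivity (hdot (k *: A c + B c : fock) (pv h b)); first by [].
  by rewrite hdotDl hdotZl A0 B0 mulr0 addr0.
- move=> A B Ah [Bh B0]; split; last first.
    split=> [|c h b]; first exact: (@hardy_comp _ _ _ M Mb _ _ Bh Ah).
    exact: (B0 (A c)).
  split=> [|c h b]; first exact: (@hardy_comp _ _ _ M Mb _ _ Ah Bh).
  rewrite -[(A \o B) c]/(A (B c)).
  apply: cabs_eq0; apply/eqP; rewrite eq_le cabs_ge0 andbT.
  apply/ler_addgt0Pl => e e0; rewrite addr0.
  have /wot_closureP[_ /(_ [:: (B c, pv h b)] e e0)[D [N [p ->]] hD]] := Ah.
  have := hD _ _ (mem_head _ _); rewrite hdotBl => /ltW.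
  suff -> : hdot (partial_eval p M N (B c)) (pv h b) = 0 by rewrite subr0.
  rewrite partial_evalE /peval /wsum hdot_suml big1// => k _.
  rewrite hdot_suml big1// => a _.
  by rewrite hdotZl (multiplier_word_pvec Yb rho01 Yr Mb Me gT) B0 mulr0.
- move=> A /wot_closureP[Ab hA]; split.
    apply: wot_closure_idem; apply: wot_closure_mono (_ : wot_closure poisson_annihilator A).
      by move=> B [].
    exact/wot_closureP.
  move=> c h b; apply: cabs_eq0; apply/eqP; rewrite eq_le cabs_ge0 andbT.
  apply/ler_addgt0Pl => e e0; rewrite addr0.
  have [B [_ B0] hB] := hA [:: (c, pv h b)] e e0.
  by have := hB _ _ (mem_head _ _); rewrite hdotBl B0 subr0 => /ltW.
Qed.

Lemma variety_ideal_annihilates : variety_ideal f M P `<=` poisson_annihilator.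
Proof.
apply: smallest_sub; first exact: poisson_annihilator_ideal.
move=> _ [q Pq <-]; have [N qN qY] := PY Pq.
have -> : series_eval q W = peval W N q.
  by apply: series_eval_geom => //; exact: geom_sum_poly.
split; last by move=> c h b; exact: pvec_orthogonal_poly.
have -> : peval W N q = partial_eval q W N by apply/funext => x; rewrite partial_evalE.
exact: hardy_partial.
Qed.

Lemma pvec_orthogonal h b :
  pv h b \in orthogonal_to (closure (\bigcup_(A in variety_ideal f M P) range A)).
Proof.
apply/asboolP; apply: closure_orthogonal => _ [A /variety_ideal_annihilates[_ A0] [c _ <-]].
exact: A0.
Qed.

Definition vvec h b : variety_space f M P := Orthocomp (pvec_orthogonal h b).

Lemma vvec_lin k h h' b : vvec (k *: h + h') b = k *: vvec h b + vvec h' b.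
Proof. by apply: val_inj; exact: pvec_lin. Qed.

End PoissonVariety.

Section Compression.
Variables (R : realType) (K : hilbertType R) (A : set K) (M : K -> K).

(** A component of variety_model, for an arbitrary operator and subspace. *)
Definition compression (x : orthocomp A) : orthocomp A :=
  projection A (M (orthocomp_val x)).

Lemma hdot_compression (x z : orthocomp A) :
  hdot (compression x) z = hdot (M (orthocomp_val x)) (orthocomp_val z).
Proof. exact: projectionP. Qed.

Lemma hdot_compressionC (x z : orthocomp A) :
  hdot z (compression x) = hdot (orthocomp_val z) (M (orthocomp_val x)).
Proof. by rewrite hdotC hdot_compression -hdotC. Qed.

Lemma bounded_compression : bounded_op M -> bounded_op compression.
Proof.
move=> /bounded_opP[Ml [c c0 Mc]]; apply/bounded_opP; split.
  move=> k x y; apply: hdot_ext => z.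
  rewrite hdotDr hdotZr !hdot_compressionC.
  have -> : orthocomp_val (k *: x + y) = k *: orthocomp_val x + orthocomp_val y by [].
  by rewrite Ml hdotDr hdotZr.
exists c => // x; set z := compression x.
have [->|z0] := eqVneq (hnorm z) 0; first by rewrite mulr_ge0 ?hnorm_ge0.
have zp : 0 < hnorm z by rewrite lt_neqAle eq_sym z0 hnorm_ge0.
rewrite -(ler_pM2r zp) -expr2 hnorm_sqr {1}/z hdot_compression.
by rewrite (le_trans (Re_hdot_hnorm _ _))// ler_wpM2r ?hnorm_ge0.
Qed.

End Compression.

(** * Approximate dilations and positive forms *)

Section GramSchmidt.
Variables (R : realType) (V : lmodType R[i]) (d : V -> V -> R[i]).
Hypothesis dlin : forall k x y z, d (k *: x + y) z = k * d x z + d y z.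
Hypothesis dC : forall x y, d x y = (d y x)^*.
Hypothesis dpos : forall x, x != 0 -> 0 < complex.Re (d x x).

(** The form is abstract because orthonormal families are needed both for the
    inner product and for the defect form of a row contraction. *)
Definition form_orthonormal (I : finType) (b : I -> V) : Prop :=
  forall i j, d (b i) (b j) = (i == j)%:R.

Lemma sform_addl x y z : d (x + y) z = d x z + d y z.
Proof. by rewrite -[x]scale1r dlin scale1r mul1r. Qed.

Lemma sform_addr x y z : d x (y + z) = d x y + d x z.
Proof. by rewrite dC sform_addl rmorphD /= -!dC. Qed.

Lemma sform_0l z : d 0 z = 0.
Proof. by apply: (@addrI _ (d 0 z)); rewrite -sform_addl !addr0. Qed.

Lemma sform_scalel k x z : d (k *: x) z = k * d x z.
Proof. by rewrite -[k *: x]addr0 dlin sform_0l addr0. Qed.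

Lemma sform_scaler k x z : d x (k *: z) = k^* * d x z.
Proof. by rewrite dC sform_scalel rmorphM /= -dC. Qed.

Lemma form_suml (I : finType) (F : I -> V) z :
  d (\sum_i F i) z = \sum_i d (F i) z.
Proof.
by elim/big_rec2: _ => [|i y x _ <-]; rewrite ?sform_0l// sform_addl.
Qed.

Lemma form_selfE x : d x x = ((complex.Re (d x x))%:C)%C.
Proof.
have := dC x x; rewrite conjCE; case: (d x x) => a b /= [].
by move=> /eqP; rewrite -subr_eq0 opprK -mulr2n mulrn_eq0 /= => /eqP ->.
Qed.

Lemma form_expansion (I : finType) (b : I -> V) (k : I -> R[i]) j : form_orthonormal b ->
  d (\sum_i k i *: b i) (b j) = k j.
Proof.
move=> bo; rewrite form_suml (bigD1 j)//= sform_scalel bo eqxx mulr1.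
rewrite big1 ?addr0// => i ij.
by rewrite sform_scalel bo (negbTE ij) mulr0.
Qed.

Definition residual (I : finType) (b : I -> V) u := u - \sum_i d u (b i) *: b i.

Lemma residual_orthogonal (I : finType) (b : I -> V) u j : form_orthonormal b ->
  d (residual b u) (b j) = 0.
Proof.
move=> bo; rewrite /residual sform_addl -scaleN1r sform_scalel form_expansion//.
by rewrite mulN1r subrr.
Qed.

Lemma form_orthogonal_add p r : d r p = 0 -> d (p + r) (p + r) = d p p + d r r.
Proof.
move=> rp; have pr : d p r = 0 by rewrite dC rp rmorph0.
by rewrite sform_addl !sform_addr rp pr addr0 add0r.
Qed.

Lemma form_pythagoras (I : finType) (b : I -> V) u : form_orthonormal b ->
  complex.Re (d u u) = \sum_i cabs (d u (b i)) ^+ 2 +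
    complex.Re (d (residual b u) (residual b u)).
Proof.
move=> bo; set r := residual b u; set p := \sum_i d u (b i) *: b i.
have uE : u = p + r by rewrite /r /residual addrC subrK.
have rp : d r p = 0.
  rewrite dC form_suml big1 ?rmorph0// => i _.
  by rewrite sform_scalel [d (b i) r]dC /r residual_orthogonal// rmorph0 mulr0.
have -> : d u u = d p p + d r r.
  by rewrite {1 2}uE form_orthogonal_add.
rewrite raddfD /=; congr (_ + _); rewrite {1}/p form_suml raddf_sum /=.
apply: eq_bigr => i _; rewrite sform_scalel [d (b i) p]dC form_expansion//.
by rewrite -normCK -sqn_normc sqnE.
Qed.

Lemma bessel (I : finType) (b : I -> V) u : form_orthonormal b ->
  \sum_i cabs (d u (b i)) ^+ 2 <= complex.Re (d u u).
Proof.
move=> bo; rewrite (form_pythagoras u bo) lerDl.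
have [->|r0] := eqVneq (residual b u) 0; first by rewrite sform_0l.
exact/ltW/dpos.
Qed.

(** Adding to an orthonormal family the normalized residual of u. *)
Lemma form_orthonormal_extend m (b : 'I_m -> V) u : form_orthonormal b -> residual b u != 0 ->
  exists c : 'I_m.+1 -> V, [/\ form_orthonormal c, residual c u = 0 &
    forall w, residual b w = 0 -> residual c w = 0].
Proof.
move=> bo r0; set r := residual b u in r0.
have dr := dpos r0; set q := complex.Re (d r r) in dr.
pose t : R[i] := (((Num.sqrt q)^-1)%:C)%C; pose e := t *: r.
have tt : t^* = t by exact: conjc_real.
have tq : t * t * d r r = 1.
  rewrite form_selfE -/q /t -!rmorphM /= -[RHS]/((1 : R)%:C)%C; congr (_%:C)%C.
  by rewrite -invfM -expr2 sqr_sqrtr ?(ltW dr)// mulVf ?gt_eqF.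
have ee : d e e = 1.
  by rewrite /e sform_scalel sform_scaler tt mulrA.
have eb j : d e (b j) = 0 by rewrite /e sform_scalel residual_orthogonal// mulr0.
pose c i := if unlift ord0 i is Some j then b j else e.
have c0 : c ord0 = e by rewrite /c unlift_none.
have cS j : c (lift ord0 j) = b j by rewrite /c liftK.
have co : form_orthonormal c.
  move=> i j; case: (unliftP ord0 i) => [i'|] ->; case: (unliftP ord0 j) => [j'|] ->.
  - by rewrite !cS bo (inj_eq (@lift_inj _ ord0)).
  - by rewrite cS c0 dC eb rmorph0 eq_sym (negbTE (neq_lift _ _)).
  - by rewrite cS c0 eb (negbTE (neq_lift _ _)).
  - by rewrite c0 ee eqxx.
have cres w : residual c w = residual b w - d w e *: e.
  rewrite /residual big_ord_recl c0 opprD addrCA [RHS]addrC; congr (_ + (_ - _)).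
  by apply: eq_bigr => i _; rewrite cS.
exists c; split=> //.
  rewrite cres -/r.
  have -> : d u e = d r e.
    rewrite /r /residual.
    have : d (\sum_i d u (b i) *: b i) e = 0.
      rewrite form_suml big1// => i _; rewrite sform_scalel [d (b i) e]dC eb rmorph0 mulr0 //.
    by move=> E; rewrite sform_addl -scaleN1r sform_scalel E mulr0 addr0.
  rewrite /e [d r _]dC sform_scalel rmorphM /= tt -dC scalerA mulrAC tq scale1r subrr //.
move=> w bw; rewrite cres bw.
suff -> : d w e = 0 by rewrite scale0r subr0.
have -> : w = \sum_i d w (b i) *: b i by apply/eqP; rewrite -subr_eq0; apply/eqP.
by rewrite form_suml big1// => i _; rewrite sform_scalel [d (b i) e]dC eb rmorph0 mulr0.
Qed.

Lemma gram_schmidt (us : seq V) :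
  exists m (b : 'I_m -> V), form_orthonormal b /\ forall u, u \in us -> residual b u = 0.
Proof.
elim: us => [|u us [m [b [bo bu]]]].
  by exists 0%N, (fun=> 0); split=> // -[].
have [r0|r0] := eqVneq (residual b u) 0.
  exists m, b; split=> // w; rewrite inE => /predU1P[->//|]; exact: bu.
have [c [co cu cw]] := form_orthonormal_extend bo r0.
exists m.+1, c; split=> // w; rewrite inE => /predU1P[->//|/bu]; exact: cw.
Qed.

End GramSchmidt.

Section FormBounds.
Variables (R : realType) (H : hilbertType R).

Lemma Re_hdot_suml (I : Type) (r : seq I) (F : I -> H) y :
  complex.Re (hdot (\sum_(i <- r) F i) y) = \sum_(i <- r) complex.Re (hdot (F i) y).
Proof. by rewrite hdot_suml raddf_sum. Qed.

(** The bound c on the norm of an operator matrix, as a bound on its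
    sesquilinear form; in this shape it is additive in the matrix. *)
Definition form_bound m (c : R) (A : 'I_m -> 'I_m -> H -> H) : Prop :=
  forall x y : 'I_m -> H,
  \sum_i \sum_j complex.Re (hdot (A i j (x j)) (y i)) <=
  c / 2 * (\sum_j hnorm (x j) ^+ 2 + \sum_i hnorm (y i) ^+ 2).

(** Cauchy-Schwarz and the mean inequality with weights 1 / c and c. *)
Lemma norm_form_bound m (c : R) (A : 'I_m -> 'I_m -> H -> H) : 0 < c ->
  (forall x, \sum_i hnorm (\sum_j A i j (x j)) ^+ 2 <=
     c ^+ 2 * \sum_j hnorm (x j) ^+ 2) -> form_bound c A.
Proof.
move=> c0 Ac x y; have := Ac x; pose Z i := \sum_j A i j (x j).
rewrite -/(\sum_i hnorm (Z i) ^+ 2) => hZ.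
apply: (@le_trans _ _ (\sum_i ((2 * c)^-1 * hnorm (Z i) ^+ 2 + c / 2 * hnorm (y i) ^+ 2))).
  apply: ler_sum => i _; have := Re_hdot_hnorm (Z i) (y i).
  rewrite {1}/Z Re_hdot_suml => h; apply: (le_trans h).
  rewrite -subr_ge0.
  have -> : (2 * c)^-1 * hnorm (Z i) ^+ 2 + c / 2 * hnorm (y i) ^+ 2 -
      hnorm (Z i) * hnorm (y i) = (2 * c)^-1 * (hnorm (Z i) - c * hnorm (y i)) ^+ 2.
    by field; rewrite gt_eqF.
  by rewrite mulr_ge0 ?sqr_ge0// invr_ge0 mulr_ge0// ltW.
rewrite big_split /= -!mulr_sumr mulrDr lerD2r.
have -> : c / 2 * \sum_j hnorm (x j) ^+ 2 =
    (2 * c)^-1 * (c ^+ 2 * \sum_j hnorm (x j) ^+ 2).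
  by field; rewrite gt_eqF.
by rewrite ler_wpM2l// invr_ge0 mulr_ge0// ltW.
Qed.

(** To recover the norm, take for y the image of x divided by c. *)
Lemma form_bound_norm m (c : R) (A : 'I_m -> 'I_m -> H -> H) : 0 < c ->
  form_bound c A ->
  forall x, \sum_i hnorm (\sum_j A i j (x j)) ^+ 2 <=
     c ^+ 2 * \sum_j hnorm (x j) ^+ 2.
Proof.
move=> c0 Ac x; pose z i := \sum_j A i j (x j).
rewrite -/(\sum_i hnorm (z i) ^+ 2); set S := \sum_j hnorm (x j) ^+ 2.
have := Ac x (fun i => ((c^-1)%:C)%C *: z i); rewrite -/S.
set Q := \sum_i hnorm (z i) ^+ 2.
have -> : \sum_i \sum_j complex.Re (hdot (A i j (x j)) (((c^-1)%:C)%C *: z i)) = c^-1 * Q.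
  rewrite mulr_sumr; apply: eq_bigr => i _.
  transitivity (complex.Re (hdot (\sum_j A i j (x j)) (((c^-1)%:C)%C *: z i))).
    by rewrite Re_hdot_suml.
  by rewrite -/(z i) (Re_form_Zr hdot) -hnorm_sqr.
have -> : \sum_i hnorm (((c^-1)%:C)%C *: z i) ^+ 2 = (c^-1) ^+ 2 * Q.
  rewrite mulr_sumr; apply: eq_bigr => i _.
  by rewrite hnorm_scale cabs_real exprMn real_normK ?num_real.
have cn : c != 0 by rewrite gt_eqF.
have -> : c / 2 * (S + (c^-1) ^+ 2 * Q) = (2 * c)^-1 * (c ^+ 2 * S + Q) by field.
have -> : c^-1 * Q = (2 * c)^-1 * (2 * Q) by field.
rewrite ler_pM2l ?invr_gt0 ?mulr_gt0//; lra.
Qed.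

Lemma form_bound_perturb m (c e : R) (A D : 'I_m -> 'I_m -> H -> H) :
  0 <= e -> form_bound c A -> (forall i j x, hnorm (D i j x - A i j x) <= e * hnorm x) ->
  form_bound (c + m%:R * e) D.
Proof.
move=> e0 Ac DA x y.
have step i j : complex.Re (hdot (D i j (x j)) (y i)) <=
    complex.Re (hdot (A i j (x j)) (y i)) + e / 2 * (hnorm (x j) ^+ 2 + hnorm (y i) ^+ 2).
  have := Re_hdot_hnorm (D i j (x j) - A i j (x j)) (y i).
  rewrite hdotBl raddfB /=; have := DA i j (x j).
  have := hnorm_ge0 (D i j (x j) - A i j (x j)).
  have := hnorm_ge0 (x j); have := hnorm_ge0 (y i).
  move: (hnorm (_ - _)) (hnorm (x j)) (hnorm (y i)) => h X Z Z0 X0 h0 hX h1.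
  have : h * Z <= e * X * Z by rewrite ler_wpM2r.
  have : 0 <= e * (X - Z) ^+ 2 by rewrite mulr_ge0 ?sqr_ge0.
  move: (complex.Re _) (complex.Re _) h1 => a b.
  have -> : e * (X - Z) ^+ 2 = e * X ^+ 2 + e * Z ^+ 2 - 2 * (e * X * Z) by ring.
  rewrite mulrDr; lra.
apply: (@le_trans _ _ (\sum_i \sum_j (complex.Re (hdot (A i j (x j)) (y i)) +
    e / 2 * (hnorm (x j) ^+ 2 + hnorm (y i) ^+ 2)))).
  by apply: ler_sum => i _; apply: ler_sum => j _; exact: step.
under eq_bigr do rewrite big_split /=.
rewrite big_split /=.
have -> : \sum_i \sum_j e / 2 * (hnorm (x j) ^+ 2 + hnorm (y i) ^+ 2) =
    m%:R * e / 2 * (\sum_j hnorm (x j) ^+ 2 + \sum_i hnorm (y i) ^+ 2).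
  under eq_bigr do rewrite -mulr_sumr big_split /= sumr_const card_ord -[_ *+ m]mulr_natl.
  rewrite -mulr_sumr big_split /= sumr_const card_ord -mulr_sumr -[_ *+ m]mulr_natl.
  ring.
have := Ac x y; move: (\sum_i \sum_j _) (_ + _) => S Q h.
rewrite mulrDl mulrDl; lra.
Qed.

End FormBounds.

Section ApproxDilation.
Variables (R : realType) (n : nat) (N H : hilbertType R).
Variables (B : 'I_n -> N -> N) (T : 'I_n -> H -> H).
Hypotheses (Bb : bounded_tuple B) (Tb : bounded_tuple T).

(** Finitely many maps V_k : H -> N that intertwine the adjoints and whose
    column is contractive and almost isometric on a given finite set: they play
    the part of the components of an isometry from H to a multiple of N. *)
Definition approx_dilation : Prop := forall (us : seq H) (e : R), 0 < e ->
  exists m (V : 'I_m -> H -> N),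
    [/\ forall k, linear (V k),
        forall k a x h, hdot (op_word B a x) (V k h) =
          hdot x (V k (adjoint (op_word T a) h)),
        forall u, \sum_k hnorm (V k u) ^+ 2 <= hnorm u ^+ 2 &
        forall u, u \in us -> hnorm u ^+ 2 - e <= \sum_k hnorm (V k u) ^+ 2].

Definition star_comb (K : hilbertType R) (S : 'I_n -> K -> K)
    (s : seq (R[i] * (word n * word n))) : K -> K :=
  \sum_(t <- s) t.1 *: star_words S t.2.1 t.2.2.

Lemma hdot_star_comb (K : hilbertType R) (S : 'I_n -> K -> K) s x y :
  bounded_tuple S ->
  hdot (star_comb S s x) y =
  \sum_(t <- s) hdot (t.1 *: adjoint (op_word S t.2.2) x)
                     (adjoint (op_word S t.2.1) y).
Proof.
move=> Sb; rewrite /star_comb fct_sum hdot_suml; apply: eq_bigr => t _.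
by rewrite scalrfctE !hdotZl /star_words /= hdot_adjoint//; exact: bounded_word.
Qed.

Lemma bounded_star_words (K : hilbertType R) (S : 'I_n -> K -> K) a b :
  bounded_tuple S -> bounded_op (star_words S a b).
Proof.
move=> Sb; apply: bounded_comp; first exact: bounded_word.
by apply: bounded_adjoint; exact: bounded_word.
Qed.

Lemma bounded_star_comb (K : hilbertType R) (S : 'I_n -> K -> K) s :
  bounded_tuple S -> bounded_op (star_comb S s).
Proof.
by move=> Sb; apply: bounded_sum => t; apply: boundedZ; exact: bounded_star_words.
Qed.

(** In 2 Re <u, w> = |u|^2 + |w|^2 - |u - w|^2 the map loses at most e in each of
    the first two terms and does not increase |u - w|. *)
Lemma polarization_defect m (V : 'I_m -> H -> N) u w (e : R) :
  (forall k, linear (V k)) ->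
  (forall u, \sum_k hnorm (V k u) ^+ 2 <= hnorm u ^+ 2) ->
  hnorm u ^+ 2 - e <= \sum_k hnorm (V k u) ^+ 2 ->
  hnorm w ^+ 2 - e <= \sum_k hnorm (V k w) ^+ 2 ->
  complex.Re (hdot u w) <= \sum_k complex.Re (hdot (V k u) (V k w)) + e.
Proof.
move=> Vl Vc ue we; have := Vc (u - w).
have -> : \sum_k hnorm (V k (u - w)) ^+ 2 = \sum_k hnorm (V k u) ^+ 2 +
    \sum_k hnorm (V k w) ^+ 2 - 2 * \sum_k complex.Re (hdot (V k u) (V k w)).
  rewrite mulr_sumr -sumrN -!big_split /=; apply: eq_bigr => k _.
  rewrite (linfB (Vl k)) hnorm_add_sqr hnorm_opp hdotNr.
  by rewrite [complex.Re (- _)]raddfN mulrN.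
rewrite hnorm_add_sqr hnorm_opp hdotNr [complex.Re (- _)]raddfN /=; lra.
Qed.

(** Moved to the other side of the inner product, the words turn T_a T_b^* into an
    inner product of two vectors from the finite set on which V is almost
    isometric; as V intertwines the adjoints, this is up to e the same expression
    in B at the vectors V_k x and V_k y, where the bound is known. *)
Lemma star_comb_form_bound m (s : 'I_m -> 'I_m -> seq (R[i] * (word n * word n)))
    (c : R) : approx_dilation -> 0 <= c ->
  form_bound c (fun i j => star_comb B (s i j)) ->
  form_bound c (fun i j => star_comb T (s i j)).
Proof.
move=> dil c0 Bc x y.
pose u j (t : R[i] * (word n * word n)) := t.1 *: adjoint (op_word T t.2.2) (x j).
pose w i (t : R[i] * (word n * word n)) := adjoint (op_word T t.2.1) (y i).
pose K : R := \sum_(i < m) \sum_(j < m) (size (s i j))%:R.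
have K0 : 0 <= K by apply: sumr_ge0 => i _; apply: sumr_ge0.
apply/ler_addgt0Pl => e e0.
have K1 : 0 < K + 1 by rewrite ltr_wpDl.
have d0 : 0 < e / (K + 1) by rewrite divr_gt0.
pose us := [seq u p.2 t | p <- enum {: 'I_m * 'I_m}, t <- s p.1 p.2] ++
  [seq w p.1 t | p <- enum {: 'I_m * 'I_m}, t <- s p.1 p.2].
have [p [V [Vl Va Vc Vu]]] := dil us _ d0.
have adjV k a h : adjoint (op_word B a) (V k h) = V k (adjoint (op_word T a) h).
  apply: hdot_ext => z; rewrite -hdot_adjoint ?Va//; exact: bounded_word.
have h1 i j : complex.Re (hdot (star_comb T (s i j) (x j)) (y i)) <=
    \sum_k complex.Re (hdot (star_comb B (s i j) (V k (x j))) (V k (y i))) +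
    (e / (K + 1)) * (size (s i j))%:R.
  rewrite hdot_star_comb// raddf_sum /=.
  have -> : \sum_k complex.Re (hdot (star_comb B (s i j) (V k (x j))) (V k (y i))) =
      \sum_(t <- s i j) \sum_k complex.Re (hdot (V k (u j t)) (V k (w i t))).
    rewrite exchange_big; apply: eq_bigr => k _ /=.
    rewrite hdot_star_comb// raddf_sum /=; apply: eq_bigr => t _.
    by rewrite !adjV /u (linfZ (Vl k)).
  have -> : (e / (K + 1)) * (size (s i j))%:R = \sum_(t <- s i j) (e / (K + 1)).
    by rewrite big_const_seq count_predT iter_addr_0 mulr_natr.
  rewrite -big_split /= big_seq [leRHS]big_seq; apply: ler_sum => t ts.
  apply: polarization_defect => //; apply: Vu; rewrite mem_cat; apply/orP.
    by left; apply/allpairsPdep; exists (i, j), t; rewrite mem_enum.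
  by right; apply/allpairsPdep; exists (i, j), t; rewrite mem_enum.
have h2 : \sum_i \sum_j \sum_k
    complex.Re (hdot (star_comb B (s i j) (V k (x j))) (V k (y i))) <=
    c / 2 * (\sum_j hnorm (x j) ^+ 2 + \sum_i hnorm (y i) ^+ 2).
  have -> : \sum_i \sum_j \sum_k
      complex.Re (hdot (star_comb B (s i j) (V k (x j))) (V k (y i))) =
      \sum_k \sum_i \sum_j complex.Re (hdot (star_comb B (s i j) (V k (x j))) (V k (y i))).
    by under eq_bigr do rewrite exchange_big /=; rewrite exchange_big.
  apply: (@le_trans _ _ (\sum_k (c / 2 * (\sum_j hnorm (V k (x j)) ^+ 2 +
      \sum_i hnorm (V k (y i)) ^+ 2)))).
    by apply: ler_sum => k _; exact: (Bc (fun j => V k (x j)) (fun i => V k (y i))).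
  rewrite -mulr_sumr ler_wpM2l ?divr_ge0// big_split /=.
  rewrite exchange_big [X in _ + X]exchange_big /=.
  by rewrite lerD//; apply: ler_sum => i _; exact: Vc.
apply: (@le_trans _ _ (\sum_i \sum_j (\sum_k complex.Re (hdot (star_comb B (s i j) (V k (x j))) (V k (y i))) +
    (e / (K + 1)) * (size (s i j))%:R))).
  by apply: ler_sum => i _; apply: ler_sum => j _; exact: h1.
under eq_bigr do rewrite big_split /=.
rewrite big_split /= addrC lerD//.
under eq_bigr do rewrite -mulr_sumr.
rewrite -mulr_sumr -/K mulrAC ler_pdivrMr// ler_wpM2l ?(ltW e0)// lerDl//.
Qed.

End ApproxDilation.

(** * The Poisson kernel of a strict row contraction *)

Section Words.
Variables (V : nmodType) (n : nat).

Lemma degree_sumSr k (F : word n -> V) :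
  degree_sum k.+1 F = degree_sum k (fun a => \sum_i F (rcons a i)).
Proof.
elim: k F => [|k IH] F.
  by rewrite degree_sumS degree_sum0; apply: eq_bigr => i _; rewrite degree_sum0.
by rewrite degree_sumS [RHS]degree_sumS; apply: eq_bigr => i _; rewrite IH.
Qed.

Lemma exchange_wsum m N (F : 'I_m -> word n -> V) :
  \sum_k wsum N (F k) = wsum N (fun a => \sum_k F k a).
Proof.
by rewrite /wsum exchange_big /=; apply: eq_bigr => j _; rewrite exchange_big.
Qed.

Definition words_lt N : seq (word n) :=
  flatten [seq [seq val a | a <- enum {: k.-tuple 'I_n}] | k <- iota 0 N].

Lemma mem_words_lt N a : (size a < N)%N -> a \in words_lt N.
Proof.
move=> aN; apply/flatten_mapP; exists (size a); first by rewrite mem_iota.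
by apply/mapP; exists (in_tuple a); rewrite ?mem_enum.
Qed.

End Words.

Section PoissonDilation.
Variables (R : realType) (n : nat) (H : hilbertType R) (Y : 'I_n -> H -> H).
Variable rho : R.
Hypotheses (Yb : bounded_tuple Y) (rho01 : 0 <= rho < 1) (Yr : row_bound rho Y).

Let rho0 : 0 <= rho. Proof. by case/andP: rho01. Qed.
Let rho2 : rho ^+ 2 < 1. Proof. by rewrite expr_lt1//; case/andP: rho01. Qed.

(** The form of the defect operator 1 - sum_i Y_i Y_i^*. *)
Definition defect_op (b : H) : H := b - \sum_i Y i (adjoint (Y i) b).

Definition defect (u w : H) : R[i] := hdot u (defect_op w).

Lemma defectE u w :
  defect u w = hdot u w - \sum_i hdot (adjoint (Y i) u) (adjoint (Y i) w).
Proof.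
rewrite /defect hdotBr hdot_sumr; congr (_ - _); apply: eq_bigr => i _.
by rewrite adjoint_hdot.
Qed.

Lemma defect_lin k x y z : defect (k *: x + y) z = k * defect x z + defect y z.
Proof. by rewrite /defect hdotDl hdotZl. Qed.

Lemma defectC x y : defect x y = (defect y x)^*.
Proof.
rewrite !defectE rmorphB rmorph_sum /= -hdotC; congr (_ - _).
by apply: eq_bigr => i _; rewrite -hdotC.
Qed.

Lemma Re_defect x : complex.Re (defect x x) =
  hnorm x ^+ 2 - \sum_i hnorm (adjoint (Y i) x) ^+ 2.
Proof.
rewrite defectE raddfB raddf_sum /= -hnorm_sqr; congr (_ - _).
by apply: eq_bigr => i _; rewrite hnorm_sqr.
Qed.

Lemma defect_pos x : x != 0 -> 0 < complex.Re (defect x x).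
Proof.
move=> x0; rewrite Re_defect subr_gt0.
apply: le_lt_trans (row_bound_adjoint Yb rho0 Yr x) _.
rewrite gtr_pMl// exprn_even_gt0//=; apply: contra x0 => /eqP /hnorm_eq0 ->.
exact: eqxx.
Qed.

Lemma adjoint_word_rcons a i h : adjoint (op_word Y (rcons a i)) h =
  adjoint (Y i) (adjoint (op_word Y a) h).
Proof.
elim: a h => [|j a IH] h; last by rewrite rcons_cons !(adjoint_word_cons Yb) IH.
rewrite -[rcons [::] i]/[:: i] (adjoint_word_cons Yb).
by rewrite !(@adjoint_unique _ _ _ (op_word Y [::]) idfun)//; exact: bounded_id.
Qed.

(** The sum telescopes. *)
Lemma wsum_defect N h :
  wsum N (fun a => complex.Re (defect (adjoint (op_word Y a) h) (adjoint (op_word Y a) h))) =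
  hnorm h ^+ 2 - degree_sum N (fun a => hnorm (adjoint (op_word Y a) h) ^+ 2).
Proof.
elim: N => [|N IH].
  rewrite wsum0 degree_sum0 (@adjoint_unique _ _ _ _ idfun) ?subrr//.
  exact: bounded_id.
rewrite wsumSr IH degree_sumSr -addrA; congr (_ + _).
rewrite (@eq_degree_sum _ _ N (fun a => complex.Re _) (fun a =>
   hnorm (adjoint (op_word Y a) h) ^+ 2 -
   \sum_i hnorm (adjoint (op_word Y (rcons a i)) h) ^+ 2)) => [|a _].
  by rewrite /degree_sum sumrB addrA addNr add0r.
rewrite Re_defect; congr (_ - _); apply: eq_bigr => i _; congr (hnorm _ ^+ 2).
by rewrite adjoint_word_rcons.
Qed.

Local Notation pv := (pvec Yb rho01 Yr).

Lemma sqn_pvec h b w :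
  sqn (pv h (defect_op b) w) = cabs (defect (adjoint (op_word Y w) h) b) ^+ 2.
Proof.
by rewrite sqnE /= /defect adjoint_hdot//; exact: bounded_word.
Qed.

(** Bessel's inequality for the defect form, word by word. *)
Lemma pvec_partial_le m (b : 'I_m -> H) h N : form_orthonormal defect b ->
  \sum_k wsum N (fun w => sqn (pv h (defect_op (b k)) w)) <= hnorm h ^+ 2.
Proof.
move=> bo; rewrite exchange_wsum.
apply: (@le_trans _ _ (wsum N (fun a => complex.Re (defect (adjoint (op_word Y a) h)
    (adjoint (op_word Y a) h))))).
  apply: ler_wsum => a; under eq_bigr do rewrite sqn_pvec.
  exact: (bessel defect_lin defectC defect_pos).
rewrite wsum_defect lerBlDr lerDl; apply: sumr_ge0 => a _; exact: sqr_ge0.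
Qed.

Lemma pvec_norm_cvg h b :
  wsum N (fun w => sqn (pv h b w)) @[N --> \oo] --> hnorm (pv h b) ^+ 2.
Proof. rewrite hnorm_l2; exact/asboolP/l2valP. Qed.

Lemma pvec_norm_le m (b : 'I_m -> H) h : form_orthonormal defect b ->
  \sum_k hnorm (pv h (defect_op (b k))) ^+ 2 <= hnorm h ^+ 2.
Proof.
move=> bo.
have cv : (\sum_k wsum N (fun w => sqn (pv h (defect_op (b k)) w))) @[N --> \oo] -->
    \sum_k hnorm (pv h (defect_op (b k))) ^+ 2.
  by apply: cvg_finsum => k; exact: pvec_norm_cvg.
rewrite -(cvg_lim _ cv)//; apply: limr_le.
  by apply/cvg_ex; eexists; exact: cv.
by apply: nearW => N; exact: pvec_partial_le.
Qed.

(** If the family exhausts the words of length smaller than L applied to h, then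
    Bessel's inequality is an equality for these words, and the other words
    contribute at most the geometric remainder. *)
Lemma pvec_norm_ge m (b : 'I_m -> H) h L : form_orthonormal defect b ->
  (forall w, (size w < L)%N -> residual defect b (adjoint (op_word Y w) h) = 0) ->
  hnorm h ^+ 2 - (rho ^+ 2) ^+ L * hnorm h ^+ 2 <=
  \sum_k hnorm (pv h (defect_op (b k))) ^+ 2.
Proof.
move=> bo br.
apply: (@le_trans _ _ (\sum_k wsum L (fun w => sqn (pv h (defect_op (b k)) w)))); last first.
  apply: ler_sum => k _; rewrite hnorm_l2; exact: wsum_le_l2sqn.
have -> : \sum_k wsum L (fun w => sqn (pv h (defect_op (b k)) w)) =
    wsum L (fun a => complex.Re (defect (adjoint (op_word Y a) h) (adjoint (op_word Y a) h))).
  rewrite exchange_wsum; apply: eq_wsum_lt => w wL; rewrite (form_pythagoras defect_lin defectC _ bo) br//.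
  rewrite (sform_0l defect_lin) addr0; apply: eq_bigr => k _; exact: sqn_pvec.
by rewrite wsum_defect lerD2l lerN2 (adjoint_degree_bound Yb rho01 Yr).
Qed.

Local Notation fock := (l2 R n).
Variables (f : 'I_n -> ncseries R n) (M : 'I_n -> fock -> fock) (P : set (ncseries R n)).
Local Notation W := (eval_tuple f M).
Variables (g : 'I_n -> ncseries R n) (T : 'I_n -> H -> H).
Hypothesis Mb : bounded_tuple M.
Hypothesis Me : forall i a w, l2val (M i (fbasis R a)) w = series_mul (g i) (mono R a) w.
Hypothesis Wb : bounded_tuple W.
Hypothesis We : forall i a, W i (fbasis R a) = fbasis R (i :: a).
Hypothesis Wh : forall i, hardy_algebra M (W i).
Hypothesis gT : forall i, geom_sum (g i) Y (T i).
Hypothesis PY : forall q, P q -> exists2 N, degree_lt N q & forall x, peval Y N q x = 0.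

Local Notation vv := (vvec Yb rho01 Yr Mb Me Wb We Wh gT PY).

Lemma model_word_vvec a (x : variety_space f M P) h b :
  hdot (op_word (variety_model f M P) a x) (vv h b) =
  hdot x (vv (adjoint (op_word T a) h) b).
Proof.
have Tb : bounded_tuple T by move=> i; case: (gT i).
elim: a h => [|i a IH] h.
  by rewrite (@adjoint_unique _ _ _ (op_word T [::]) idfun)//; exact: bounded_id.
rewrite (adjoint_word_cons Tb) -(IH (adjoint (T i) h)).
set x' := op_word _ a x.
rewrite -[LHS]/(hdot (compression (M i) x') (vv h b)) hdot_compression.
exact: (multiplier_pvec Yb rho01 Yr Mb Me gT).
Qed.

(** The maps are the components of the Poisson kernel along an orthonormal family
    for the defect form, chosen by Gram-Schmidt to exhaust the given vectors
    up to a degree L where the remainder is small. *)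
Lemma poisson_dilation : approx_dilation (variety_model f M P) T.
Proof.
move=> us e e0.
have [L LP] : exists L, forall u, u \in us -> (rho ^+ 2) ^+ L * hnorm u ^+ 2 <= e.
  pose S : R := \sum_(u <- us) hnorm u ^+ 2 + 1.
  have S1 : 0 < S by rewrite ltr_wpDl// sumr_ge0// => u _; exact: sqr_ge0.
  have r01 : 0 <= rho ^+ 2 < 1 by rewrite sqr_ge0.
  have [L LP] := geometric_small r01 (divr_gt0 e0 S1); exists L => u uus.
  have := LP L (leqnn L); rewrite ler_pdivlMr// => h; apply: le_trans h.
  rewrite ler_wpM2l ?exprn_ge0 ?sqr_ge0// /S (big_rem u)//= -addrA lerDl addr_ge0//.
  by apply: sumr_ge0 => w _; exact: sqr_ge0.
pose vs := [seq adjoint (op_word Y w) u | u <- us, w <- words_lt n L].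
have [m [b [bo bv]]] := gram_schmidt defect_lin defectC defect_pos vs.
exists m, (fun k h => vv h (defect_op (b k))); split.
- by move=> k l h h'; exact: vvec_lin.
- by move=> k a x h; exact: model_word_vvec.
- by move=> u; exact: pvec_norm_le.
move=> u uus; apply: le_trans (_ : hnorm u ^+ 2 - (rho ^+ 2) ^+ L * hnorm u ^+ 2 <= _).
  by rewrite lerD2l lerN2 LP.
apply: pvec_norm_ge => // w wL; apply: bv; apply/allpairsP.
by exists (u, w); split=> //; exact: mem_words_lt.
Qed.

End PoissonDilation.

(** * Row contractions, and extension to the closed span *)

Section AdjointConvergence.
Variables (R : realType) (n : nat) (H : hilbertType R).
Variables (S : nat -> 'I_n -> H -> H) (T : 'I_n -> H -> H).
Hypotheses (Sb : forall k, bounded_tuple (S k)) (Tb : bounded_tuple T).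
Variable eps : nat -> R.
Hypothesis eps_cvg : eps k @[k --> \oo] --> (0 : R).
Hypothesis ST : forall k i x, hnorm (T i x - S k i x) <= eps k * hnorm x.

Lemma adjoint_difference k i x :
  hnorm (adjoint (T i) x - adjoint (S k i) x) <= eps k * hnorm x.
Proof.
set z := _ - _; have [->|z0] := eqVneq z 0.
  by rewrite hnorm0 (le_trans (hnorm_ge0 _) (ST k i x)).
have zp : 0 < hnorm z.
  by rewrite lt_neqAle hnorm_ge0 andbT eq_sym; apply: contra z0 => /eqP /hnorm_eq0 ->.
rewrite -(ler_pM2l zp) -expr2 hnorm_sqr {2}/z hdotBr -(hdot_adjoint _ _ (Tb i)) -(hdot_adjoint _ _ (Sb k i)) -hdotBl.
rewrite (le_trans (Re_hdot_hnorm _ _))// mulrCA mulrA ler_wpM2r ?hnorm_ge0//.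
Qed.

Lemma adjoint_cvg i (x : nat -> H) (l : H) : x k @[k --> \oo] --> l ->
  adjoint (S k i) (x k) @[k --> \oo] --> adjoint (T i) l.
Proof.
move=> xl; have Ta := bounded_adjoint (Tb i).
have -> : (fun k => adjoint (S k i) (x k)) =
    (fun k => adjoint (T i) (x k) - (adjoint (T i) (x k) - adjoint (S k i) (x k))).
  by apply/funext => k; rewrite opprB addrC subrK.
rewrite -[X in _ --> X]subr0; apply: cvgB; first exact: bounded_cvg.
apply/hcvgP => e e0; move/hcvgP : (xl) => /(_ 1 ltr01) x1.
have d0 : 0 < e / (hnorm l + 1 + 1).
  by rewrite divr_gt0// ltr_wpDl// addr_ge0// hnorm_ge0.
move/cvgrPdist_le : eps_cvg => /(_ _ d0); apply: filterS2 x1 => k xk.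
rewrite sub0r normrN subr0 => ek; apply: (le_trans (adjoint_difference k i (x k))).
have hx : hnorm (x k) <= hnorm l + 1.
  by rewrite -[x k](subrK l) (le_trans (hnorm_triangle _ _))// addrC lerD2l.
have hl := hnorm_ge0 l.
apply: (@le_trans _ _ (e / (hnorm l + 1 + 1) * (hnorm l + 1))).
  apply: (@le_trans _ _ (`|eps k| * hnorm (x k))).
    by rewrite ler_wpM2r ?hnorm_ge0// ler_norm.
  by rewrite ler_pM ?hnorm_ge0.
by rewrite mulrAC ler_pdivrMr ?ltr_wpDl ?addr_ge0// ler_wpM2l ?(ltW e0)// lerDl.
Qed.

Lemma adjoint_word_cvg a (x : nat -> H) (l : H) : x k @[k --> \oo] --> l ->
  adjoint (op_word (S k) a) (x k) @[k --> \oo] --> adjoint (op_word T a) l.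
Proof.
elim: a x l => [|i a IH] x l xl.
  have E (Z : 'I_n -> H -> H) y : adjoint (op_word Z [::]) y = y.
    by rewrite (@adjoint_unique _ _ _ (op_word Z [::]) idfun)//; exact: bounded_id.
  by rewrite E; under eq_fun do rewrite E.
rewrite (adjoint_word_cons Tb).
have -> : (fun k => adjoint (op_word (S k) (i :: a)) (x k)) =
    (fun k => adjoint (op_word (S k) a) (adjoint (S k i) (x k))).
  by apply/funext => k; rewrite (adjoint_word_cons (Sb k)).
by apply: IH; exact: adjoint_cvg.
Qed.

Lemma Re_star_comb_cvg s x y :
  complex.Re (hdot (star_comb (S k) s x) y) @[k --> \oo] -->
  complex.Re (hdot (star_comb T s x) y).
Proof.
rewrite hdot_star_comb//.
have -> : (fun k => complex.Re (hdot (star_comb (S k) s x) y)) = (fun k =>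
    \sum_(t <- s) complex.Re (hdot (t.1 *: adjoint (op_word (S k) t.2.2) x)
                     (adjoint (op_word (S k) t.2.1) y))).
  by apply/funext => k; rewrite hdot_star_comb// raddf_sum.
rewrite raddf_sum; apply: cvg_finsum => t /=; apply/cvgrPdist_le => e e0.
have h1 : (t.1 *: adjoint (op_word (S k) t.2.2) x) @[k --> \oo] -->
    t.1 *: adjoint (op_word T t.2.2) x.
  by apply: cvgZr; apply: adjoint_word_cvg; exact: cvg_cst.
have h2 : adjoint (op_word (S k) t.2.1) y @[k --> \oo] --> adjoint (op_word T t.2.1) y.
  by apply: adjoint_word_cvg; exact: cvg_cst.
have [N _ NP] := hdot_cvg h1 h2 e0; exists N => // k Nk.
apply: le_trans (NP k Nk); rewrite distrC -raddfB.
set z := _ - _; have := normc_ge_Re z; rewrite cabsE lecR //.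
Qed.

End AdjointConvergence.

Section RowContractions.
Variables (R : realType) (n : nat) (H : hilbertType R) (Y : 'I_n -> H -> H).
Hypotheses (Yb : bounded_tuple Y) (Yr : row_bound 1 Y).
Local Notation fock := (l2 R n).
Variables (f : 'I_n -> ncseries R n) (M : 'I_n -> fock -> fock) (P : set (ncseries R n)).
Local Notation W := (eval_tuple f M).
Variables (g : 'I_n -> ncseries R n) (T : 'I_n -> H -> H).
Hypothesis Mb : bounded_tuple M.
Hypothesis Me : forall i a w, l2val (M i (fbasis R a)) w = series_mul (g i) (mono R a) w.
Hypothesis Wb : bounded_tuple W.
Hypothesis We : forall i a, W i (fbasis R a) = fbasis R (i :: a).
Hypothesis Wh : forall i, hardy_algebra M (W i).
Hypothesis gT : forall i, geom_sum (g i) Y (T i).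
Variable s : R.
Hypothesis s01 : 0 <= s < 1.
Hypothesis gs : forall i, growth s (g i).
Hypothesis P_hom : forall q, P q -> homogeneous q.
Hypothesis PY : forall q, P q -> exists2 N, degree_lt N q & forall x, peval Y N q x = 0.

Let r k : R := 1 - k.+1%:R^-1.

Let r01 k : 0 <= r k < 1.
Proof.
rewrite /r subr_ge0 ltrBlDr ltrDl invr_gt0 ltr0n andbT.
by rewrite invf_le1 ?ltr0n// ler1n.
Qed.

Lemma scaled_annihilated k q : P q ->
  exists2 N, degree_lt N q & forall x, peval (scale_tuple (r k) Y) N q x = 0.
Proof.
move=> Pq; have [N qN q0] := PY Pq; exists N => // x.
have [d qd] := P_hom Pq; rewrite peval_scale//.
have -> : dilate (r k) q = ((r k)%:C)%C ^+ d *: q + 0.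
  apply/funext => a; rewrite addr0 /dilate scalrfctE.
  by have [<-//|ad] := eqVneq (size a) d; rewrite qd// mulr0 scaler0.
by rewrite peval_lin q0 scaler0 add0r /peval wsum_eq0// => a _; rewrite scale0r.
Qed.

(** The estimate for strict row contractions holds for each r Y with r < 1;
    it passes to the limit because g(rY) tends to g(Y) in norm. *)
Lemma row_contraction_form_bound m (c : R)
    (t : 'I_m -> 'I_m -> seq (R[i] * (word n * word n))) : 0 <= c ->
  form_bound c (fun i j => star_comb (variety_model f M P) (t i j)) ->
  form_bound c (fun i j => star_comb T (t i j)).
Proof.
move=> c0 Bc; have /andP[s0 s1] := s01.
have Ykb k : bounded_tuple (scale_tuple (r k) Y) by exact: bounded_scale_tuple.
have Ykr k : row_bound (r k) (scale_tuple (r k) Y).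
  by have := @row_bound_scale _ _ _ 1 (r k) Y Yb Yr; rewrite mulr1.
have exS k : exists Sk, forall i, geom_sum (g i) (scale_tuple (r k) Y) (Sk i).
  have ex i : exists A, geom_sum (g i) (scale_tuple (r k) Y) A.
    have /andP[rk0 rk1] := r01 k.
    apply: growth_geom_sum (Ykr k) (gs i) => //.
    by rewrite (le_lt_trans _ s1)// ler_piMl// ltW.
  by have [Sk SkP] := choice ex; exists Sk.
have [S SP] := choice exS.
have Sb k : bounded_tuple (S k) by move=> i; case: (SP k i).
have Tb : bounded_tuple T by move=> i; case: (gT i).
have Sform k : form_bound c (fun i j => star_comb (S k) (t i j)).
  apply: (star_comb_form_bound _ (Sb k) _ c0 Bc).
    by move=> i; exact: bounded_compression.
  exact: (poisson_dilation (Ykb k) (r01 k) (Ykr k) Mb Me Wb We Wh (SP k)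
    (scaled_annihilated k)).
have ext i : exists d, 0 <= d /\ tame d (1 * s) (g i) Y.
  by have [d d0 td] := growth_tame Yb ler01 s0 Yr (gs i); exists d.
have [d dP] := choice ext.
pose D : R := \sum_i d i.
have D0 : 0 <= D by apply: sumr_ge0 => i _; case: (dP i).
pose eps k := D / (1 - s) ^+ 2 * k.+1%:R^-1.
have s10 : 0 < (1 - s) ^+ 2 by rewrite exprn_gt0// subr_gt0.
have ST k i x : hnorm (T i x - S k i x) <= eps k * hnorm x.
  have [di ti] := dP i; rewrite mul1r in ti; have /andP[rk0 rk1] := r01 k.
  have rk01 : 0 <= r k <= 1 by rewrite rk0 ltW.
  have h := geom_sum_dilate_le Yb di s01 ti rk01 (gT i)
    (geom_sum_cvg (x := x) (SP k i)).
  apply: (le_trans h).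
  have -> : 1 - r k = k.+1%:R^-1 by rewrite /r opprB addrC subrK.
  have dD : d i <= D.
    by rewrite /D (bigD1 i)//= lerDl; apply: sumr_ge0 => j _; case: (dP j).
  rewrite /eps; have -> : d i * k.+1%:R^-1 * hnorm x / (1 - s) ^+ 2 =
    d i / (1 - s) ^+ 2 * k.+1%:R^-1 * hnorm x by ring.
  rewrite ler_wpM2r ?hnorm_ge0// ler_wpM2r ?invr_ge0 ?ler0n//.
  by rewrite ler_wpM2r ?invr_ge0 ?(ltW s10).
have eps0 : eps k @[k --> \oo] --> (0 : R).
  rewrite -[X in _ --> X](mulr0 (D / (1 - s) ^+ 2)).
  apply: cvgM; first exact: cvg_cst.
  exact: cvg_harmonic.
move=> x y.
have cv : (\sum_i \sum_j complex.Re (hdot (star_comb (S k) (t i j) (x j)) (y i)))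
    @[k --> \oo] -->
    \sum_i \sum_j complex.Re (hdot (star_comb T (t i j) (x j)) (y i)).
  apply: cvg_finsum => i; apply: cvg_finsum => j.
  exact: (Re_star_comb_cvg Sb Tb eps0 ST).
rewrite -(cvg_lim _ cv)//; apply: limr_le.
  by apply/cvg_ex; eexists; exact: cv.
by apply: nearW => k; exact: Sform.
Qed.

End RowContractions.

Section Extension.
Variables (R : realType) (n : nat) (N H : hilbertType R).
Variables (B : 'I_n -> N -> N) (T : 'I_n -> H -> H).
Hypotheses (Bb : bounded_tuple B) (Tb : bounded_tuple T).
Hypothesis BT : forall m (c : R) (t : 'I_m -> 'I_m -> seq (R[i] * (word n * word n))),
  0 <= c -> form_bound c (fun i j => star_comb B (t i j)) ->
  form_bound c (fun i j => star_comb T (t i j)).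

Lemma star_comb_cat (K : hilbertType R) (S : 'I_n -> K -> K) k s t x :
  star_comb S ([seq (k * u.1, u.2) | u <- s] ++ t) x =
  k *: star_comb S s x + star_comb S t x.
Proof.
rewrite /star_comb big_cat /= addrfctE; congr (_ + _).
rewrite big_map !fct_sum scaler_sumr; apply: eq_bigr => u _.
by rewrite !scalrfctE scalerA.
Qed.

Lemma form_bound1 (K : hilbertType R) (c : R) (A : K -> K) : 0 < c ->
  form_bound c (fun _ _ : 'I_1 => A) <-> bound_by c A.
Proof.
move=> c0; split=> [Ac x|Ac].
  have := form_bound_norm c0 Ac (fun=> x); rewrite !big_ord1 -exprMn => h.
  by rewrite -(@ler_pXn2r _ 2) ?nnegrE ?mulr_ge0 ?hnorm_ge0// ltW.
apply: norm_form_bound => // x; rewrite !big_ord1 -exprMn.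
by rewrite lerXn2r ?nnegrE ?mulr_ge0 ?hnorm_ge0// ltW.
Qed.

(** A difference of two combinations is a combination, so the hypothesis with m = 1
    makes the correspondence well defined and continuous. *)
Lemma star_comb_diff_bound s t (c : R) : 0 < c ->
  bound_by c (fun x => star_comb B s x - star_comb B t x) ->
  bound_by c (fun x => star_comb T s x - star_comb T t x).
Proof.
move=> c0; pose u := [seq (-1 * v.1, v.2) | v <- t] ++ s.
have uE (K : hilbertType R) (S : 'I_n -> K -> K) x :
    star_comb S u x = star_comb S s x - star_comb S t x.
  by rewrite star_comb_cat scaleN1r addrC.
move=> Bc; have : bound_by c (star_comb B u) by move=> x; rewrite uE; exact: Bc.
move=> /(form_bound1 _ c0) h.
have /(form_bound1 _ c0) h' := @BT 1 c (fun _ _ => u) (ltW c0) h.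
by move=> x; rewrite -uE; exact: h'.
Qed.

(** The graph of the map to be constructed: the combinations of words that
    approximate A in B also approximate L in T. *)
Definition star_image (A : N -> N) (L : H -> H) : Prop := bounded_op L /\
  forall e : R, 0 < e -> exists s,
    bound_by e (fun x => A x - star_comb B s x) /\
    bound_by e (fun x => L x - star_comb T s x).

Lemma bound_by_sub (K : hilbertType R) (c d : R) (A D E : K -> K) :
  bound_by c (fun x => A x - D x) -> bound_by d (fun x => A x - E x) ->
  bound_by (c + d) (fun x => D x - E x).
Proof.
move=> h1 h2 x; rewrite -(subrKA (A x)) (le_trans (hnorm_triangle _ _))// mulrDl.
by rewrite lerD// hnorm_subC; exact: h1.
Qed.

Lemma bound_by_add (K : hilbertType R) (c d : R) (A D E : K -> K) :
  bound_by c (fun x => A x - D x) -> bound_by d (fun x => D x - E x) ->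
  bound_by (c + d) (fun x => A x - E x).
Proof.
move=> h1 h2 x; rewrite -(subrKA (D x)) (le_trans (hnorm_triangle _ _))// mulrDl.
by rewrite lerD.
Qed.

Lemma star_image_unique A L L' : star_image A L -> star_image A L' -> L = L'.
Proof.
move=> [_ h] [_ h']; apply/funext => x; apply/eqP; rewrite -subr_eq0; apply/eqP/hnorm_eq0.
apply/eqP; rewrite eq_le hnorm_ge0 andbT; apply/ler_addgt0Pl => e e0; rewrite addr0.
pose d := e / 4 / (hnorm x + 1).
have x1 : 0 < hnorm x + 1 by rewrite ltr_wpDl// hnorm_ge0.
have d0 : 0 < d by rewrite !divr_gt0.
have [s [As Ls]] := h d d0; have [s' [As' Ls']] := h' d d0.
have Ts : bound_by (d + d) (fun x => star_comb T s x - star_comb T s' x).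
  by apply: star_comb_diff_bound; [rewrite addr_gt0|exact: bound_by_sub As As'].
have L1 := bound_by_add Ls Ts.
have := hnorm_triangle (L x - star_comb T s' x) (star_comb T s' x - L' x).
have := L1 x; have := Ls' x; rewrite [hnorm (star_comb T s' x - _)]hnorm_subC subrKA.
have : d * hnorm x <= e / 4.
  rewrite /d mulrAC ler_pdivrMr// ler_wpM2l ?lerDl// divr_ge0// ltW//.
rewrite !mulrDl; lra.
Qed.

Lemma star_spanP A : star_span B A <-> bounded_op A /\
  forall e : R, 0 < e -> exists s, bound_by e (fun x => A x - star_comb B s x).
Proof.
have subb s : bounded_op A -> bounded_op (A - star_comb B s)%R.
  move=> Ab; rewrite -scaleN1r addrC; apply: bounded_lin => //.
  exact: bounded_star_comb.
split=> -[Ab h]; split=> // e e0.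
  have [_ [s ->] /ltW hs] := h e e0; exists s.
  have [Al _] := subb s Ab.
  by have /(opnorm_leP Al (ltW e0)) := hs.
have e2 : 0 < e / 2 by rewrite divr_gt0.
have [s hs] := h _ e2; exists (star_comb B s); first by exists s.
have [Al _] := subb s Ab.
apply: (@le_lt_trans _ _ (e / 2)%:E); first exact/(opnorm_leP Al (ltW e2)).
by rewrite lte_fin ltr_pdivrMr// mulr_natr mulr2n ltrDl.
Qed.

Lemma star_image_exists A : star_span B A -> exists L, star_image A L.
Proof.
move=> /star_spanP[Ab h].
have d0 k : 0 < (k.+1%:R^-1 : R) by rewrite invr_gt0 ltr0n.
have [s sP] := choice (fun k => h _ (d0 k)).
have Tjk j k : bound_by (j.+1%:R^-1 + k.+1%:R^-1)
    (fun x => star_comb T (s j) x - star_comb T (s k) x).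
  by apply: star_comb_diff_bound; [rewrite addr_gt0|exact: bound_by_sub].
have small (e : R) : 0 < e -> exists K, forall k, (K <= k)%N -> (k.+1%:R^-1 : R) <= e.
  move=> e0; have [K KP] := @ltr_add_invr R 0 e e0; rewrite add0r in KP.
  exists K => k Kk; apply: le_trans (ltW KP); rewrite lef_pV2 ?posrE ?ltr0n//.
  by rewrite ler_nat.
have ex x : exists l : H, star_comb T (s k) x @[k --> \oo] --> l.
  apply: hcauchy => e e0; have x1 : 0 < hnorm x + 1 by rewrite ltr_wpDl// hnorm_ge0.
  have e1 : 0 < e / 2 / (hnorm x + 1) by rewrite !divr_gt0.
  have [K KP] := small _ e1; exists K => i j /KP hi /KP hj.
  apply: (le_trans (Tjk i j x)).
  apply: (@le_trans _ _ ((e / 2 / (hnorm x + 1) + e / 2 / (hnorm x + 1)) * hnorm x)).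
    by rewrite ler_wpM2r ?hnorm_ge0// lerD.
  have -> : (e / 2 / (hnorm x + 1) + e / 2 / (hnorm x + 1)) * hnorm x =
    e * hnorm x / (hnorm x + 1) by field; rewrite gt_eqF.
  by rewrite ler_pdivrMr// ler_wpM2l ?lerDl// ltW.
have [L LP] := choice ex.
have LT k : bound_by (2 * k.+1%:R^-1) (fun x => L x - star_comb T (s k) x).
  move=> x; apply/ler_addgt0Pl => e e0; have /hcvgP /(_ e e0)[K1 _ K1P] := LP x.
  have [K2 K2P] := small _ (d0 k).
  have h1 := K1P (maxn K1 K2) (leq_maxl _ _); have h2 := K2P (maxn K1 K2) (leq_maxr _ _).
  set j := maxn K1 K2 in h1 h2.
  rewrite -(subrKA (star_comb T (s j) x)) (le_trans (hnorm_triangle _ _))// lerD//.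
    by rewrite hnorm_subC.
  apply: (le_trans (Tjk j k x)); rewrite ler_wpM2r ?hnorm_ge0//.
  by rewrite mulr_natl mulr2n lerD2r.
exists L; split; last first.
  move=> e e0; have e2 : 0 < e / 2 by rewrite divr_gt0.
  have [K KP] := small _ e2; have hK := KP K (leqnn K); exists (s K); split=> x.
    by rewrite (le_trans (sP K x))// ler_wpM2r ?hnorm_ge0// (le_trans hK)//; lra.
  by rewrite (le_trans (LT K x))// ler_wpM2r ?hnorm_ge0// mulrC -ler_pdivlMr.
have Tl k : linear (star_comb T (s k)) by case: (bounded_star_comb (s k) Tb).
apply/bounded_opP; split.
  move=> k x y; apply: (@hcvg_unique _ _ _ \oo _ (fun j => star_comb T (s j) (k *: x + y))) => //.
  have -> : (fun j => star_comb T (s j) (k *: x + y)) =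
      (fun j => k *: star_comb T (s j) x + star_comb T (s j) y).
    by apply/funext => j; rewrite Tl.
  by apply: cvgD => //; apply: cvgZr.
have /bounded_opP[_ [c c0 cP]] := bounded_star_comb (s 0%N) Tb.
exists (2 * 1%:R^-1 + c) => [|x]; first by rewrite addr_ge0// mulr_ge0// invr_ge0.
rewrite -[L x](subrK (star_comb T (s 0%N) x)) (le_trans (hnorm_triangle _ _))//.
by rewrite mulrDl lerD//; exact: (LT 0%N x).
Qed.

Lemma star_image_lin k A A' L L' : star_image A L -> star_image A' L' ->
  star_image (k *: A + A')%R (k *: L + L')%R.
Proof.
move=> [Lb h] [Lb' h']; split; first exact: bounded_lin.
move=> e e0; have k1 : 0 < cabs k + 1 by rewrite ltr_wpDl// cabs_ge0.
pose d := e / 2 / (cabs k + 1).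
have d0 : 0 < d by rewrite !divr_gt0.
have e2 : 0 < e / 2 by rewrite divr_gt0.
have [s [As Ls]] := h d d0; have [s' [As' Ls']] := h' _ e2.
exists ([seq (k * u.1, u.2) | u <- s] ++ s').
have kd : cabs k * d <= e / 2.
  rewrite mulrC /d mulrAC ler_pdivrMr// ler_wpM2l ?lerDl// ltW//.
have gen (K : hilbertType R) (S : 'I_n -> K -> K) (A1 A2 : K -> K) :
    bound_by d (fun x => A1 x - star_comb S s x) ->
    bound_by (e / 2) (fun x => A2 x - star_comb S s' x) ->
    bound_by e (fun x => (k *: A1 + A2)%R x -
      star_comb S ([seq (k * u.1, u.2) | u <- s] ++ s') x).
  move=> h1 h2 x; rewrite star_comb_cat addrfctE scalrfctE opprD addrACA -scalerBr.
  rewrite (le_trans (hnorm_triangle _ _))// hnorm_scale (splitr e) mulrDl lerD//.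
  rewrite (le_trans (ler_wpM2l (cabs_ge0 k) (h1 x)))// mulrA.
  by rewrite ler_wpM2r ?hnorm_ge0.
by split; exact: gen.
Qed.

Lemma star_image_star_words a b : star_image (star_words B a b) (star_words T a b).
Proof.
have E (K : hilbertType R) (S : 'I_n -> K -> K) x :
    star_comb S [:: (1, (a, b))] x = star_words S a b x.
  by rewrite /star_comb big_seq1 scale1r.
split; first exact: bounded_star_words.
move=> e e0; exists [:: (1, (a, b))].
by split=> x; rewrite E subrr hnorm0 mulr_ge0 ?hnorm_ge0// ltW.
Qed.

(** Every entry is approximated within e, once on each side; each time this costs
    m e in the bound. *)
Lemma star_image_form_bound m (c : R) (A : 'I_m -> 'I_m -> N -> N)
    (L : 'I_m -> 'I_m -> H -> H) (e : R) : 0 < e -> 0 <= c ->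
  (forall i j, star_image (A i j) (L i j)) -> form_bound c A ->
  form_bound (c + m%:R * e + m%:R * e) L.
Proof.
move=> e0 c0 AL Ac.
have ex (p : 'I_m * 'I_m) := (AL p.1 p.2).2 e e0.
have [t tP] := choice ex.
apply: (@form_bound_perturb _ _ _ _ _ (fun i j => star_comb T (t (i, j)))).
- exact: ltW.
- apply: BT; first by rewrite addr_ge0// mulr_ge0// ltW.
  apply: (form_bound_perturb (ltW e0) Ac) => i j x; rewrite hnorm_subC.
  exact: ((tP (i, j)).1 x).
- by move=> i j x; exact: ((tP (i, j)).2 x).
Qed.

Theorem star_span_map : exists Psi : (N -> N) -> (H -> H),
    [/\ forall A, star_span B A -> bounded_op (Psi A),
        forall (k : R[i]) A A', star_span B A -> star_span B A' ->
          Psi (k *: A + A')%R = (k *: Psi A + Psi A')%R,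
        forall a b, Psi (star_words B a b) = star_words T a b &
        completely_contractive (star_span B) Psi].
Proof.
pose Psi A : H -> H := xget 0 [set L | star_image A L].
have PsiP A L : star_image A L -> Psi A = L.
  move=> AL; rewrite /Psi; case: xgetP => [L' _ /= AL'|/(_ L) []//].
  exact: star_image_unique AL' AL.
have PsiI A : star_span B A -> star_image A (Psi A).
  by move=> /star_image_exists[L AL]; rewrite (PsiP _ _ AL).
exists Psi; split.
- by move=> A /PsiI[].
- by move=> k A A' /PsiI h /PsiI h'; apply: PsiP; exact: star_image_lin.
- by move=> a b; apply: PsiP; exact: star_image_star_words.
move=> m A AS.
have Al i j : linear (A i j) by have /star_spanP[[]] := AS i j.
have Ll i j : linear (Psi (A i j)) by have [[]] := PsiI _ (AS i j).
have A0 : (0%:E <= mx_opnorm A)%E.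
  apply: ereal_sup_ubound; exists (fun=> 0) => /=.
    by rewrite big1 ?ler01// => j _; rewrite hnorm0 expr0n.
  rewrite big1 ?sqrtr0// => i _; rewrite big1 ?hnorm0 ?expr0n// => j _.
  exact: linf0.
case E : (mx_opnorm A) => [c| |]; last 2 first.
- exact: leey.
- by rewrite E in A0.
rewrite E lee_fin in A0; have Ac := (mx_opnorm_leP Al A0).1; rewrite E lexx in Ac.
have {}Ac := Ac isT.
apply/lee_addgt0Pr => e e0; rewrite -EFinD.
(* e / 2 is lost in making the norm positive, e / 4 in each approximation. *)
have e2 : 0 < e / 2 by rewrite divr_gt0.
have ce : 0 < c + e / 2 by rewrite ltr_wpDl.
have Af : form_bound (c + e / 2) A.
  apply: norm_form_bound => // x; apply: (le_trans (Ac x)).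
  rewrite ler_wpM2r; last by rewrite lerXn2r ?nnegrE ?lerDl ?(ltW ce) ?(ltW e2).
    by [].
  by apply: sumr_ge0 => j _; exact: sqr_ge0.
pose d := e / 4 / (m%:R + 1).
have m1 : 0 < (m%:R + 1 : R) by rewrite ltr_wpDl.
have d0 : 0 < d by rewrite !divr_gt0.
have Lf := star_image_form_bound d0 (ltW ce) (fun i j => PsiI _ (AS i j)) Af.
have md : m%:R * d <= e / 4.
  by rewrite mulrC /d mulrAC ler_pdivrMr// ler_wpM2l ?lerDl// divr_ge0// ltW.
have md0 : 0 <= m%:R * d by rewrite mulr_ge0// ltW.
set c' := c + _ + _ + _ in Lf.
have c'0 : 0 < c' by rewrite /c'; lra.
have /(mx_opnorm_leP Ll (ltW c'0)) h := form_bound_norm c'0 Lf.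
by apply: (le_trans h); rewrite lee_fin /c'; lra.
Qed.

End Extension.

(** * The universal model on coefficients *)

Section MonomialMultiples.
Variables (R : realType) (n : nat).
Implicit Types (p : ncseries R n) (a w : word n).

Lemma series_mul_X_rcons p i w j :
  series_mul p (series_X R i) (rcons w j) = (j == i)%:R * p w.
Proof.
elim: w p => [|l w IH] p.
  rewrite series_mul_cons series_mul_nil /series_X /= mulr0 addr0 mulrC.
  by rewrite eqseq_cons andbT.
rewrite rcons_cons series_mul_cons IH /series_X eqseq_cons.
by case: w {IH} => [|l' w]; rewrite /= ?andbF ?mulr0 ?add0r.
Qed.

Lemma square_summable_mul_X p i : p \in @square_summable R n ->
  series_mul p (series_X R i) \in @square_summable R n.
Proof.
move=> /square_summableP[C pC]; apply/square_summableP; exists C => N.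
have E k : wsum k.+1 (fun a => sqn (series_mul p (series_X R i) a)) =
    wsum k (fun a => sqn (p a)).
  elim: k => [|k IH].
    by rewrite wsumSr !wsum0 degree_sum0 series_mul_nil /series_X mulr0 sqn0 addr0.
  rewrite wsumSr IH wsumSr; congr (_ + _); rewrite degree_sumSr.
  apply: eq_degree_sum => a _; rewrite (bigD1 i)//= big1 => [|j ji].
    by rewrite series_mul_X_rcons eqxx mul1r addr0.
  by rewrite series_mul_X_rcons (negbTE ji) mul0r sqn0.
apply: le_trans (pC N); rewrite -E; apply: wsum_homo => // a; exact: sqn_ge0.
Qed.

Lemma square_summable_mul_mono p a : p \in @square_summable R n ->
  series_mul p (mono R a) \in @square_summable R n.
Proof.
elim: a p => [|i a IH] p ps; first by rewrite mono_nil series_mul1.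
by rewrite -series_X_mul_mono -series_mulA; apply/IH/square_summable_mul_X.
Qed.

(** If c are the coordinates of Z_i then these are the coordinates of Z_i f_a;
    multiplication by words on the right, unlike on the left by series,
    preserves square sums. *)
Definition mul_mono (c : l2 R n) a : l2 R n :=
  L2 (square_summable_mul_mono a (l2valP c)).

End MonomialMultiples.

Section ModelFacts.
Variables (R : realType) (n : nat) (H0 : hilbertType R).
Local Notation series := (ncseries R n).
Local Notation fock := (l2 R n).
Implicit Types (f g : 'I_n -> series).

(** What the three kinds of realization have in common: the elements f_a are
    represented by the basis vectors, representation is faithful, and left
    multiplication by a coordinate acts on coefficients through the formal
    product. *)
Record faithful_realization (rho : realization R n) : Prop := {
  represents_inj : forall c c' p, @represents _ _ rho c p ->
    @represents _ _ rho c' p -> c = c';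
  represents_basis : exists pa : word n -> carrier rho,
    (forall a, @represents _ _ rho (fbasis R a) (pa a)) /\
    (forall j a, @represents _ _ rho (fbasis R (j :: a)) (mul_f j (pa a))) /\
    (forall i a (c : fock), @represents _ _ rho c (@coord_fun _ _ rho i) ->
       @represents _ _ rho (mul_mono c a) (mul_coord i (pa a))) }.

Lemma multiplier_coefficients rho i (M : fock -> fock) (c : fock) a :
  faithful_realization rho ->
  @mult_op R n rho (@mul_coord _ _ rho i) M -> @represents _ _ rho c (@coord_fun _ _ rho i) ->
  M (fbasis R a) = mul_mono c a.
Proof.
move=> [inj [pa [ba [_ ga]]]] [_ Mr] ci.
exact: inj (Mr _ _ (ba a)) (ga i a c ci).
Qed.

Lemma multiplier_shift rho j (W : fock -> fock) a : faithful_realization rho ->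
  @mult_op R n rho (@mul_f _ _ rho j) W -> W (fbasis R a) = fbasis R (j :: a).
Proof.
move=> [inj [pa [ba [fa _]]]] [_ Wr]; exact: inj (Wr _ _ (ba a)) (fa j a).
Qed.

Lemma sum_seriesE (I : Type) (r : seq I) (F : I -> series) w :
  (\sum_(i <- r) F i) w = \sum_(i <- r) F i w.
Proof.
by elim: r => [|i r IH]; rewrite ?big_nil// !big_cons addrfctE IH.
Qed.

Lemma peval_linear (V : lmodType R[i]) (Y : 'I_n -> V -> V) N (v : V) :
  linear (fun p : series => peval Y N p v).
Proof. by move=> k p q; exact: peval_lin. Qed.

Lemma series_comp_mul_mono N f (c : series) a :
  series_comp (N + size a) (series_mul c (mono R a)) f =
  series_mul (series_comp N c f) (series_word f a).
Proof.
rewrite series_compE peval_mul_mono; last by move=> i; exact: linear_series_mul.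
by rewrite -series_wordE peval_series_mul.
Qed.

Lemma series_comp_mono N f a : (size a < N)%N ->
  series_comp N (mono R a) f = series_word f a.
Proof. by move=> aN; rewrite series_compE peval_mono. Qed.

Lemma series_compB N (c c' : series) f :
  series_comp N (c - c') f = series_comp N c f - series_comp N c' f.
Proof.
by rewrite !series_compE; exact: (linfB (@peval_linear _ _ N _)).
Qed.

Section Polynomials.
Variables (N : nat) (f q : 'I_n -> series).
Hypothesis fqN : forall i, degree_lt N (f i) /\ degree_lt N (q i).
Hypothesis fq : forall i, series_comp N (f i) q = series_X R i.

Lemma poly_comp_word K a : degree_lt K (series_word f a) ->
  series_comp K (series_word f a) q = mono R a.
Proof.
have big : forall L, (size a * N + 1 <= L)%N -> series_comp L (series_word f a) q = mono R a.
  elim: a => [|i a IH] L.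
    by move=> L0; rewrite series_comp_mono// -addn1.
  move=> aL; have {}aL : (N + size a * N + 1 <= L)%N by rewrite -mulSn; exact: aL.
  have fa : degree_lt (size a * N).+1 (series_word f a).
    by apply: degree_lt_word => j; case: (fqN j).
  have -> : L = (N + (L - N))%N by rewrite subnKC//; move: aL; lia.
  rewrite series_compE /= peval_mul.
  - rewrite -series_compE IH; last by move: aL; lia.
    by rewrite peval_series_mul fq series_X_mul_mono.
  - by move=> j; exact: linear_series_mul.
  - exact: (fqN i).1.
  - by apply: degree_lt_leq fa; move: aL; lia.
move=> aK; rewrite -(big (maxn K (size a * N + 1)) (leq_maxr _ _)).
by rewrite !series_compE (peval_stable _ _ aK)// leq_maxl.
Qed.

(** Composition on the right with the inverse q undoes composition with f. *)
Lemma poly_comp_inj K d : degree_lt K d -> series_comp K d f = 0 -> d = 0.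
Proof.
move=> dK d0; pose L := (K * N + 1)%N.
have : series_comp L (series_comp K d f) q = d.
  rewrite {2}/series_comp series_compE (linf_wsum _ _ (@peval_linear _ _ _ _)).
  rewrite (@eq_wsum_lt _ _ _ _ (fun a => d a *: mono R a)).
    by apply/funext => w; rewrite wsum_mono; case: ltnP => // Kw; rewrite dK.
  move=> a aK; rewrite (linfZ (@peval_linear _ _ _ _)) -series_compE poly_comp_word//.
  apply: (@degree_lt_leq _ _ (size a * N).+1); last first.
    by apply: degree_lt_word => j; case: (fqN j).
  by rewrite -addn1 leq_add2r leq_mul2r ltnW ?orbT.
by rewrite d0 => <-; rewrite series_compE (linf0 (@peval_linear _ _ _ _)).
Qed.

Lemma poly_faithful : faithful_realization (poly_realization f).
Proof.
split=> [c c' p [K cK ->] [K' cK' E]|].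
  suff d0 : (l2val c - l2val c' : series) = 0.
    by apply: val_inj; apply/eqP; rewrite -subr_eq0; exact/eqP.
  pose L := maxn K K'.
  have cL : degree_lt L c by apply: degree_lt_leq cK; exact: leq_maxl.
  have cL' : degree_lt L c' by apply: degree_lt_leq cK'; exact: leq_maxr.
  apply: (@poly_comp_inj L) => [w wL|].
    by rewrite addrfctE opprfctE cL// cL'// subr0.
  rewrite series_compB !series_compE (peval_stable _ _ cK) ?leq_maxl//.
  by rewrite (peval_stable _ _ cK') ?leq_maxr// -!series_compE E subrr.
exists (series_word f); split; [|split].
- by move=> a; exists (size a).+1; [exact: mono_degree|rewrite series_comp_mono].
- move=> j a; exists (size a).+2; first exact: (@mono_degree _ _ (j :: a)).
  by rewrite (@series_comp_mono _ _ (j :: a)).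
- move=> i a c [K cK E]; exists (K + size a)%N.
    move=> w wK; rewrite /= /series_mul big1// => k _.
    have [Kk|kK] := leqP K k.
      by rewrite cK ?mul0r// size_takel// -ltnS.
    rewrite [mono _ _ _](_ : _ = 0) ?mulr0// /mono; case: eqVneq => // E'.
    by have := size_drop k w; rewrite E'; move: wK kK; lia.
  by rewrite series_comp_mul_mono -E.
Qed.

Lemma poly_represents_lin k c c' p p' :
  @represents _ _ (poly_realization f) c p -> @represents _ _ (poly_realization f) c' p' ->
  @represents _ _ (poly_realization f) (k *: c + c') (k *: p + p').
Proof.
move=> [K cK ->] [K' cK' ->]; exists (maxn K K') => [w|].
  rewrite geq_max => /andP[wK wK'].
  by rewrite -[LHS]/(k * l2val c w + l2val c' w) cK// cK'// mulr0 addr0.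
rewrite !series_compE -(peval_stable _ _ cK (leq_maxl K K')).
by rewrite -(peval_stable _ _ cK' (leq_maxr K K')) -peval_lin.
Qed.

(** For polynomials it is not an axiom of the model, but a consequence, that the
    multiplication by f_j is f_j(M). *)
Lemma poly_mult_op (M : 'I_n -> fock -> fock) j :
  (forall i, @mult_op R n (poly_realization f) (series_mul (series_X R i)) (M i)) ->
  @mult_op R n (poly_realization f) (series_mul (f j)) (peval M N (f j)).
Proof.
move=> Mm; have Mb : bounded_tuple M by move=> i; case: (Mm i).
split=> [|c p cp]; first exact: bounded_peval.
have X0 : @represents _ _ (poly_realization f) (0 : fock) (0 : series).
  exists 0%N => //; rewrite series_compE (linf0 (@peval_linear _ _ _ _))//.
have -> : series_mul (f j) p = peval (fun i => series_mul (series_X R i)) N (f j) p.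
  rewrite peval_series_mul /series_comp; congr (series_mul _ p); apply/funext => w.
  rewrite (@eq_wsum _ _ _ _ (fun a => f j a *: mono R a)).
    by rewrite wsum_mono; case: ltnP => // Nw; rewrite (fqN j).1.
  by move=> a; rewrite series_word_X.
have sum0 (I : Type) (r : seq I) (F : I -> fock) (G : I -> series) :
    (forall i, @represents _ _ (poly_realization f) (F i) (G i)) ->
    @represents _ _ (poly_realization f) (\sum_(i <- r) F i) (\sum_(i <- r) G i).
  move=> FG; elim: r => [|i r IH]; first by rewrite !big_nil.
  rewrite !big_cons; have := poly_represents_lin 1 (FG i) IH.
  by rewrite !scale1r.
apply: (sum0) => k; apply: (sum0) => a.
have wr : @represents _ _ (poly_realization f) (wact M a c)
    (wact (fun i => series_mul (series_X R i)) a p : series).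
  elim: (val a) => //= i w IH.
  by have [_ h] := Mm i; exact: h.
have := poly_represents_lin (f j a) wr X0.
by rewrite !addr0.
Qed.

End Polynomials.

Section Formal.
Variable f : 'I_n -> series.
Hypothesis f0 : forall i, f i [::] = 0.

Lemma series_word_small a w : (size w < size a)%N -> series_word f a w = 0.
Proof.
elim: a w => [//|i a IH] w wa; rewrite /= /series_mul big1// => k _.
have [->|k0] := eqVneq (val k) 0%N; first by rewrite take0 f0 mul0r.
rewrite IH ?mulr0// size_drop; move: wa k0 (ltn_ord k); rewrite /=; lia.
Qed.

Lemma series_comp_stable N c w : (size w < N)%N ->
  series_comp N c f w = series_comp (size w).+1 c f w.
Proof.
have E K : series_comp K c f w = wsum K (fun a => c a * series_word f a w).
  rewrite /series_comp /wsum sum_seriesE; apply: eq_bigr => k _.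
  exact: sum_seriesE.
move=> wN; rewrite !E; apply: wsum_stable => // a aw.
by rewrite series_word_small ?mulr0.
Qed.

Lemma formal_representsP (c : fock) (p : series) :
  @represents _ _ (formal_realization f) c p <->
  forall w N, (size w < N)%N -> p w = series_comp N c f w.
Proof.
split=> [h w N wN|h w]; last exact: h.
by rewrite series_comp_stable// h.
Qed.

(** Leading terms: on words of length |a| only the linear part of f counts. *)
Lemma series_word_cons_small i a j w : size w = size a ->
  series_word f (i :: a) (j :: w) = f i [:: j] * series_word f a w.
Proof.
move=> wa; rewrite /= series_mul_cons f0 mul0r add0r /series_mul big_ord_recl.
rewrite take0 drop0 big1 ?addr0// => k _.
rewrite series_word_small ?mulr0// size_drop -wa lift0.
by have := ltn_ord k; lia.
Qed.

Hypothesis fdet : \det (\matrix_(i, j) f i [:: j]) != 0.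

Lemma leading_inj k (F : word n -> R[i]) :
  (forall w, size w = k -> degree_sum k (fun a => F a * series_word f a w) = 0) ->
  forall a, size a = k -> F a = 0.
Proof.
elim: k F => [|k IH] F FE a ak.
  have := FE [::] erefl; rewrite degree_sum0 /= /series_one eqxx mulr1.
  by rewrite (size0nil ak).
pose J := \matrix_(i, j) f i [:: j].
have Ju : J \in unitmx by rewrite unitmxE unitfE.
case: a ak => [//|i a] [ak]; apply: (IH (fun a => F (i :: a))) => // w wk.
pose G l := degree_sum k (fun b => F (l :: b) * series_word f b w).
have GJ : (\row_l G l) *m J = 0.
  apply/rowP => j; rewrite !mxE -[RHS](FE (j :: w)); last by rewrite /= wk.
  rewrite degree_sumS.
  apply: eq_bigr => l _; rewrite !mxE /G /degree_sum mulr_suml.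
  apply: eq_bigr => b _.
  by rewrite series_word_cons_small ?size_tuple//; ring.
have : \row_l G l = 0 by rewrite -[LHS](mulmxK Ju) GJ mul0mx.
by move=> /rowP /(_ i); rewrite !mxE.
Qed.

Lemma formal_comp_inj (d : series) :
  (forall w, series_comp (size w).+1 d f w = 0) -> d = 0.
Proof.
move=> dE; apply/funext => a.
elim/ltn_ind: {a}(size a) {-2}a (erefl (size a)) => k IH a ak.
apply: (leading_inj (k := k)) => // w wk.
have := dE w; rewrite /series_comp wk wsumSr.
have -> : wsum k (fun b => d b *: series_word f b) = 0.
  by apply: wsum_eq0 => b bk; rewrite (IH (size b))// scale0r.
by rewrite add0r => E; rewrite -[RHS]E /degree_sum sum_seriesE.
Qed.

Lemma formal_faithful : faithful_realization (formal_realization f).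
Proof.
split=> [c c' p /formal_representsP cp /formal_representsP cp'|].
  suff d0 : (l2val c - l2val c' : series) = 0.
    by apply: val_inj; apply/eqP; rewrite -subr_eq0; exact/eqP.
  apply: formal_comp_inj => w; rewrite series_compB addrfctE opprfctE.
  by rewrite -cp// -cp'// subrr.
have basis a : @represents _ _ (formal_realization f) (fbasis R a) (series_word f a).
  apply/formal_representsP => w N wN.
  rewrite series_comp_stable// -(@series_comp_stable (maxn (size w) (size a)).+1).
    by rewrite series_comp_mono// ltnS leq_maxr.
  by rewrite ltnS leq_maxl.
exists (series_word f); split; [exact: basis|split=> [j a|i a c]].
  exact: (basis (j :: a)).
move=> /formal_representsP cX; apply/formal_representsP => w N wN.
rewrite series_comp_stable// -(@series_comp_stable ((size w).+1 + size a)) ?leq_addr//.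
rewrite series_comp_mul_mono; apply: series_mul_local => // v vw.
by apply: cX; rewrite ltnS.
Qed.

End Formal.

Section Functions.
Variables (gamma : R) (f : 'I_n -> series).
Hypothesis f_inj : forall G : series, free_holomorphic 1 G ->
  (forall X : 'I_n -> H0 -> H0,
     op_ball gamma X -> series_eval G (eval_tuple f X) = 0) -> G = 0.
Hypothesis f_ball : forall X : 'I_n -> H0 -> H0,
  op_ball gamma X -> op_ball 1 (eval_tuple f X).

Lemma l2_geom_sum (Y : 'I_n -> H0 -> H0) (c : fock) : op_ball 1 Y ->
  geom_sum c Y (series_eval c Y).
Proof.
move=> Y1; have [rho /andP[r0 r1] Yr] := op_ball_row_bound Y1; have [Yb _] := Y1.
have rho1 : rho * 1 < 1 by rewrite mulr1.
have [A gA] := growth_geom_sum Yb r0 ler01 rho1 Yr (l2_growth c).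
by rewrite (series_eval_geom Yb gA).
Qed.

Lemma function_faithful : faithful_realization (function_realization H0 gamma f).
Proof.
have basis a : @represents _ _ (function_realization H0 gamma f) (fbasis R a)
    (fun X => op_word (eval_tuple f X) a).
  move=> X /f_ball[Yb _]; apply/esym.
  rewrite (series_eval_geom Yb (geom_sum_poly Yb (@mono_degree R n a))).
  by apply/funext => x; rewrite peval_mono// op_wordE.
split=> [c c' p cp cp'|].
  apply/eqP; rewrite -subr_eq0; apply/eqP/val_inj.
  apply: f_inj; first exact: l2_free_holomorphic.
  move=> X Xg; have Y1 := f_ball Xg; have [Yb _] := Y1.
  have h := geom_sum_lin (-1) (l2_geom_sum c' Y1) (l2_geom_sum c Y1).
  have E : (-1 *: series_eval c' (eval_tuple f X) + series_eval c (eval_tuple f X))%R = 0.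
    by rewrite -(cp X Xg) -(cp' X Xg) scaleN1r addNr.
  rewrite E in h.
  rewrite -(series_eval_geom Yb h); congr (series_eval _ _).
  by apply/funext => w; rewrite addrfctE scalrfctE scaleN1r addrC.
exists (fun a X => op_word (eval_tuple f X) a); split; [exact: basis|split=> [j a|i a c ci]].
  exact: (basis (j :: a)).
move=> X Xg; have Y1 := f_ball Xg; have [Yb _] := Y1.
have cE := ci X Xg; rewrite /= in cE.
apply/funext => x; apply/esym.
apply: (@hcvg_unique _ _ _ \oo _ (fun N => peval (eval_tuple f X) (N + size a) (mul_mono c a) x)).
  have := geom_sum_cvg (x := x) (l2_geom_sum (mul_mono c a) Y1).
  by rewrite -(cvg_shiftn (size a)).
have -> : (fun N => peval (eval_tuple f X) (N + size a) (mul_mono c a) x) =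
    (fun N => peval (eval_tuple f X) N c (wact (eval_tuple f X) a x)).
  by apply/funext => N; rewrite peval_mul_mono//; exact: tuple_linear.
rewrite /= cE op_wordE; exact: geom_sum_cvg (l2_geom_sum c Y1).
Qed.

End Functions.

Lemma mult_axiom_facts f (rho : realization R n) (M : 'I_n -> fock -> fock)
    (c : 'I_n -> fock) :
  faithful_realization rho -> mult_axiom f rho ->
  (forall i, @mult_op R n rho (@mul_coord _ _ rho i) (M i)) ->
  (forall i, @represents _ _ rho (c i) (@coord_fun _ _ rho i)) ->
  (forall j, @mult_op R n rho (@mul_f _ _ rho j) (eval_tuple f M j)) /\
  (forall j, hardy_algebra M (eval_tuple f M j)).
Proof.
move=> rf [M' [M'm M'c M'f]] Mm ci.
have MM' : M' = M.
  apply/funext => i; apply: fock_ext; first by case: (M'm i).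
    by case: (Mm i).
  move=> a; rewrite (multiplier_coefficients a rf (M'm i) (ci i)).
  by rewrite (multiplier_coefficients a rf (Mm i) (ci i)).
rewrite -MM'; split=> // j.
have M'b : bounded_tuple M' by move=> i; case: (M'm i).
apply: (@hardy_series _ _ _ _ M'b (f j)).
rewrite /eval_tuple /series_eval; case: xgetP => [A _ //|no].
by case: M'c => -[_ /(_ j)[A sA]]; case: (no A); [left|right].
Qed.

(** Whatever the kind of the model, in coordinates M_i is left multiplication by
    g_i, and f_j(M) is the j-th left creation operator. *)
Theorem universal_model_facts f (M : 'I_n -> fock -> fock) g :
  universal_model H0 f M g ->
  [/\ bounded_tuple M,
      forall i a w, l2val (M i (fbasis R a)) w = series_mul (g i) (mono R a) w,
      bounded_tuple (eval_tuple f M),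
      forall i a, eval_tuple f M i (fbasis R a) = fbasis R (i :: a) &
      forall i, hardy_algebra M (eval_tuple f M i)].
Proof.
move=> [rho mc [Mm gc]].
have Mb : bounded_tuple M by move=> i; case: (Mm i).
have [c cP] := choice (fun i => let: ex_intro2 c h1 h2 := gc i in
  ex_intro (fun c => represents c (@coord_fun _ _ rho i) /\ g i = l2val c) c (conj h1 h2)).
suff [rf [Wm Wh]] : faithful_realization rho /\
    (forall j, @mult_op R n rho (@mul_f _ _ rho j) (eval_tuple f M j)) /\
    (forall j, hardy_algebra M (eval_tuple f M j)).
  split=> //.
  - move=> i a w; have [ci ->] := cP i.
    by rewrite (multiplier_coefficients a rf (Mm i) ci).
  - by move=> i; case: (Wm i).
  - by move=> i a; exact: multiplier_shift (Wm i).
case: mc Mm {gc} c cP => [N q fqN fq _|f0 _ fdet _ ma|gamma _ _ fb finj _ ma] Mm c cP.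
- have rf := poly_faithful fqN fq; split=> //.
  have WE j : eval_tuple f M j = peval M N (f j).
    by apply: series_eval_geom => //; apply: geom_sum_poly => //; case: (fqN j).
  split=> j; rewrite WE; first exact: (poly_mult_op fqN).
  apply: hardy_poly => //; exists N, (f j); apply/funext => x.
  by rewrite partial_evalE.
- have rf := formal_faithful f0 fdet; split=> //.
  exact: (mult_axiom_facts rf ma Mm (fun i => (cP i).1)).
- have rf := function_faithful finj fb; split=> //.
  exact: (mult_axiom_facts rf ma Mm (fun i => (cP i).1)).
Qed.

End ModelFacts.

(** * Formal identities from identities of functions *)

Section OrthonormalFamilies.
Variables (R : realType) (H0 : hilbertType R).
Hypothesis H0_inf : infinite_dimensional H0.

Lemma orthonormal_exists m : exists b : 'I_m -> H0, form_orthonormal hdot b.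
Proof.
have dlin k (x y z : H0) : hdot (k *: x + y) z = k * hdot x z + hdot y z.
  by rewrite hdotDl hdotZl.
have dpos (x : H0) : x != 0 -> 0 < complex.Re (hdot x x).
  move=> x0; rewrite -hnorm_sqr exprn_even_gt0//=.
  by apply: contra x0 => /eqP /hnorm_eq0 ->.
elim: m => [|m [b bo]]; first by exists (fun=> 0) => -[].
have [v vfree] := H0_inf m.+1.
have [i ri] : exists i, residual hdot b (v i) != 0.
  apply/not_existsP => r0.
  have vE i : v i = \sum_j hdot (v i) (b j) *: b j.
    apply/eqP; rewrite -subr_eq0; apply/negPn/negP => h; exact: r0 i h.
  (* Otherwise m + 1 independent vectors have coordinate rows of length m, and a
     kernel vector of the coordinate matrix is a linear dependence. *)
  pose A : 'M[R[i]]_(m.+1, m) := \matrix_(i, j) hdot (v i) (b j).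
  have : kermx A != 0.
    by rewrite -mxrank_eq0 mxrank_ker subn_eq0 -ltnNge ltnS rank_leq_col.
  move=> /rowV0Pn[k /sub_kermxP kA k0]; move/negP: k0; apply.
  apply/eqP/rowP => i; rewrite mxE; apply: (vfree (fun i => k 0 i)) => {i}.
  under eq_bigr do rewrite vE scaler_sumr.
  rewrite exchange_big big1// => j _.
  have := congr1 (fun B : 'rV__ => B 0 j) kA; rewrite !mxE => kj.
  rewrite -[RHS](scale0r (b j)) -kj scaler_suml; apply: eq_bigr => i _.
  by rewrite mxE scalerA.
by have [c [co _ _]] := form_orthonormal_extend dlin (@hdotC _ H0) dpos bo ri; exists c.
Qed.

Lemma orthonormal_words n N : exists e : word n -> H0,
  forall w w', (size w <= N)%N -> (size w' <= N)%N -> hdot (e w) (e w') = (w == w')%:R.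
Proof.
pose s := words_lt n N.+1.
have [b bo] := orthonormal_exists (size s).+1.
exists (fun w => b (inord (index w s))) => w w' wN wN'.
have ws : w \in s by exact: mem_words_lt.
have ws' : w' \in s by exact: mem_words_lt.
rewrite bo -val_eqE /= !inordK ?ltnS ?index_size//.
have [->|ww'] := eqVneq w w'; first by rewrite eqxx.
case: eqVneq => // h; case/eqP: ww'.
by rewrite -(nth_index [::] ws) h nth_index.
Qed.

End OrthonormalFamilies.

Section NilpotentShifts.
Variables (R : realType) (n N : nat) (H0 : hilbertType R) (e : word n -> H0).
Local Notation series := (ncseries R n).
Hypothesis eo : forall w w', (size w <= N)%N -> (size w' <= N)%N ->
  hdot (e w) (e w') = (w == w')%:R.
Variable eps : R.
Hypothesis eps0 : 0 < eps.

(** The truncated left shifts; the weight eps brings the tuple into a given ball. *)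
Definition nil_shift (i : 'I_n) (x : H0) : H0 :=
  wsum N (fun w => ((eps%:C)%C * hdot x (e w)) *: e (i :: w)).

Local Notation X := nil_shift.

Lemma hnorm_nil_basis w : (size w <= N)%N -> hnorm (e w) = 1.
Proof.
move=> wN; have := hdot_hnorm (e w); rewrite eo// eqxx => /complexI.
by move=> /esym/eqP; rewrite sqrp_eq1 ?hnorm_ge0// => /eqP.
Qed.

Lemma linear_nil_shift i : linear (X i).
Proof.
move=> k x y; rewrite /nil_shift -wsumZ -wsumD; apply: eq_wsum => w.
by rewrite hdotDl hdotZl mulrDr scalerDl scalerA; congr (_ *: _ + _); ring.
Qed.

Lemma hnorm_wsum (F : word n -> H0) K :
  hnorm (wsum K F) <= wsum K (fun w => hnorm (F w)).
Proof.
rewrite /wsum (le_trans (hnorm_sum _ _))//; apply: ler_sum => k _.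
exact: hnorm_sum.
Qed.

Lemma nil_shift_bound i : bound_by (eps * wsum N (fun _ : word n => 1)) (X i).
Proof.
move=> x; rewrite (le_trans (hnorm_wsum _ _))//.
rewrite -mulrA [_ * hnorm x]mulrC mulrA -wsumMl /wsum.
apply: ler_sum => k _; apply: ler_sum => w _.
have wN : (size w < N)%N by rewrite size_tuple.
rewrite hnorm_scale cabsM cabs_real hnorm_nil_basis// !mulr1 gtr0_norm//.
rewrite ler_wpM2l ?(ltW eps0)// (le_trans (cauchy_schwarz _ _))//.
by rewrite hnorm_nil_basis ?mulr1// ltnW.
Qed.

Lemma bounded_nil_shift : bounded_tuple X.
Proof.
move=> i; apply/bounded_opP; split; first exact: linear_nil_shift.
exists (eps * wsum N (fun _ : word n => 1)); last exact: nil_shift_bound.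
by rewrite mulr_ge0 ?(ltW eps0)// wsum_ge0.
Qed.

(** The span of the e_w with l <= |w| <= N, which is 0 for l > N. *)
Definition nil_filtration l (x : H0) : Prop := exists k : word n -> R[i],
  (forall w, (size w < l)%N -> (size w <= N)%N -> k w = 0) /\ x = wsum N.+1 (fun w => k w *: e w).

Lemma filtration_lin l k x y : nil_filtration l x -> nil_filtration l y ->
  nil_filtration l (k *: x + y).
Proof.
move=> [a [al ->]] [b [bl ->]]; exists (fun w => k * a w + b w); split.
  by move=> w wl wN; rewrite al// bl// mulr0 addr0.
rewrite -wsumZ -wsumD; apply: eq_wsum => w.
by rewrite scalerDl scalerA.
Qed.

Lemma filtration0 l : nil_filtration l 0.
Proof.
exists (fun=> 0); split=> //; rewrite wsum_eq0// => w _; exact: scale0r.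
Qed.

Lemma filtration_le l l' x : (l <= l')%N -> nil_filtration l' x -> nil_filtration l x.
Proof.
move=> ll [a [al ->]]; exists a; split=> // w wl wN; apply: al => //; exact: leq_trans wl ll.
Qed.

Lemma filtration_top x : nil_filtration N.+1 x -> x = 0.
Proof.
by move=> [a [al ->]]; apply: wsum_eq0 => w wN; rewrite al// scale0r.
Qed.

Lemma filtration_sum l (I : Type) (r : seq I) (F : I -> H0) :
  (forall i, nil_filtration l (F i)) -> nil_filtration l (\sum_(i <- r) F i).
Proof.
move=> Fl; elim: r => [|i r IH]; first by rewrite big_nil; exact: filtration0.
by rewrite big_cons -[F i]scale1r; exact: filtration_lin.
Qed.

Lemma hdot_nil_comb (k : word n -> R[i]) w : (size w <= N)%N ->
  hdot (wsum N.+1 (fun v => k v *: e v)) (e w) = k w.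
Proof.
move=> wN; have -> : hdot (wsum N.+1 (fun v => k v *: e v)) (e w) =
    wsum N.+1 (fun v => hdot (k v *: e v) (e w)).
  rewrite /wsum hdot_suml; apply: eq_bigr => j _; exact: hdot_suml.
have -> : wsum N.+1 (fun v => hdot (k v *: e v) (e w)) =
    wsum N.+1 (fun v => k v * (v == w)%:R).
  by apply: eq_wsum_lt => v vN; rewrite hdotZl eo.
rewrite (wsum_only (b := w))// ?eqxx ?mulr1// => v vw.
by rewrite (negbTE vw) mulr0.
Qed.

Lemma nil_shiftE i x : X i x = wsum N.+1 (fun v => (if v is j :: w then
   (j == i)%:R * ((eps%:C)%C * hdot x (e w)) else 0) *: e v).
Proof.
rewrite wsumSl scale0r add0r (bigD1 i)//= big1 => [|j ji].
  by rewrite addr0; apply: eq_wsum => w; rewrite eqxx mul1r.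
by apply: wsum_eq0 => w _; rewrite (negbTE ji) mul0r scale0r.
Qed.

Definition raising (Z : H0 -> H0) : Prop :=
  (forall x, nil_filtration 1 (Z x)) /\
  (forall l x, nil_filtration l x -> nil_filtration l.+1 (Z x)).

Lemma raising_nil_shift i : raising (X i).
Proof.
split=> [x|l x [a [al xE]]]; rewrite nil_shiftE; eexists; (split; last by []).
  by case.
move=> [|j w] //= wl wN.
by rewrite xE hdot_nil_comb ?(ltnW wN)// al ?(ltnW wN)// !mulr0.
Qed.

Lemma filtration_wact (Z : 'I_n -> H0 -> H0) a x : (forall i, raising (Z i)) ->
  (0 < size a)%N -> nil_filtration (size a) (wact Z a x).
Proof.
move=> Zr; elim: a => [//|i [|j a] IH] _; first exact: (Zr i).1.
by apply: (Zr i).2; exact: IH.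
Qed.

Lemma raising_nilpotent (Z : 'I_n -> H0 -> H0) a x : (forall i, raising (Z i)) ->
  (N < size a)%N -> wact Z a x = 0.
Proof.
move=> Zr Na; apply: filtration_top; apply: (filtration_le Na).
apply: filtration_wact => //; exact: leq_ltn_trans Na.
Qed.

Lemma raising_eval (Z : 'I_n -> H0 -> H0) (p : series) : bounded_tuple Z ->
  (forall i, raising (Z i)) -> series_eval p Z = peval Z N.+1 p.
Proof.
move=> Zb Zr; apply: series_eval_geom => //; apply: geom_sum_stable => // K x NK.
apply: wsum_stable => // a Na; by rewrite raising_nilpotent// scaler0.
Qed.

Lemma raising_word (Z : 'I_n -> H0 -> H0) a l x : (forall i, raising (Z i)) ->
  nil_filtration l x -> nil_filtration (size a + l) (wact Z a x).
Proof. by move=> Zr xl; elim: a => //= i a IH; exact: (Zr i).2. Qed.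

Lemma raising_peval (p : series) : p [::] = 0 -> raising (peval X N.+1 p).
Proof.
move=> p0; have Xr := raising_nil_shift; split=> [x|l x xl];
  apply: filtration_sum => k; apply: filtration_sum => -[[|i a] ak] /=;
  rewrite ?p0 ?scale0r; try exact: filtration0;
  rewrite -[_ *: _]addr0; apply: filtration_lin; try exact: filtration0.
- exact: (Xr i).1.
- apply: filtration_le (raising_word (i :: a) Xr xl); by rewrite /= addSn ltnS leq_addl.
Qed.

Variable f : 'I_n -> series.
Hypothesis f0 : forall i, f i [::] = 0.
Local Notation Y := (eval_tuple f X).

Lemma nil_tupleE i : Y i = peval X N.+1 (f i).
Proof. by apply: raising_eval; [exact: bounded_nil_shift|exact: raising_nil_shift]. Qed.

Lemma bounded_nil_tuple : bounded_tuple Y.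
Proof. by move=> i; rewrite nil_tupleE; apply: bounded_peval; exact: bounded_nil_shift. Qed.

Lemma raising_nil_tuple i : raising (Y i).
Proof. by rewrite nil_tupleE; exact: raising_peval. Qed.

(** The image of a formal power series in the span of the e_w; with the weights
    eps^|w| the shift X_i acts as multiplication by Z_i. *)
Definition nil_vector (p : series) : H0 :=
  wsum N.+1 (fun w => ((eps%:C)%C ^+ size w * p w) *: e w).

Lemma nil_vector_lin k p q : nil_vector (k *: p + q) = k *: nil_vector p + nil_vector q.
Proof.
rewrite /nil_vector -wsumZ -wsumD; apply: eq_wsum => w.
by rewrite addrfctE scalrfctE mulrDr scalerDl scalerA mulrCA.
Qed.

Lemma nil_vector_local p q : (forall w, (size w <= N)%N -> p w = q w) ->
  nil_vector p = nil_vector q.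
Proof. by move=> pq; apply: eq_wsum_lt => w wN; rewrite pq. Qed.

Lemma nil_vector_inj p q : nil_vector p = nil_vector q ->
  forall w, (size w <= N)%N -> p w = q w.
Proof.
move=> pq w wN; have := congr1 (fun x => hdot x (e w)) pq.
rewrite !hdot_nil_comb//; apply: mulfI; rewrite expf_eq0 negb_and.
by apply/orP; right; apply/eqP => /complexI /eqP; rewrite gt_eqF.
Qed.

Lemma nil_shift_vector i p : X i (nil_vector p) = nil_vector (series_mul (series_X R i) p).
Proof.
rewrite nil_shiftE; apply: eq_wsum_lt => -[|j w] wN; congr (_ *: _).
  by rewrite series_X_mul_nil mulr0.
have wN' : (size w <= N)%N by exact: ltnW.
have -> : hdot (nil_vector p) (e w) = (eps%:C)%C ^+ size w * p w.
  exact: hdot_nil_comb.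
by rewrite series_X_mul_cons [size _]/= exprS; ring.
Qed.

Lemma nil_word_vector (Z : 'I_n -> H0 -> H0) (h : 'I_n -> series) a p :
  (forall i q, Z i (nil_vector q) = nil_vector (series_mul (h i) q)) ->
  wact Z a (nil_vector p) = nil_vector (wact (fun i => series_mul (h i)) a p).
Proof. by move=> Zh; elim: a => //= i a ->. Qed.

Lemma nil_peval_vector (Z : 'I_n -> H0 -> H0) (h : 'I_n -> series) (q : series) K p :
  (forall i q, Z i (nil_vector q) = nil_vector (series_mul (h i) q)) ->
  peval Z K q (nil_vector p) = nil_vector (peval (fun i => series_mul (h i)) K q p).
Proof.
move=> Zh; have ul : linear nil_vector by move=> k u v; exact: nil_vector_lin.
rewrite /peval (linf_wsum _ _ ul); apply: eq_wsum => a.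
by rewrite (linfZ ul) (nil_word_vector a p Zh).
Qed.

Lemma nil_tuple_vector i p : Y i (nil_vector p) = nil_vector (series_mul (f i) p).
Proof.
rewrite nil_tupleE (nil_peval_vector _ _ _ nil_shift_vector) peval_series_mul.
apply: nil_vector_local => w wN; apply: series_mul_local => // v vw.
rewrite /series_comp (@eq_wsum _ _ _ _ (fun a => f i a *: mono R a)) => [|a].
  by rewrite wsum_mono ltnS (leq_trans vw wN).
by rewrite series_word_X.
Qed.

Lemma nil_identity i (c : series) : X i = series_eval c Y ->
  forall w, (size w <= N)%N -> series_X R i w = series_comp N.+1 c f w.
Proof.
rewrite (raising_eval _ bounded_nil_tuple raising_nil_tuple) => XE.
apply: nil_vector_inj; rewrite -[series_X R i]series_mul1 -nil_shift_vector XE.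
by rewrite (nil_peval_vector _ _ _ nil_tuple_vector).
Qed.

End NilpotentShifts.

(** An identity of functions on a ball determines the coefficients of the formal
    composition, since the truncated shifts separate them. *)
Lemma function_formal (R : realType) (n : nat) (H0 : hilbertType R) (gamma : R)
    (f : 'I_n -> ncseries R n) (c : ncseries R n) i :
  infinite_dimensional H0 -> 0 < gamma -> (forall i, f i [::] = 0) ->
  (forall X : 'I_n -> H0 -> H0, op_ball gamma X -> X i = series_eval c (eval_tuple f X)) ->
  forall w, series_X R i w = series_comp (size w).+1 c f w.
Proof.
move=> H0_inf g0 f0 fc w; pose N := size w.
have [e eo] := orthonormal_words H0_inf n N.
pose K : R := wsum N (fun _ : word n => 1).
have K0 : 0 <= K by apply: wsum_ge0.
have K1 : 0 < n%:R * K + 1 by rewrite ltr_wpDl// mulr_ge0.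
pose eps := gamma / 2 / (n%:R * K + 1).
have eps0 : 0 < eps by rewrite !divr_gt0.
apply: (nil_identity eo eps0 f0 (fc _ _)) => //.
apply: (row_bound_op_ball (bounded_nil_shift eo eps0)).
  have : n%:R * (eps * K) <= gamma / 2.
    rewrite mulrCA /eps mulrAC ler_pdivrMr// ler_wpM2l ?lerDl// divr_ge0// ltW//.
  move=> h; apply/andP; split; last by apply: (le_lt_trans h); lra.
  exact: (mulr_ge0 (ler0n _ n) (mulr_ge0 (ltW eps0) K0)).
apply: bound_row_bound; first by rewrite mulr_ge0// ltW.
by move=> j; exact: nil_shift_bound.
Qed.

(** * An identity theorem for uniform limits of polynomials *)

Section PolynomialIdentity.
Variable R : realType.
Implicit Types (p : {poly R[i]}) (M : R).

(** Cauchy's estimate without integrals.  The even and the odd part of p are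
    polynomials in z^2 of smaller size, and are bounded by M on the circle because
    there they are means of p(z) and p(- z), up to signs and a factor z. *)
Lemma coef_le_circle_sup p M :
  (forall z, cabs z = 1 -> cabs p.[z] <= M) -> forall k, cabs p`_k <= M.
Proof.
elim/ltn_ind: {p}(size p) {-2}p (erefl (size p)) => m IH p pm pM k.
have M0 : 0 <= M by apply: le_trans (pM 1 (@cabs1 R)); exact: cabs_ge0.
have [p1|p1] := leqP (size p) 1.
  have [c pc] : exists c, p = c%:P by exists p`_0; exact: size1_polyC.
  rewrite pc coefC; case: ifP => _; last by rewrite cabs0.
  by have := pM 1 (@cabs1 R); rewrite pc hornerC.
have root (w : R[i]) : cabs w = 1 -> exists2 z, z ^+ 2 = w & cabs z = 1.
  move=> w1; exists (sqrtC w); first exact: sqrtCK.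
  have : cabs (sqrtC w) ^+ 2 = 1 by rewrite -cabsX sqrtCK.
  by move=> /eqP; rewrite sqrp_eq1 ?cabs_ge0// => /eqP.
have split z : p.[z] = (even_poly p).[z ^+ 2] + (odd_poly p).[z ^+ 2] * z.
  rewrite -{1}(poly_even_odd p) hornerD hornerM hornerX.
  by rewrite !horner_comp hornerXn.
have two : cabs (2 : R[i]) = 2 by rewrite /cabs normr_nat.
have avg (u v : R[i]) : cabs u <= M -> cabs v <= M -> cabs (u + v) <= 2 * M.
  by move=> uM vM; rewrite (le_trans (cabsD _ _))// mulr_natl mulr2n lerD.
have half (u : R[i]) : cabs (2 * u) <= 2 * M -> cabs u <= M.
  by rewrite cabsM two ler_pM2l.
have pN z : cabs z = 1 -> cabs p.[- z] <= M by move=> z1; apply: pM; rewrite cabsN.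
have evenM w : cabs w = 1 -> cabs (even_poly p).[w] <= M.
  move=> /root[z <- z1]; apply: half.
  have -> : 2 * (even_poly p).[z ^+ 2] = p.[z] + p.[- z].
    by rewrite !split sqrrN; ring.
  by apply: avg; [exact: pM|exact: pN].
have oddM w : cabs w = 1 -> cabs (odd_poly p).[w] <= M.
  move=> /root[z <- z1]; apply: half.
  have E : 2 * (odd_poly p).[z ^+ 2] * z = p.[z] + - p.[- z].
    by rewrite !split sqrrN; ring.
  have : cabs (2 * (odd_poly p).[z ^+ 2] * z) <= 2 * M.
    by rewrite E; apply: avg; [exact: pM|rewrite cabsN; exact: pN].
  by rewrite (cabsM (2 * (odd_poly p).[z ^+ 2]) z) z1 mulr1.
have := odd_double_half k; case: (odd k) => kE; rewrite -kE.
  rewrite add1n -coef_odd_poly; apply: (IH _ _ _ erefl oddM).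
  by rewrite (leq_ltn_trans (size_odd_poly _))// -pm; move: p1; lia.
rewrite add0n -coef_even_poly; apply: (IH _ _ _ erefl evenM).
rewrite (leq_ltn_trans (size_even_poly _))// -pm; move: p1; lia.
Qed.

Lemma geometric_partial (t : R) (a : nat -> R) M L K : 0 <= t < 1 -> 0 <= M ->
  (forall k, a k <= M) -> 
  (\sum_(L <= k < K) a k * t ^+ k) * (1 - t) <= M * t ^+ L.
Proof.
move=> /andP[t0 t1] M0 aM.
have [KL|LK] := leqP K L.
  by rewrite big_geq// mul0r mulr_ge0// exprn_ge0.
suff : (\sum_(L <= k < K) a k * t ^+ k) * (1 - t) <= M * (t ^+ L - t ^+ K).
  move=> h; apply: (le_trans h); rewrite ler_wpM2l// lerBlDr lerDl.
  exact: exprn_ge0.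
rewrite -(subnK (ltnW LK)); elim: (K - L)%N => [|j IH].
  by rewrite add0n big_geq// subrr mul0r mulr0.
rewrite addSn big_nat_recr ?leq_addl//= mulrDl.
have h : a (j + L)%N * t ^+ (j + L) * (1 - t) <= M * t ^+ (j + L) * (1 - t).
  by rewrite ler_wpM2r ?subr_ge0 ?(ltW t1)// ler_wpM2r ?exprn_ge0.
apply: (le_trans (lerD IH h)); rewrite [t ^+ (j + L).+1]exprS.
by rewrite le_eqVlt; apply/orP; left; apply/eqP; ring.
Qed.

Lemma horner_split p (t : R) L : cabs (p.[(t%:C)%C] -
    \sum_(k < L) p`_k * (t%:C)%C ^+ k) <=
  \sum_(L <= k < maxn L (size p)) cabs p`_k * `|t| ^+ k.
Proof.
have -> : p.[(t%:C)%C] = \sum_(0 <= k < maxn L (size p)) p`_k * (t%:C)%C ^+ k.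
  rewrite horner_coef big_mkord.
  rewrite (big_ord_widen (maxn L (size p)) (fun k => p`_k * (t%:C)%C ^+ k)) ?leq_maxr//.
  rewrite [RHS](bigID (fun k : 'I_(maxn L (size p)) => (k < size p)%N))/=.
  rewrite [X in _ + X]big1 ?addr0// => k; rewrite -leqNgt => kp.
  by rewrite nth_default// mul0r.
rewrite (big_cat_nat (leq0n L) (leq_maxl L (size p)))/= big_mkord addrAC subrr add0r.
rewrite (le_trans (cabs_sum _ _))//; apply: ler_sum => k _.
by rewrite cabsM cabsX cabs_real.
Qed.

(** Once the coefficients before the L-th are small, the value at a small t isolates
    the L-th one: the tail is of order t^(L + 1). *)
Lemma small_coefs M (d : R) : 0 <= M -> 0 < d -> forall L (eta : R), 0 < eta ->
  exists2 e : R, 0 < e & forall p, (forall k, cabs p`_k <= M) ->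
    (forall t, 0 <= t <= d -> cabs p.[(t%:C)%C] <= e) ->
    forall k, (k < L)%N -> cabs p`_k <= eta.
Proof.
move=> M0 d0; elim=> [|L IH] eta eta0; first by exists 1.
(* At t the coefficients after the L-th contribute at most eta t^L / 4, and with
   eta' the earlier ones at most eta t^L / 8. *)
pose t := Num.min d (Num.min (2^-1) (eta / 8 / (M + 1))).
have M1 : 0 < M + 1 by rewrite ltr_wpDl.
have t0 : 0 < t by rewrite !lt_min d0 invr_gt0 ltr0n !divr_gt0.
have td : t <= d by rewrite /t ge_min lexx.
have th : t <= 2^-1 by rewrite /t !ge_min lexx orbT.
have tM : t * (M + 1) <= eta / 8.
  by rewrite -ler_pdivlMr// /t !ge_min lexx !orbT.
have t1 : t < 1 by lra.
have tL : 0 < t ^+ L by rewrite exprn_gt0.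
pose eta' := Num.min eta (eta / 8 * t ^+ L / (L%:R + 1)).
have L1 : 0 < (L%:R + 1 : R) by rewrite ltr_wpDl.
have eta'0 : 0 < eta' by rewrite lt_min eta0 !divr_gt0// mulr_gt0// divr_gt0.
have [e e0 eP] := IH eta' eta'0.
exists (Num.min e (eta / 8 * t ^+ L)); first by rewrite lt_min e0 mulr_gt0// divr_gt0.
move=> p pM pt.
have low k : (k < L)%N -> cabs p`_k <= eta'.
  apply: eP => // u ud; apply: (le_trans (pt u ud)); by rewrite ge_min lexx.
move=> k; rewrite ltnS leq_eqVlt => /predU1P[->|kL]; last first.
  by apply: le_trans (low k kL) _; rewrite ge_min lexx.
rewrite -(ler_pM2r tL).
have h1 : cabs p.[(t%:C)%C] <= eta / 8 * t ^+ L.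
  by apply: le_trans (pt t _) _; rewrite ?(ltW t0)// ge_min lexx orbT.
have h2 := horner_split p t L.+1; rewrite ger0_norm ?(ltW t0)// in h2.
have h3 := @geometric_partial t (fun k => cabs p`_k) M L.+1 (maxn L.+1 (size p)).
have {}h3 := h3 _ M0 pM; rewrite (ltW t0) t1 in h3; have {}h3 := h3 isT.
set T := \sum_(L.+1 <= _ < _) _ in h2 h3.
have T0 : 0 <= T by apply: le_trans h2; exact: cabs_ge0.
have h4 : T <= eta / 4 * t ^+ L.
  have : T * (1 - t) <= t * (M + 1) * t ^+ L.
    apply: (le_trans h3); rewrite exprS.
    have : 0 <= t * t ^+ L by rewrite mulr_ge0// ltW.
    nra.
  have : t * (M + 1) * t ^+ L <= eta / 8 * t ^+ L by rewrite ler_wpM2r// ltW.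
  have : T * 2^-1 <= T * (1 - t) by rewrite ler_wpM2l//; lra.
  rewrite -!mulrA; move: (_ * t ^+ L) => q; lra.
have h5 : cabs (\sum_(k < L) p`_k * (t%:C)%C ^+ k) <= eta / 8 * t ^+ L.
  rewrite (le_trans (cabs_sum _ _))//.
  apply: (@le_trans _ _ (\sum_(k < L) eta')).
    apply: ler_sum => j _; rewrite cabsM cabsX cabs_real ger0_norm ?(ltW t0)//.
    rewrite -[leRHS]mulr1 ler_pM ?cabs_ge0 ?exprn_ge0 ?(ltW t0)// ?low//.
    by rewrite exprn_ile1// ltW.
  rewrite (_ : \sum_(k < L) eta' = L%:R * eta'); last first.
    by rewrite sumr_const card_ord mulr_natl.
  apply: (@le_trans _ _ (L%:R * (eta / 8 * t ^+ L / (L%:R + 1)))).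
    by rewrite ler_wpM2l// /eta' ge_min lexx orbT.
  have gen (q l : R) : 0 <= q -> 0 <= l -> l * (q / (l + 1)) <= q.
    move=> q0 l0; rewrite mulrA ler_pdivrMr ?ltr_wpDl// mulrC ler_wpM2l// lerDl//.
  by apply: gen; rewrite ?ler0n// mulr_ge0 ?(ltW tL)// divr_ge0// ltW.
rewrite big_ord_recr /= in h2.
have -> : cabs p`_L * t ^+ L = cabs (p`_L * (t%:C)%C ^+ L).
  by rewrite cabsM cabsX cabs_real ger0_norm// ltW.
set S := \sum_(k < L) _ in h2 h5; set q := p`_L * _ in h2 *.
have -> : q = p.[(t%:C)%C] + (- (p.[(t%:C)%C] - (S + q)) + - S) by ring.
have := cabsD p.[(t%:C)%C] (- (p.[(t%:C)%C] - (S + q)) + - S).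
have := cabsD (- (p.[(t%:C)%C] - (S + q))) (- S); rewrite !cabsN.
have := h1; have := h5; have := le_trans h2 h4.
have -> : eta / 4 * t ^+ L = 2 * (eta * t ^+ L) / 8 by field.
have -> : eta / 8 * t ^+ L = (eta * t ^+ L) / 8 by ring.
move: (cabs _) (cabs _) (cabs _) (cabs _) (cabs _) => a1 a2 a3 a4 a5.
have : 0 < eta * t ^+ L by rewrite mulr_gt0.
move: (eta * _) => E; lra.
Qed.

(** The tail from degree L on is at most M t^L / (1 - t); the finitely many
    coefficients before it are small. *)
Lemma small_values M (d t eta : R) : 0 <= M -> 0 < d -> 0 <= t < 1 -> 0 < eta ->
  exists2 e : R, 0 < e & forall p, (forall k, cabs p`_k <= M) ->
    (forall u, 0 <= u <= d -> cabs p.[(u%:C)%C] <= e) -> cabs p.[(t%:C)%C] <= eta.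
Proof.
move=> M0 d0 t01 eta0; have /andP[t0 t1] := t01.
have t10 : 0 < 1 - t by rewrite subr_gt0.
have M1 : 0 < M + 1 by rewrite ltr_wpDl.
have [L LP] := geometric_small t01 (divr_gt0 (mulr_gt0 (divr_gt0 eta0 (ltr0n _ 2)) t10) M1).
have L1 : 0 < (L%:R + 1 : R) by rewrite ltr_wpDl.
have [e e0 eP] := small_coefs M0 d0 L (divr_gt0 (divr_gt0 eta0 (ltr0n _ 2)) L1).
exists e => // p pM pe; have low := eP p pM pe.
have h2 := horner_split p t L; rewrite ger0_norm// in h2.
have h3 := @geometric_partial t (fun k => cabs p`_k) M L (maxn L (size p)) t01 M0 pM.
set T := \sum_(L <= _ < _) _ in h2 h3.
have h4 : T <= eta / 2.
  rewrite -(ler_pM2r t10) (le_trans h3)//.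
  have := LP L (leqnn L); rewrite ler_pdivlMr// => h; apply: le_trans h.
  rewrite mulrC ler_wpM2l ?exprn_ge0// lerDl//.
have h5 : cabs (\sum_(k < L) p`_k * (t%:C)%C ^+ k) <= eta / 2.
  rewrite (le_trans (cabs_sum _ _))//.
  apply: (@le_trans _ _ (\sum_(k < L) (eta / 2 / (L%:R + 1)))).
    apply: ler_sum => j _; rewrite cabsM cabsX cabs_real ger0_norm//.
    rewrite -[leRHS]mulr1 ler_pM ?cabs_ge0 ?exprn_ge0// ?low//.
    by rewrite exprn_ile1// ltW.
  rewrite (_ : \sum_(k < L) _ = eta / 2 * (L%:R / (L%:R + 1))); last first.
    by rewrite sumr_const card_ord -[LHS]mulr_natl; ring.
  rewrite ler_piMr ?divr_ge0 ?(ltW eta0)// ler_pdivrMr// mul1r lerDl//.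
rewrite -(subrK (\sum_(k < L) p`_k * (t%:C)%C ^+ k) p.[_]) (le_trans (cabsD _ _))//.
by rewrite (splitr eta) lerD// (le_trans h2).
Qed.

End PolynomialIdentity.

Section DiscApproximation.
Variables (R : realType) (H : hilbertType R).
Implicit Types (u v : R[i] -> H).

(** Uniform limits on the closed unit disc of polynomials with coefficients in H:
    a substitute for analytic functions that is stable under all operations
    needed here. *)
Definition disc_approx v : Prop := forall e : R, 0 < e ->
  exists K (a : nat -> H), forall z, cabs z <= 1 ->
    hnorm (v z - \sum_(k < K) z ^+ k *: a k) <= e.

Lemma disc_approx_cst x : disc_approx (fun=> x).
Proof.
move=> e e0; exists 1%N, (fun=> x) => z _.
by rewrite big_ord1 expr0 scale1r subrr hnorm0 ltW.
Qed.

Lemma disc_poly_widen (z : R[i]) K L (a : nat -> H) : (K <= L)%N ->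
  \sum_(k < L) z ^+ k *: (if (k < K)%N then a k else 0) = \sum_(k < K) z ^+ k *: a k.
Proof.
move=> KL; rewrite (big_ord_widen L (fun k => z ^+ k *: a k))// [RHS]big_mkcond.
by apply: eq_bigr => k _; case: ifP; rewrite ?scaler0.
Qed.

Lemma disc_approx_lin c u v : disc_approx u -> disc_approx v ->
  disc_approx (fun z => c *: u z + v z).
Proof.
move=> ua va e e0; have c1 : 0 < cabs c + 1 by rewrite ltr_wpDl// cabs_ge0.
have e2 : 0 < e / 2 by rewrite divr_gt0.
have [K [a aP]] := ua _ (divr_gt0 e2 c1); have [L [b bP]] := va _ e2.
exists (maxn K L), (fun k => c *: (if (k < K)%N then a k else 0) + (if (k < L)%N then b k else 0)).
move=> z z1; have -> : \sum_(k < maxn K L) z ^+ k *: (c *: (if (k < K)%N then a k else 0) +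
    (if (k < L)%N then b k else 0)) =
    c *: (\sum_(k < K) z ^+ k *: a k) + \sum_(k < L) z ^+ k *: b k.
  rewrite -(disc_poly_widen z a (leq_maxl K L)) -(disc_poly_widen z b (leq_maxr K L)).
  rewrite scaler_sumr -big_split; apply: eq_bigr => k _.
  by rewrite scalerDr !scalerA mulrC.
rewrite opprD addrACA -scalerBr (le_trans (hnorm_triangle _ _))// (splitr e) lerD ?bP//.
rewrite hnorm_scale; have := aP z z1; rewrite ler_pdivlMr// mulrC => h.
by apply: le_trans h; rewrite ler_wpM2r ?hnorm_ge0// lerDl.
Qed.

Lemma disc_approx_sum (I : Type) (r : seq I) (F : I -> R[i] -> H) :
  (forall i, disc_approx (F i)) -> disc_approx (fun z => \sum_(i <- r) F i z).
Proof.
move=> Fa; elim: r => [|i r IH].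
  have -> : (fun z => \sum_(i <- [::]) F i z) = (fun=> 0).
    by apply/funext => z; rewrite big_nil.
  exact: disc_approx_cst.
have -> : (fun z => \sum_(j <- i :: r) F j z) = (fun z => 1 *: F i z + \sum_(j <- r) F j z).
  by apply/funext => z; rewrite big_cons scale1r.
exact: disc_approx_lin.
Qed.

Lemma disc_approx_mulX k v : disc_approx v -> disc_approx (fun z => z ^+ k *: v z).
Proof.
move=> va e e0; have [K [a aP]] := va e e0.
exists (k + K)%N, (fun j => if (j < k)%N then 0 else a (j - k)%N) => z z1.
rewrite big_split_ord /= big1 ?add0r => [|j _]; last by rewrite ltn_ord scaler0.
have -> : \sum_(i < K) z ^+ (k + i) *: (if (k + i < k)%N then 0 else a (k + i - k)%N) =
    z ^+ k *: \sum_(i < K) z ^+ i *: a i.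
  rewrite scaler_sumr; apply: eq_bigr => i _.
  by rewrite ltnNge leq_addr /= addKn exprD scalerA.
rewrite -scalerBr hnorm_scale cabsX (le_trans _ (aP z z1))//.
by rewrite ler_piMl ?hnorm_ge0// exprn_ile1// cabs_ge0.
Qed.

Lemma disc_approx_limit v :
  (forall e : R, 0 < e -> exists2 u, disc_approx u &
     forall z, cabs z <= 1 -> hnorm (v z - u z) <= e) -> disc_approx v.
Proof.
move=> vu e e0; have e2 : 0 < e / 2 by rewrite divr_gt0.
have [u ua uv] := vu _ e2; have [K [a aP]] := ua _ e2; exists K, a => z z1.
rewrite -(subrKA (u z)) (le_trans (hnorm_triangle _ _))// (splitr e).
by rewrite lerD ?uv ?aP.
Qed.

Lemma disc_approx_apply (Phi : R[i] -> H -> H) v :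
  (forall z, cabs z <= 1 -> linear (Phi z) /\ bound_by 1 (Phi z)) ->
  (forall x, disc_approx (fun z => Phi z x)) ->
  disc_approx v -> disc_approx (fun z => Phi z (v z)).
Proof.
move=> Phil Phia va; apply: disc_approx_limit => e e0.
have [K [a aP]] := va e e0.
exists (fun z => \sum_(k < K) z ^+ k *: Phi z (a k)).
  by apply: disc_approx_sum => k; exact: disc_approx_mulX.
move=> z z1; have [Pl Pb] := Phil z z1.
have -> : \sum_(k < K) z ^+ k *: Phi z (a k) = Phi z (\sum_(k < K) z ^+ k *: a k).
  by rewrite (linf_sum Pl); apply: eq_bigr => k _; rewrite (linfZ Pl).
by rewrite -(linfB Pl) (le_trans (Pb _))// mul1r aP.
Qed.

Lemma disc_approx_bounded v : disc_approx v ->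
  exists2 C : R, 0 <= C & forall z, cabs z <= 1 -> hnorm (v z) <= C.
Proof.
move=> /(_ 1 ltr01)[K [a aP]].
have S0 : 0 <= \sum_(k < K) hnorm (a k) by apply: sumr_ge0 => k _; exact: hnorm_ge0.
exists (1 + \sum_(k < K) hnorm (a k)); first by rewrite addr_ge0.
move=> z z1; rewrite -[v z](subrK (\sum_(k < K) z ^+ k *: a k)).
rewrite (le_trans (hnorm_triangle _ _))// lerD ?aP//.
rewrite (le_trans (hnorm_sum _ _))//; apply: ler_sum => k _.
by rewrite hnorm_scale cabsX ler_piMl ?hnorm_ge0// exprn_ile1// cabs_ge0.
Qed.

(** Paired with y, the approximating polynomials have bounded coefficients by
    Cauchy's estimate and are small on [0, d], hence small at t. *)
Lemma disc_approx_identity v (d : R) : disc_approx v -> 0 < d ->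
  (forall t, 0 <= t <= d -> t <= 1 -> v (t%:C)%C = 0) ->
  forall t, 0 <= t < 1 -> v (t%:C)%C = 0.
Proof.
move=> va d0 v0 t t01; have /andP[t0 t1] := t01.
have [C C0 vC] := disc_approx_bounded va.
apply: hdot_ext => y; rewrite hdot0r hdotC.
suff -> : hdot (v (t%:C)%C) y = 0 by rewrite rmorph0.
apply: cabs_eq0; apply/eqP; rewrite eq_le cabs_ge0 andbT.
apply/ler_addgt0Pl => eta eta0; rewrite addr0.
have y1 : 0 < hnorm y + 1 by rewrite ltr_wpDl// hnorm_ge0.
have M0 : 0 <= (C + 1) * (hnorm y + 1) by rewrite mulr_ge0 ?(ltW y1)// addr_ge0.
have eta2 : 0 < eta / 2 by rewrite divr_gt0.
have d1 : 0 < Num.min d 1 by rewrite lt_min d0 ltr01.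
have [e e0 eP] := small_values M0 d1 t01 eta2.
pose e' := Num.min 1 (Num.min (e / (hnorm y + 1)) (eta / 2 / (hnorm y + 1))).
have e'0 : 0 < e' by rewrite !lt_min ltr01 !divr_gt0.
have [K [a aP]] := va e' e'0.
pose p := \poly_(k < K) hdot (a k) y.
have pE z : p.[z] = hdot (\sum_(k < K) z ^+ k *: a k) y.
  rewrite horner_poly hdot_suml; apply: eq_bigr => k _.
  by rewrite hdotZl mulrC.
have e'y (b : R) : 0 < b -> e' <= b / (hnorm y + 1) -> e' * hnorm y <= b.
  move=> b0; rewrite ler_pdivlMr// => h; apply: le_trans h.
  by rewrite ler_wpM2l ?(ltW e'0)// lerDl.
have dist z (b : R) : cabs z <= 1 -> 0 < b -> e' <= b / (hnorm y + 1) ->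
    cabs (hdot (v z) y - p.[z]) <= b.
  move=> z1 b0 /(e'y b b0); apply: le_trans.
  rewrite pE -hdotBl (le_trans (cauchy_schwarz _ _))//.
  by rewrite ler_wpM2r ?hnorm_ge0// aP.
have real_le1 (x : R) : 0 <= x <= 1 -> cabs (x%:C)%C <= 1.
  by move=> /andP[x0 x1]; rewrite cabs_real ger0_norm.
have pt : cabs p.[(t%:C)%C] <= eta / 2.
  apply: eP.
    apply: coef_le_circle_sup => z z1.
    rewrite pE (le_trans (cauchy_schwarz _ _))// ler_pM ?hnorm_ge0// ?lerDl//.
    rewrite -(subrK (v z) (\sum_(k < K) _)) (le_trans (hnorm_triangle _ _))// addrC.
    rewrite lerD ?vC ?z1// hnorm_subC (le_trans (aP _ _)) ?z1//.
    by rewrite /e' ge_min lexx.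
  move=> u /andP[u0]; rewrite le_min => /andP[ud u1].
  have := dist (u%:C)%C e; rewrite v0 ?u0// hdot0l sub0r cabsN; apply => //.
    by apply: real_le1; rewrite u0.
  by rewrite /e' !ge_min lexx orbT.
rewrite -(subrK p.[(t%:C)%C] (hdot _ _)) (le_trans (cabsD _ _))// (splitr eta).
rewrite lerD//; apply: dist => //; first by apply: real_le1; rewrite t0 ltW.
by rewrite /e' !ge_min lexx !orbT.
Qed.

End DiscApproximation.

(** * Uniqueness for compositions of free holomorphic functions *)

Section DiscSlices.
Variables (R : realType) (n : nat) (H : hilbertType R).
Local Notation series := (ncseries R n).
Implicit Types (psi : series) (X : 'I_n -> H -> H) (z w : R[i]).

Definition disc_slice X z : 'I_n -> H -> H := fun i x => z *: X i x.

Lemma scale_disc_slice X (t : R) : scale_tuple t X = disc_slice X (t%:C)%C.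
Proof. by apply/funext => i; apply/funext => x. Qed.

Lemma bounded_disc_slice X z : bounded_tuple X -> bounded_tuple (disc_slice X z).
Proof. by move=> Xb i; exact: (boundedZ z (Xb i)). Qed.

Lemma wact_disc_slice X z a x : bounded_tuple X ->
  wact (disc_slice X z) a x = z ^+ size a *: wact X a x.
Proof.
move=> Xb; elim: a => [|i a IH] /=; first by rewrite expr0 scale1r.
by rewrite IH /disc_slice (linfZ (tuple_linear Xb i)) scalerA exprS.
Qed.

Lemma degree_term_disc_slice psi X z k x : bounded_tuple X ->
  degree_term psi (disc_slice X z) k x = z ^+ k *: degree_term psi X k x.
Proof.
move=> Xb; rewrite /degree_term /degree_sum scaler_sumr; apply: eq_bigr => a _.
by rewrite wact_disc_slice// size_tuple !scalerA mulrC.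
Qed.

Lemma peval_disc_slice psi X z N x : bounded_tuple X ->
  peval (disc_slice X z) N psi x = \sum_(k < N) z ^+ k *: degree_term psi X k x.
Proof.
move=> Xb; rewrite /peval wsumE; apply: eq_bigr => k _.
exact: degree_term_disc_slice.
Qed.

Lemma tame_disc_slice c s psi X z : 0 <= c -> 0 <= s -> bounded_tuple X ->
  cabs z <= 1 -> tame c s psi X -> tame c s psi (disc_slice X z).
Proof.
move=> c0 s0 Xb z1 t k x; rewrite degree_term_disc_slice// hnorm_scale cabsX.
by rewrite (le_trans _ (t k x))// ler_piMl ?hnorm_ge0// exprn_ile1 ?cabs_ge0.
Qed.

Lemma row_bound_disc_slice rho X z : row_bound rho X -> cabs z <= 1 ->
  row_bound rho (disc_slice X z).
Proof.
move=> Xr z1 x; rewrite /disc_slice -scaler_sumr hnorm_scale.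
apply: le_trans (Xr x); rewrite lerXn2r ?nnegrE ?hnorm_ge0 ?mulr_ge0 ?cabs_ge0 ?hnorm_ge0//.
by rewrite ler_piMl ?hnorm_ge0.
Qed.

Lemma cabs_subX z w k : cabs z <= 1 -> cabs w <= 1 ->
  cabs (z ^+ k - w ^+ k) <= k%:R * cabs (z - w).
Proof.
move=> z1 w1; elim: k => [|k IH]; first by rewrite !expr0 subrr cabs0 mul0r.
have -> : z ^+ k.+1 - w ^+ k.+1 = z * (z ^+ k - w ^+ k) + (z - w) * w ^+ k.
  by rewrite !exprS; ring.
rewrite (le_trans (cabsD _ _))// !cabsM cabsX.
have h1 : cabs z * cabs (z ^+ k - w ^+ k) <= k%:R * cabs (z - w).
  by apply: le_trans IH; rewrite ler_piMl ?cabs_ge0.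
have h2 : cabs (z - w) * cabs w ^+ k <= cabs (z - w).
  by rewrite ler_piMr ?cabs_ge0// exprn_ile1 ?cabs_ge0.
by rewrite -natr1 mulrDl mul1r lerD.
Qed.

Lemma hnorm_lim_le (u : nat -> H) l (b C : R) : 0 <= b ->
  u N @[N --> \oo] --> l -> (forall N, hnorm (u N) * b <= C) -> hnorm l * b <= C.
Proof.
move=> b0 /hcvgP ul uC; apply/ler_addgt0Pl => e e0.
have b1 : 0 < b + 1 by rewrite ltr_wpDl.
have [N _ NP] := ul (e / (b + 1)) (divr_gt0 e0 b1).
have h : hnorm (l - u N) * b <= e.
  have := NP N (leqnn N); rewrite hnorm_subC ler_pdivlMr// => h; apply: le_trans h.
  by rewrite ler_wpM2l ?hnorm_ge0// lerDl.
rewrite -(subrK (u N) l) (@le_trans _ _ ((hnorm (l - u N) + hnorm (u N)) * b))//.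
  by rewrite ler_wpM2r// hnorm_triangle.
by rewrite mulrDl lerD.
Qed.

Section Composition.
Variables (f : 'I_n -> series) (X : 'I_n -> H -> H) (c s : R).
Hypotheses (Xb : bounded_tuple X) (c0 : 0 <= c) (s01 : 0 <= s < 1).
Hypothesis ft : forall i, tame c s (f i) X.

Local Notation Phi z := (eval_tuple f (disc_slice X z)).

Lemma slice_geom_sum z i : cabs z <= 1 -> geom_sum (f i) (disc_slice X z) (Phi z i).
Proof.
move=> z1; have /andP[s0 _] := s01; have Zb := bounded_disc_slice z Xb.
have [A gA] := tame_geom_sum Zb c0 s01 (tame_disc_slice c0 s0 Xb z1 (ft i)).
by rewrite /eval_tuple (series_eval_geom Zb gA).
Qed.

Lemma disc_approx_slice i x : disc_approx (fun z => Phi z i x).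
Proof.
move=> e e0; have /andP[s0 s1] := s01; have s10 : 0 < 1 - s by rewrite subr_gt0.
have q0 : 0 <= c * hnorm x by rewrite mulr_ge0 ?hnorm_ge0.
have q1 : 0 < c * hnorm x + 1 by rewrite ltr_wpDl.
have [N NP] := geometric_small s01 (divr_gt0 (mulr_gt0 e0 s10) q1).
exists N, (fun k => degree_term (f i) X k x) => z z1.
rewrite -peval_disc_slice// -(ler_pM2r s10).
have := tame_geom_error N s01 c0 (tame_disc_slice c0 s0 Xb z1 (ft i))
  (geom_sum_cvg (x := x) (slice_geom_sum i z1)).
move=> h; apply: (le_trans h); rewrite mulrAC.
have := NP N (leqnn N); rewrite ler_pdivlMr// => h2; apply: le_trans h2.
by rewrite mulrC ler_wpM2l ?exprn_ge0// lerDl.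
Qed.

(** The difference of z^k and w^k is at most k |z - w|, and weights linear in k are
    absorbed by the geometric decay. *)
Lemma slice_lipschitz i x z w : cabs z <= 1 -> cabs w <= 1 ->
  hnorm (Phi z i x - Phi w i x) * (1 - s) ^+ 2 <= c * cabs (z - w) * hnorm x.
Proof.
move=> z1 w1; apply: (hnorm_lim_le (u := fun N => peval (disc_slice X z) N (f i) x -
  peval (disc_slice X w) N (f i) x)); first exact: sqr_ge0.
  by apply: cvgB; apply: geom_sum_cvg; exact: slice_geom_sum.
move=> N; rewrite !peval_disc_slice// -sumrB.
under eq_bigr do rewrite -scalerBl.
apply: (@tame_weighted _ _ _ c s (f i) X (fun k => z ^+ k - w ^+ k) (cabs (z - w))) => //.
  exact: cabs_ge0.
by move=> k; exact: cabs_subX.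
Qed.

Hypothesis Phi_ball : forall z, cabs z <= 1 -> op_ball 1 (Phi z).

Lemma slice_local z : exists2 eta : R, 0 < eta & exists2 rho : R, 0 <= rho < 1 &
  forall w, cabs w <= 1 -> cabs (w - z) <= eta -> row_bound rho (Phi w).
Proof.
(* Around a z outside the disc the claim is vacuous. *)
have [z1|z1] := leP (cabs z) 1; last first.
  exists ((cabs z - 1) / 2); first by rewrite divr_gt0// subr_gt0.
  exists 0 => [|w w1 wz]; first by rewrite lexx ltr01.
  have := cabsD w (- (w - z)); rewrite cabsN opprB addrC subrK; lra.
have [rho /andP[r0 r1] zr] := op_ball_row_bound (Phi_ball z1).
have /andP[s0 s1] := s01.
have s2 : 0 < (1 - s) ^+ 2 by rewrite exprn_gt0// subr_gt0.
pose K := n%:R * (c / (1 - s) ^+ 2) + 1.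
have K'0 : 0 <= n%:R * (c / (1 - s) ^+ 2).
  by rewrite mulr_ge0// divr_ge0// ltW.
have K0 : 0 < K by rewrite ltr_wpDl.
pose eta := (1 - rho) / 2 / K.
have eta0 : 0 < eta by rewrite !divr_gt0// subr_gt0.
have etaK : eta * K = (1 - rho) / 2 by rewrite /eta divfK// gt_eqF.
exists eta => //; exists (rho + (1 - rho) / 2); first by apply/andP; split; lra.
move=> w w1 wz; apply: (row_bound_perturb r0 _ zr); first by lra.
have small : 0 <= n%:R * (c / (1 - s) ^+ 2 * eta) <= (1 - rho) / 2.
  rewrite -etaK /K mulrA mulr_ge0 ?(ltW eta0)//=.
  by rewrite mulrC ler_wpM2l ?(ltW eta0)// lerDl.
apply: (row_bound_le small); apply: bound_row_bound.
  by rewrite mulr_ge0 ?(ltW eta0)// divr_ge0// ltW.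
move=> i x; have := slice_lipschitz i x w1 z1.
rewrite -ler_pdivlMr// => h; apply: (le_trans h).
have -> : c * cabs (w - z) * hnorm x / (1 - s) ^+ 2 =
  c / (1 - s) ^+ 2 * cabs (w - z) * hnorm x by ring.
by rewrite ler_wpM2r ?hnorm_ge0// ler_wpM2l// divr_ge0// ltW.
Qed.

(** The closed disc being compact, f maps the whole disc of multiples of X into
    one ball of radius smaller than 1. *)
Lemma slice_uniform : exists2 rho : R, 0 <= rho < 1 &
  forall z, cabs z <= 1 -> row_bound rho (Phi z).
Proof.
pose K : set (R * R) := `[-1, 1]%classic `*` `[-1, 1]%classic.
have Kc : compact K by apply: compact_setX; exact: segment_compact.
pose good (rho : R) (u : R * R) := 0 <= rho < 1 /\
  (cabs (Complex u.1 u.2) <= 1 -> row_bound rho (Phi (Complex u.1 u.2))).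
have cabs_le (a b : R) : cabs (Complex a b) <= `|a| + `|b|.
  rewrite -(@ler_pXn2r _ 2) ?nnegrE ?cabs_ge0 ?addr_ge0// -sqnE /sqn /=.
  rewrite -(real_normK (num_real a)) -(real_normK (num_real b)).
  have : 0 <= `|a| * `|b| by rewrite mulr_ge0.
  by rewrite sqrrD mulr2n; lra.
have /compact_near_coveringP /(_ R (1^'-) good) := Kc.
case/(_ _ _)/wrap.
  move=> [a b] _ /=; have [eta eta0 [rho /andP[r0 r1] h]] := slice_local (Complex a b).
  have e2 : 0 < eta / 2 by rewrite divr_gt0.
  exists (ball (a, b) (eta / 2), [set r | rho < r < 1]) => /=.
    split; first exact: nbhsx_ballx.
    near=> r; apply/andP; split; near: r.
      exact: nbhs_left_gt.
    exact: nbhs_left_lt.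
  move=> [[a' b'] r] /= [[aa bb] /andP[rr rr1]]; split.
    by rewrite (ltW (le_lt_trans r0 rr)).
  move=> w1; apply: (@row_bound_le _ _ _ rho); first by rewrite r0 ltW.
  apply: h => //=.
  have -> : Complex a' b' - Complex a b = Complex (a' - a) (b' - b) by [].
  rewrite (le_trans (cabs_le _ _))//; rewrite /ball /= in aa bb.
  by rewrite distrC [`|b' - b|]distrC; lra.
move=> good1; have [rho rhoP] := @filter_ex _ (1^'- : set_system R) _ _ good1.
have r01 : 0 <= rho < 1.
  by case: (rhoP (0, 0)) => //; split=> /=; rewrite in_itv /=; lra.
exists rho => // -[a b] z1.
case: (rhoP (a, b)) => [|_ h]; last exact: h.
have aux : `|a| <= 1 /\ `|b| <= 1.
  have : sqn (Complex a b) <= 1 by rewrite sqnE exprn_ile1// cabs_ge0.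
  rewrite /sqn /= -(real_normK (num_real a)) -(real_normK (num_real b)).
  have := normr_ge0 a; have := normr_ge0 b; split; nra.
by case: aux; rewrite !ler_norml => ha hb; split=> /=; rewrite in_itv.
Unshelve. all: by end_near. Qed.

Lemma disc_approx_composition (G : series) x : growth 1 G ->
  disc_approx (fun z => series_eval G (Phi z) x) /\
  forall z, cabs z <= 1 -> geom_sum G (Phi z) (series_eval G (Phi z)).
Proof.
move=> Gg; have [rho /andP[r0 r1] Phir] := slice_uniform.
have [c' c'0 c't] := growth_tame_uniform H ler01 Gg.
have rho1 : 0 <= rho < 1 by rewrite r0.
have Phib z : cabs z <= 1 -> bounded_tuple (Phi z).
  by move=> z1 i; case: (slice_geom_sum i z1).
have Gt z (z1 : cabs z <= 1) : tame c' rho G (Phi z).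
  by have := c't _ _ (Phib z z1) r0 (Phir z z1); rewrite mulr1.
have Gs z (z1 : cabs z <= 1) : geom_sum G (Phi z) (series_eval G (Phi z)).
  have [A gA] := tame_geom_sum (Phib z z1) c'0 rho1 (Gt z z1).
  by rewrite (series_eval_geom (Phib z z1) gA).
split=> //; apply: disc_approx_limit => e e0.
have s10 : 0 < 1 - rho by rewrite subr_gt0.
have q0 : 0 <= c' * hnorm x by rewrite mulr_ge0 ?hnorm_ge0.
have q1 : 0 < c' * hnorm x + 1 by rewrite ltr_wpDl.
have [N NP] := geometric_small rho1 (divr_gt0 (mulr_gt0 e0 s10) q1).
exists (fun z => peval (Phi z) N G x).
  rewrite /peval /wsum; apply: disc_approx_sum => k; apply: disc_approx_sum => a.
  have -> : (fun z => G a *: wact (Phi z) a x) = (fun z => G a *: wact (Phi z) a x + 0).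
    by apply/funext => z; rewrite addr0.
  apply: disc_approx_lin; last exact: disc_approx_cst.
  elim: (val a) => [|i w IH] /=; first exact: disc_approx_cst.
  apply: (disc_approx_apply (Phi := fun z => Phi z i)) => // [z z1|y].
    split; first by case: (Phib z z1 i).
    apply: (row_bound_component i (Phib z z1) ler01).
    by apply: row_bound_le (Phir z z1); rewrite r0 ltW.
  exact: disc_approx_slice.
move=> z z1; rewrite -(ler_pM2r s10).
have h := tame_geom_error N rho1 c'0 (Gt z z1) (geom_sum_cvg (x := x) (Gs z z1)).
apply: (le_trans h); rewrite mulrAC.
have := NP N (leqnn N); rewrite ler_pdivlMr// => h2; apply: le_trans h2.
by rewrite mulrC ler_wpM2l ?exprn_ge0// lerDl.
Qed.

End Composition.

(** Uniqueness for G o f: on the disc of multiples of a point, G o f is a uniform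
    limit of polynomials, so if it vanishes on a small ball it vanishes. *)
Lemma composition_identity (gamma gamma' : R) (f : 'I_n -> series) (G : series) :
  0 < gamma -> 0 < gamma' -> (forall i, free_holomorphic gamma (f i)) ->
  (forall X : 'I_n -> H -> H, op_ball gamma X -> op_ball 1 (eval_tuple f X)) ->
  growth 1 G ->
  (forall X : 'I_n -> H -> H, op_ball gamma X -> op_ball gamma' X ->
     series_eval G (eval_tuple f X) = 0) ->
  forall X : 'I_n -> H -> H, op_ball gamma X -> series_eval G (eval_tuple f X) = 0.
Proof.
move=> g0 g'0 fh fb Gg Gs X Xg; have [Xb _] := Xg.
have [rho0 /andP[r0 rg] Xr] := op_ball_row_bound Xg.
(* t0 < 1 is such that X / t0 is still in the ball, so that X is an interior point
   of the disc of multiples of X / t0. *)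
pose t0 := (rho0 / gamma + 1) / 2.
have q01 : 0 <= rho0 / gamma < 1.
  by rewrite divr_ge0 ?(ltW g0)//= ltr_pdivrMr// mul1r.
have t01 : 0 < t0 < 1 by rewrite /t0; apply/andP; split; lra.
have /andP[t00 t1] := t01.
pose X1 := scale_tuple t0^-1 X; pose rho1 := t0^-1 * rho0.
have X1b : bounded_tuple X1 := bounded_scale_tuple t0^-1 Xb.
have X1r : row_bound rho1 X1 by exact: row_bound_scale.
have rho10 : 0 <= rho1 by rewrite mulr_ge0// invr_ge0 ltW.
have rho1g : rho1 < gamma.
  rewrite /rho1 mulrC ltr_pdivrMr// mulrC -ltr_pdivrMr// /t0; lra.
have mid0 : 0 < (rho1 + gamma) / 2 by lra.
pose tau := ((rho1 + gamma) / 2)^-1.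
have tau0 : 0 < tau by rewrite invr_gt0.
have taug : gamma^-1 < tau by rewrite ltf_pV2 ?posrE//; lra.
have s01 : 0 <= rho1 * tau < 1.
  rewrite mulr_ge0 ?(ltW tau0)//= /tau ltr_pdivrMr// mul1r; lra.
have /choice[cc ccP] i : exists c, 0 <= c /\ tame c (rho1 * tau) (f i) X1.
  have [c c0 ct] := growth_tame X1b rho10 (ltW tau0) X1r
    (free_holomorphic_growth g0 taug (fh i)).
  by exists c.
pose c := \sum_i cc i.
have c0 : 0 <= c by apply: sumr_ge0 => i _; case: (ccP i).
have ct i : tame c (rho1 * tau) (f i) X1.
  move=> k x; have [ci0 ci] := ccP i; apply: (le_trans (ci k x)).
  rewrite ler_wpM2r ?hnorm_ge0// ler_wpM2r ?exprn_ge0//; first by case/andP: s01.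
  by rewrite /c (bigD1 i)//= lerDl; apply: sumr_ge0 => j _; case: (ccP j).
have slice_ball z : cabs z <= 1 -> op_ball gamma (disc_slice X1 z).
  move=> z1; apply: (@row_bound_op_ball _ _ _ _ rho1).
  - exact: bounded_disc_slice.
  - by rewrite rho10.
  - exact: row_bound_disc_slice.
have Phib z : cabs z <= 1 -> op_ball 1 (eval_tuple f (disc_slice X1 z)).
  by move=> z1; apply: fb; exact: slice_ball.
have XE : X = disc_slice X1 (t0%:C)%C.
  apply/funext => i; apply/funext => x; rewrite /disc_slice /X1 /scale_tuple scalrfctE.
  by rewrite scalerA -rmorphM mulfV ?gt_eqF// scale1r.
apply/funext => x; rewrite XE.
have [approx _] := disc_approx_composition X1b c0 s01 ct Phib x Gg.
pose d := Num.min 1 (gamma' / 2 / (rho1 + 1)).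
have rho1p : 0 < rho1 + 1 by rewrite ltr_wpDl.
have d0 : 0 < d by rewrite lt_min ltr01 !divr_gt0.
apply: (disc_approx_identity approx d0) => [t /andP[t0' td] tl1|]; last by rewrite ltW.
have tc : cabs (t%:C)%C <= 1 by rewrite cabs_real ger0_norm.
rewrite Gs//; first exact: slice_ball.
rewrite -scale_disc_slice.
apply: (row_bound_op_ball (bounded_scale_tuple t X1b) _ (row_bound_scale t X1b X1r)).
rewrite mulr_ge0//=.
have : d * (rho1 + 1) <= gamma' / 2.
  by rewrite -ler_pdivlMr// /d ge_min lexx orbT.
have : t * rho1 <= d * (rho1 + 1) by rewrite ler_pM// lerDl.
lra.
Qed.

End DiscSlices.

(** * Decay of the coordinates *)

Section ScaledSeries.
Variables (R : realType) (n : nat).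
Local Notation series := (ncseries R n).
Local Notation fock := (l2 R n).
Implicit Types (f : 'I_n -> series) (p : series) (r : R).

Definition scale_series r f : 'I_n -> series := fun i => (r%:C)%C *: f i.

Lemma series_word_scale r f a :
  series_word (scale_series r f) a = (r%:C)%C ^+ size a *: series_word f a.
Proof.
elim: a => [|i a IH] /=; first by rewrite expr0 scale1r.
rewrite IH (linfZ (@linear_series_mul R n _)) (linfZ (@linear_series_mull R n _)).
by rewrite scalerA exprSr.
Qed.

(** Scaling f moves the radius into the coefficients, the source of decay. *)
Lemma series_comp_scale N r p f :
  series_comp N p (scale_series r f) = series_comp N (dilate r p) f.
Proof.
by apply: eq_wsum => a; rewrite series_word_scale scalerA /dilate mulrC.
Qed.

Lemma dilate_square_summable r (c : fock) : 0 <= r <= 1 ->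
  dilate r c \in @square_summable R n.
Proof.
move=> r01; apply/square_summableP.
have /square_summableP[C cC] := l2valP c; exists C => N.
apply: le_trans (cC N); apply: ler_wsum => a.
rewrite /dilate sqnM ler_piMl ?sqn_ge0// sqnE cabsX cabs_real -exprM.
have /andP[r0 r1] := r01; by rewrite ger0_norm// exprn_ile1.
Qed.

Lemma peval_word_poly (H : hilbertType R) (X : 'I_n -> H -> H) N f a L x :
  bounded_tuple X -> (forall i, degree_lt N (f i)) -> (size a * N + 1 <= L)%N ->
  peval X L (series_word f a) x = wact (fun i => peval X N (f i)) a x.
Proof.
move=> Xb fN; elim: a L => [|i a IH] L aL /=.
  have -> : @series_one R n = mono R [::] by [].
  by rewrite peval_mono// -addn1.
have aL' : (N + size a * N + 1 <= L)%N by rewrite -mulSn; exact: aL.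
have -> : L = (N + (L - N))%N by rewrite subnKC//; move: aL'; lia.
rewrite peval_mul; first by rewrite IH//; move: aL'; lia.
- exact: tuple_linear.
- exact: fN.
- apply: (@degree_lt_leq _ _ (size a * N).+1); last exact: degree_lt_word.
  by move: aL'; lia.
Qed.

Lemma peval_comp_poly (H : hilbertType R) (X : 'I_n -> H -> H) N f K p L x :
  bounded_tuple X -> (forall i, degree_lt N (f i)) -> (K * N + 1 <= L)%N ->
  peval X L (series_comp K p f) x = peval (fun i => peval X N (f i)) K p x.
Proof.
move=> Xb fN KL; rewrite {1}/series_comp.
rewrite (linf_wsum _ _ (@peval_linear R n H X L x)).
apply: eq_wsum_lt => a aK; rewrite (linfZ (@peval_linear R n H X _ x)).
rewrite (peval_word_poly x Xb fN)// (leq_trans _ KL)//.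
by rewrite leq_add2r leq_mul2r ltnW ?orbT.
Qed.

End ScaledSeries.

Section Decay.
Variables (R : realType) (n : nat) (H0 : hilbertType R).
Local Notation series := (ncseries R n).
Local Notation fock := (l2 R n).
Hypothesis H0_inf : infinite_dimensional H0.
Implicit Types (f : 'I_n -> series) (rho : realization R n) (r : R).

Lemma model_coordinates f rho : model_case H0 f rho ->
  exists c : 'I_n -> fock, forall i, @represents _ _ rho (c i) (@coord_fun _ _ rho i).
Proof.
case=> [N q fqN _ qf|_ _ _ cc _|gamma _ _ _ _ cc _]; [|by have [c cP] := choice (fun i => cc i); exists c..].
exists (fun i => L2 (poly_square_summable (fqN i).2)) => i /=.
by exists N; [exact: (fqN i).2|rewrite qf].
Qed.

Lemma formal_identity f rho (c : fock) i : model_case H0 f rho ->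
  (forall i, f i [::] = 0) -> @represents _ _ rho c (@coord_fun _ _ rho i) ->
  forall w, series_X R i w = series_comp (size w).+1 c f w.
Proof.
move=> mc f0; case: mc c => [N q _ _ _|_ _ _ _ _|gamma g0 _ _ _ _ _] c /=.
- move=> [K cK ->] w.
  rewrite -(series_comp_stable f0 _ (leq_maxr K (size w).+1)) !series_compE.
  by rewrite (peval_stable _ _ cK (leq_maxl _ _)).
- by move=> cX w; exact: cX.
- by move=> cX; exact: (function_formal H0_inf g0 f0 cX).
Qed.

(** Both families are coordinates of Z_i with respect to f, which are unique
    because f is invertible to first order. *)
Lemma formal_decay f rho rho' r (c c' : fock) i : model_case H0 f rho ->
  model_case H0 (scale_series r f) rho' -> (forall i, f i [::] = 0) ->
  \det (\matrix_(i, j) f i [:: j]) != 0 ->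
  @represents _ _ rho c (@coord_fun _ _ rho i) ->
  @represents _ _ rho' c' (@coord_fun _ _ rho' i) -> l2val c = dilate r c'.
Proof.
move=> mc mc' f0 fdet cX c'X.
have rf0 j : scale_series r f j [::] = 0.
  by rewrite /scale_series scalrfctE f0; exact: mulr0.
apply/eqP; rewrite -subr_eq0; apply/eqP/(formal_comp_inj f0 fdet) => w.
rewrite series_compB addrfctE opprfctE -series_comp_scale.
by rewrite -(formal_identity mc f0 cX) -(formal_identity mc' rf0 c'X) subrr.
Qed.

Lemma geom_sumZ (H : hilbertType R) k (psi : series) (Y : 'I_n -> H -> H) A :
  bounded_tuple Y -> geom_sum psi Y A -> geom_sum (k *: psi) Y (k *: A).
Proof.
move=> Yb gA; have z : geom_sum (0 : series) Y (peval Y 0 (0 : series)).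
  by apply: geom_sum_poly => // w _.
have := geom_sum_lin k gA z.
have -> : peval Y 0 (0 : series) = 0 by apply/funext => x; rewrite /peval wsum0.
by rewrite !addr0.
Qed.

(** In the polynomial and the function models the coordinates are recovered from
    f(X) near 0; in the formal model f is a formal diffeomorphism at 0. *)
Lemma coordinate_recovery f rho (c : fock) i : model_case H0 f rho ->
  @represents _ _ rho c (@coord_fun _ _ rho i) ->
  ((forall i, f i [::] = 0) /\ \det (\matrix_(i, j) f i [:: j]) != 0) \/
  exists2 gamma : R, 0 < gamma & forall X : 'I_n -> H0 -> H0, op_ball gamma X ->
    geom_sum c (eval_tuple f X) (X i).
Proof.
move=> mc; case: mc c => [N q fqN _ _|f0 _ fdet _ _|gamma g0 _ fb _ _ _] c /=.
- move=> [K cK cX]; right; exists 1; first exact: ltr01.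
  move=> X [Xb _]; have fN j : degree_lt N (f j) by case: (fqN j).
  have fE : eval_tuple f X = fun j => peval X N (f j).
    apply/funext => j; apply: (series_eval_geom Xb).
    by apply: geom_sum_poly.
  have Yb : bounded_tuple (eval_tuple f X) by rewrite fE => j; exact: bounded_peval.
  suff -> : X i = peval (eval_tuple f X) K c by exact: geom_sum_poly.
  apply/funext => x; rewrite fE -(peval_comp_poly (L := K * N + 2) c x Xb fN) ?leq_add2l//.
  by rewrite -cX -mono1 peval_mono//= addn2.
- by left.
- move=> cX; right; exists gamma => // X Xg.
  by rewrite (cX X Xg); apply: l2_geom_sum; exact: fb.
Qed.

(** Both families recover X_i from f(X) on a small ball; their difference vanishes
    on f of this ball, hence on f of the whole ball of the model, hence is 0. *)
Lemma functional_decay f (gamma : R) r (c c' : fock) i : 0 < r <= 1 -> 0 < gamma ->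
  (forall i, free_holomorphic gamma (f i)) ->
  (forall X : 'I_n -> H0 -> H0, op_ball gamma X -> op_ball 1 (eval_tuple f X)) ->
  (forall G : series, free_holomorphic 1 G ->
     (forall X : 'I_n -> H0 -> H0,
       op_ball gamma X -> series_eval G (eval_tuple f X) = 0) -> G = 0) ->
  (forall X : 'I_n -> H0 -> H0, op_ball gamma X -> X i = series_eval c (eval_tuple f X)) ->
  (exists2 gamma' : R, 0 < gamma' & forall X : 'I_n -> H0 -> H0, op_ball gamma' X ->
    geom_sum c' (eval_tuple (scale_series r f) X) (X i)) ->
  l2val c = dilate r c'.
Proof.
move=> /andP[r0 r1] g0 fh fb finj cX [gamma' g'0 c'X].
have scaleE (X : 'I_n -> H0 -> H0) : op_ball gamma X ->
    eval_tuple (scale_series r f) X = scale_tuple r (eval_tuple f X).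
  move=> Xg; have [Xb _] := Xg; have [rho /andP[rho0 rg] Xr] := op_ball_row_bound Xg.
  apply/funext => j; rewrite /eval_tuple /scale_tuple; apply: series_eval_geom => //.
  pose tau := ((rho + gamma) / 2)^-1.
  have tau0 : 0 < tau by rewrite invr_gt0; lra.
  have taug : gamma^-1 < tau by rewrite ltf_pV2 ?posrE//; lra.
  have st : rho * tau < 1 by rewrite /tau ltr_pdivrMr; lra.
  have [A gA] := growth_geom_sum Xb rho0 (ltW tau0) st Xr
    (free_holomorphic_growth g0 taug (fh j)).
  by rewrite (series_eval_geom Xb gA); exact: geom_sumZ.
have r01 : 0 <= r <= 1 by rewrite ltW.
pose c'' : fock := L2 (dilate_square_summable c' r01).
pose G : fock := c - c''.
suff G0 : l2val G = 0 by apply/eqP; rewrite -subr_eq0; apply/eqP.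
apply: finj; first exact: l2_free_holomorphic.
apply: (composition_identity g0 g'0 fh fb (l2_growth G)) => X Xg Xg'.
have Y1 := fb X Xg; have [Yb _] := Y1.
have h1 : geom_sum c (eval_tuple f X) (X i) by rewrite (cX X Xg); exact: l2_geom_sum.
have h2 : geom_sum c'' (eval_tuple f X) (X i).
  by apply: (geom_sum_scale Yb); rewrite -scaleE//; exact: c'X.
apply: (series_eval_geom Yb).
have := geom_sum_lin (-1) h2 h1; rewrite [-1 *: X i]scaleN1r addNr.
suff -> : (-1 *: l2val c'' + l2val c) = l2val G :> series by [].
by apply/funext => w; rewrite addrfctE scalrfctE scaleN1r addrC.
Qed.

(** The radial approximation property makes the coefficients of g decay
    geometrically: they are r^|a| times square summable ones. *)
Theorem coordinate_decay f (M : 'I_n -> fock -> fock) g :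
  radial_approximation H0 f -> universal_model H0 f M g ->
  exists2 s : R, 0 <= s < 1 & forall i, growth s (g i).
Proof.
move=> [_ [delta [/andP[d0 d1] rad]]] [rho mc [_ gc]].
pose r := (1 + delta) / 2.
have r0 : 0 < r by rewrite /r; lra.
have r1 : r < 1 by rewrite /r; lra.
exists r => [|i]; first by rewrite ltW.
have [rho' mc'] : model_property H0 (scale_series r f).
  by apply: rad; rewrite /r; apply/andP; split; lra.
have [c' c'X] := model_coordinates mc'.
have [c cX ->] := gc i.
have decay : l2val c = dilate r (c' i) -> growth r c.
  by move=> ->; rewrite -[X in growth X _]mulr1; apply: growth_dilate; exact: l2_growth.
have formal : (forall i, f i [::] = 0) -> \det (\matrix_(i, j) f i [:: j]) != 0 ->
    growth r c.
  by move=> f0 fdet; apply: decay; exact: (formal_decay mc mc' f0 fdet cX (c'X i)).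
move: formal => {gc}; case: mc cX => [N q fqN _ _|f0 _ fdet _ _|gamma g0 fh fb finj _ _] /= cX formal.
- by case: cX => K cK _; exact: poly_growth cK.
- exact: formal.
- have [[rf0 rdet]|rec] := coordinate_recovery mc' (c'X i); last first.
    have r01 : 0 < r <= 1 by rewrite r0 ltW.
    exact: decay (functional_decay r01 g0 fh fb finj cX rec).
  have rn0 : (r%:C)%C != 0 :> R[i] by apply/eqP => /complexI /eqP; rewrite gt_eqF.
  apply: formal => [j|].
    by have := rf0 j; rewrite /scale_series scalrfctE => /eqP; rewrite scaler_eq0 (negbTE rn0) => /eqP.
  apply: contra rdet => /eqP fdet.
  have -> : \matrix_(i, j) scale_series r f i [:: j] = (r%:C)%C *: \matrix_(i, j) f i [:: j].
    by apply/matrixP => j k; rewrite !mxE.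
  by rewrite detZ fdet mulr0.
Qed.

End Decay.

(** * The theorem *)

Lemma bounded_eval_tuple (R : realType) (n : nat) (H : hilbertType R)
    (f : 'I_n -> ncseries R n) (Y : 'I_n -> H -> H) :
  conv_sot f Y \/ conv_rad f Y -> bounded_tuple (eval_tuple f Y).
Proof.
move=> cv i; rewrite /eval_tuple /series_eval; case: xgetP => [A _ [[]|[]]//|no].
by case: cv => -[_ /(_ i)[A sA]]; case: (no A); [left|right].
Qed.

Theorem theorem5p3 (R : realType) (n : nat) (n_gt0 : (0 < n)%N)
    (H0 : hilbertType R) (H0_inf : infinite_dimensional H0)
    (f : 'I_n -> ncseries R n) (f_rad : radial_approximation H0 f)
    (P : set (ncseries R n)) (P_hom : forall q, P q -> homogeneous q)
    (M : 'I_n -> l2 R n -> l2 R n) (g : 'I_n -> ncseries R n)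
    (M_model : universal_model H0 f M g)
    (H : hilbertType R) (T : 'I_n -> H -> H) (T_dom : op_domain f g T)
    (T_zero : forall q, P q -> series_eval q (eval_tuple f T) = 0) :
  let B := variety_model f M P in
  exists Psi : (variety_space f M P -> variety_space f M P) -> (H -> H),
    [/\ forall A, star_span B A -> bounded_op (Psi A),
        forall (k : R[i]) A A', star_span B A -> star_span B A' ->
          Psi (k *: A + A') = k *: Psi A + Psi A',
        forall a b, Psi (star_words B a b) = star_words T a b &
        completely_contractive (star_span B) Psi].
Proof.
move=> B; have [Mb Me Wb We Wh] := universal_model_facts M_model.
have [s s01 gs] := coordinate_decay H0_inf f_rad M_model.
have /andP[s0 s1] := s01.
case: T_dom => cvT T1 TE; pose Y := eval_tuple f T.
have Yb : bounded_tuple Y := bounded_eval_tuple cvT.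
have Yr : row_bound 1 Y := row_contraction Yb T1.
have gT i : geom_sum (g i) Y (T i).
  have s11 : 1 * s < 1 by rewrite mul1r.
  have [A gA] := growth_geom_sum Yb ler01 s0 s11 Yr (gs i).
  suff -> : T i = A by [].
  by apply: (geom_sum_unique Yb gA); case: TE => /(_ i) h; [left|right].
have Tb : bounded_tuple T by move=> i; case: (gT i).
have Bb : bounded_tuple B by move=> i; exact: bounded_compression.
apply: (star_span_map Bb Tb) => m c t.
apply: (row_contraction_form_bound Yb Yr Mb Me Wb We Wh gT s01 gs P_hom) => q Pq.
have [d qd] := P_hom q Pq.
have qN : degree_lt d.+1 q by move=> w dw; apply: qd; rewrite gtn_eqF.
exists d.+1 => // x.
by rewrite -(series_eval_geom Yb (geom_sum_poly Yb qN)) T_zero.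
Qed.
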